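(* Let $\lambda\in\mathbb{H}$ and let $\Omega\subset\mathbb{H}$ be an axially symmetric domain. Consider the eigenvalue problem $\partial f=f\lambda$ on $\Omega$, with $f\in\mathcal{AM}(\Omega)$. Write $\mathcal{L}_\lambda f=\partial f-f\lambda$ for $f\in\mathcal{AM}(\Omega)$ and $\mathcal{L}=\mathcal{L}_0$. The axially monogenic function $\Delta\exp_\lambda(x)\in\mathcal{AM}(\mathbb{H})$ is a solution of the problem on $\mathbb{H}$. If $\lambda\neq0$ and $\Omega$ is a slice domain, a function $f\in\mathcal{AM}(\Omega)$ is a solution if and only if $f=c\cdot\Delta\exp_\lambda(x)$ with $c\in\mathbb{H}$. If $\lambda=0$ and $\Omega$ is a slice domain, $\ker(\mathcal{L})$ contains only the constants. If $\Omega$ is a product domain and $\lambda\neq0$, the operator $\mathcal{L}_\lambda$ on $\mathcal{AM}(\Omega)$ has kernel $$\ker(\mathcal{L}_\lambda)=\{\Delta(g\cdot\exp_\lambda(x))\ |\ g\in\mathcal{SC}(\Omega)\}.$$ If $\Omega$ is a product domain and $\lambda=0$, $\ker(\mathcal{L})=\{c+\Delta g\ |\ c\in\mathbb{H},\ g\in\mathcal{SC}(\Omega)\}$. The function $\Delta\exp_\lambda(x)$ has the expansion $$\Delta\exp_\lambda(x)=-4\sum_{n=0}^{+\infty}\mathcal{P}_n(x)\frac{\lambda^{n+2}}{(n+2)!}=-4\sum_{n=0}^{+\infty}\sum_{k=1}^{n+1}kx^{k-1}\overline x^{\,n-k+1}\frac{\lambda^{n+2}}{(n+2)!}.$$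
   Context: $\mathbb{H}$ is the skew field of quaternions, with elements $x=x_0+x_1i+x_2j+x_3k$, $\mathbb{S}=\{J\in\mathbb{H}: J^2=-1\}$; $\Delta=\sum_{i=0}^3\partial^2/\partial x_i^2$ is the Laplacian of $\mathbb{R}^4\simeq\mathbb{H}$. For an open set $D\subseteq\mathbb{C}$ invariant under complex conjugation, put $\Omega_D=\{\alpha+J\beta:\ \alpha+i\beta\in D,\ J\in\mathbb{S}\}\subseteq\mathbb{H}$. An axially symmetric domain is a connected open set $\Omega=\Omega_D$ of this form; it is a slice domain if $\Omega\cap\mathbb{R}\neq\emptyset$ and a product domain if $\Omega\cap\mathbb{R}=\emptyset$. A stem function on $D$ is a map $F=F_1+\imath F_2:D\to\mathbb{H}\otimes_{\mathbb{R}}\mathbb{C}$ ($F_1,F_2$ $\mathbb{H}$-valued, $\imath$ the central imaginary unit of the factor $\mathbb{C}$) with $F(\overline z)=\overline{F(z)}$, conjugation acting on the factor $\mathbb{C}$. It induces the slice function $f=\mathcal{I}(F):\Omega_D\to\mathbb{H}$, $f(\alpha+J\beta)=F_1(\alpha+i\beta)+JF_2(\alpha+i\beta)$. $\mathcal{S}^1(\Omega)$ is the set of slice functions induced by $C^1$ stem functions; the slice derivative is $\frac{\partial f}{\partial x}=\mathcal{I}(\frac{\partial F}{\partial z})$ with $\frac{\partial}{\partial z}=\frac12(\partial_\alpha-\imath\partial_\beta)$. $f$ is slice-regular if $F$ is holomorphic. $\mathcal{SC}(\Omega)$ is the set of slice-constant functions: slice-regular $g$ with $\frac{\partial g}{\partial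 x}=0$. The slice product of $f=\mathcal{I}(F)$, $g=\mathcal{I}(G)$ is $f\cdot g=\mathcal{I}(FG)$, with $FG$ the pointwise product in $\mathbb{H}\otimes\mathbb{C}$; quaternions are identified with constant slice functions. $\exp_\lambda(x)=\sum_{n=0}^{+\infty}\frac{x^n\lambda^n}{n!}$. The Cauchy-Riemann-Fueter operator is $\overline\partial=\frac12\left(\frac{\partial}{\partial x_0}+i\frac{\partial}{\partial x_1}+j\frac{\partial}{\partial x_2}+k\frac{\partial}{\partial x_3}\right)$ and its conjugate is $\partial=\frac12\left(\frac{\partial}{\partial x_0}-i\frac{\partial}{\partial x_1}-j\frac{\partial}{\partial x_2}-k\frac{\partial}{\partial x_3}\right)$ ($i,j,k$ acting by left multiplication). $\mathcal{AM}(\Omega)=\{f\in\mathcal{S}^1(\Omega):\overline\partial f=0\}$ is the space of axially monogenic functions. $\mathcal{P}_n(x)=-\frac14\Delta(x^{n+2})$ for $n\in\mathbb{N}$. *)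

(* Defs.v *)
From HB Require Import structures.
From mathcomp Require Import all_boot all_order all_algebra.
From mathcomp Require Import all_classical all_reals all_analysis.
From mathcomp Require Import ring.

Set Implicit Arguments.
Unset Strict Implicit.
Unset Printing Implicit Defensive.

Import Order.TTheory GRing.Theory Num.Theory.
Import numFieldNormedType.Exports.

Local Open Scope classical_set_scope.
Local Open Scope ring_scope.

(* The quaternions over R: the normed space R^4 (row vectors,
   hence the usual topology, which does not depend on the norm), equipped with
   Hamilton's product. *)
Definition quat (R : realType) : Type := 'rV[R]_4.

HB.instance Definition _ (R : realType) :=
  NormedModule.copy (quat R) ('rV[R]_4).

Section Quaternions.
Context {R : realType}.

Definition mkq (a b c d : R) : quat R := \row_(i < 4) [:: a; b; c; d]`_i.

Definition q0 (x : quat R) : R := (x : 'rV[R]_4) ord0 (inord 0).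
Definition q1 (x : quat R) : R := (x : 'rV[R]_4) ord0 (inord 1).
Definition q2 (x : quat R) : R := (x : 'rV[R]_4) ord0 (inord 2).
Definition q3 (x : quat R) : R := (x : 'rV[R]_4) ord0 (inord 3).

Lemma mkqE a b c d : (q0 (mkq a b c d) = a) * (q1 (mkq a b c d) = b)
  * (q2 (mkq a b c d) = c) * (q3 (mkq a b c d) = d).
Proof. by rewrite /q0 /q1 /q2 /q3 !mxE !inordK. Qed.

Lemma quatP (x y : quat R) :
  q0 x = q0 y -> q1 x = q1 y -> q2 x = q2 y -> q3 x = q3 y -> x = y.
Proof.
move=> h0 h1 h2 h3; apply/rowP => i.
by case: i => -[|[|[|[|//]]]] lt_i; [move: h0|move: h1|move: h2|move: h3];
  rewrite /q0 /q1 /q2 /q3; (congr (_ = _); congr (_ _ _); apply/val_inj);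
  rewrite /= inordK.
Qed.

Lemma qD (x y : quat R) : (q0 (x + y) = q0 x + q0 y)
  * (q1 (x + y) = q1 x + q1 y) * (q2 (x + y) = q2 x + q2 y)
  * (q3 (x + y) = q3 x + q3 y).
Proof. by rewrite /q0 /q1 /q2 /q3 !mxE. Qed.

Lemma qZ (a : R) (x : quat R) : (q0 (a *: x) = a * q0 x)
  * (q1 (a *: x) = a * q1 x) * (q2 (a *: x) = a * q2 x)
  * (q3 (a *: x) = a * q3 x).
Proof. by rewrite /q0 /q1 /q2 /q3 !mxE. Qed.

Definition qone : quat R := mkq 1 0 0 0.

Definition qmul (x y : quat R) : quat R :=
  mkq (q0 x * q0 y - q1 x * q1 y - q2 x * q2 y - q3 x * q3 y)
      (q0 x * q1 y + q1 x * q0 y + q2 x * q3 y - q3 x * q2 y)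
      (q0 x * q2 y - q1 x * q3 y + q2 x * q0 y + q3 x * q1 y)
      (q0 x * q3 y + q1 x * q2 y - q2 x * q1 y + q3 x * q0 y).

Fact qmulA : associative qmul.
Proof. by move=> x y z; apply: quatP; rewrite !mkqE; ring. Qed.
Fact qmul1q : left_id qone qmul.
Proof. by move=> x; apply: quatP; rewrite !mkqE; ring. Qed.
Fact qmulq1 : right_id qone qmul.
Proof. by move=> x; apply: quatP; rewrite !mkqE; ring. Qed.
Fact qmulDl : left_distributive qmul (+%R : quat R -> quat R -> quat R).
Proof. by move=> x y z; apply: quatP; rewrite !(mkqE, qD); ring. Qed.
Fact qmulDr : right_distributive qmul (+%R : quat R -> quat R -> quat R).
Proof. by move=> x y z; apply: quatP; rewrite !(mkqE, qD); ring. Qed.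
Fact qone_neq0 : qone != 0 :> quat R.
Proof.
by apply/eqP => /(congr1 q0) /eqP; rewrite mkqE /q0 mxE oner_eq0.
Qed.

HB.instance Definition _ := GRing.Zmodule_isNzRing.Build (quat R)
  qmulA qmul1q qmulq1 qmulDl qmulDr qone_neq0.

Fact qscaleAl (a : R) (x y : quat R) : a *: (x * y) = (a *: x) * y.
Proof. by apply: quatP; rewrite !(mkqE, qZ); ring. Qed.
Fact qscaleAr (a : R) (x y : quat R) : a *: (x * y) = x * (a *: y).
Proof. by apply: quatP; rewrite !(mkqE, qZ); ring. Qed.

HB.instance Definition _ :=
  GRing.Lmodule_isLalgebra.Build R (quat R) qscaleAl.
HB.instance Definition _ :=
  GRing.Lalgebra_isAlgebra.Build R (quat R) qscaleAr.

Definition qi : quat R := mkq 0 1 0 0.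
Definition qj : quat R := mkq 0 0 1 0.
Definition qk : quat R := mkq 0 0 0 1.

Definition qconj (x : quat R) : quat R := mkq (q0 x) (- q1 x) (- q2 x) (- q3 x).

End Quaternions.

Section StemAndSliceFunctions.
Context {R : realType}.
Implicit Types (D : set (R * R)) (F G : R * R -> quat R * quat R)
  (f g : quat R -> quat R).

(* The complex number alpha + i beta is the pair (alpha, beta), and the element
   w1 + iota w2 of H (x) C is the pair (w1, w2); on the latter the ring
   structure is hc_mul, not the componentwise product of pairs. *)
Definition hc_mul (v w : quat R * quat R) : quat R * quat R :=
  (v.1 * w.1 - v.2 * w.2, v.1 * w.2 + v.2 * w.1).

Definition hc_iota : quat R * quat R := (0, 1).

Definition hc_conj (w : quat R * quat R) : quat R * quat R := (w.1, - w.2).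

Definition conj_invariant D : Prop := forall a b, D (a, b) -> D (a, - b).

Definition imag_units : set (quat R) := [set J | J * J = -1].

Definition circularization D : set (quat R) :=
  [set x | exists a b J,
     [/\ D (a, b), imag_units J & x = a%:A + b *: J]].

Definition axially_symmetric_domain D : Prop :=
  [/\ open D, conj_invariant D, open (circularization D)
    & connected (circularization D)].

Definition real_axis : set (quat R) := [set x | exists a : R, x = a%:A].

Definition slice_domain D : Prop :=
  axially_symmetric_domain D /\ circularization D `&` real_axis !=set0.

Definition product_domain D : Prop :=
  axially_symmetric_domain D /\ circularization D `&` real_axis = set0.

Definition stem_function D F : Prop :=
  forall a b, D (a, b) -> F (a, - b) = hc_conj (F (a, b)).

Definition C1_on D F : Prop :=
  forall z, D z ->
    differentiable F z /\ forall v, {for z, continuous ('D_v F)}.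

(* Complex differentiability: the real differential commutes with the
   multiplications by i on C and by iota on H (x) C. *)
Definition holomorphic_on D F : Prop :=
  forall z, D z -> differentiable F z /\
    forall h : R * R, 'd F z (- h.2, h.1) = hc_mul hc_iota ('d F z h).

Definition stem_dz F : R * R -> quat R * quat R := fun z =>
  2^-1 *: ('D_(1, 0) F z - hc_mul hc_iota ('D_(0, 1) F z)).

(* Every x is alpha + J beta with alpha = q0 x, beta = qimnorm x >= 0 and
   J = qimdir x; for real x the junk value qimdir x = 0 is harmless, since
   then beta = 0 and a stem function has F_2(alpha, 0) = 0 (see sliceE). *)
Definition qimnorm (x : quat R) : R :=
  Num.sqrt (q1 x ^+ 2 + q2 x ^+ 2 + q3 x ^+ 2).

Definition qimdir (x : quat R) : quat R :=
  (qimnorm x)^-1 *: mkq 0 (q1 x) (q2 x) (q3 x).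

Definition slice F : quat R -> quat R := fun x =>
  (F (q0 x, qimnorm x)).1 + qimdir x * (F (q0 x, qimnorm x)).2.

Lemma imag_unitsP (J : quat R) : imag_units J ->
  q0 J = 0 /\ q1 J ^+ 2 + q2 J ^+ 2 + q3 J ^+ 2 = 1.
Proof.
rewrite /imag_units /= => JJ.
have N1 : (-1 : quat R) = mkq (-1) 0 0 0.
  by apply: quatP; rewrite -scaleN1r qZ !mkqE; ring.
move: JJ; rewrite N1 => JJ.
have := congr1 q0 JJ; have := congr1 q1 JJ; have := congr1 q2 JJ.
have := congr1 q3 JJ; rewrite !mkqE => e3 e2 e1 e0.
have J0 : q0 J = 0.
  apply/eqP; apply: contraT => nz.
  have dbl (y : R) : q0 J * y + y * q0 J = 0 -> y = 0.
    rewrite [y * _]mulrC -mulr2n => /eqP.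
    by rewrite mulrn_eq0 /= mulf_eq0 (negPf nz) => /eqP.
  have z1 : q1 J = 0 by apply: dbl; rewrite -[RHS]e1; ring.
  have z2 : q2 J = 0 by apply: dbl; rewrite -[RHS]e2; ring.
  have z3 : q3 J = 0 by apply: dbl; rewrite -[RHS]e3; ring.
  move: e0; rewrite z1 z2 z3 !mulr0 !subr0 -expr2 => e0.
  by move: (sqr_ge0 (q0 J)); rewrite e0 oppr_ge0 ler10.
split=> //; apply: oppr_inj; rewrite -e0 J0; ring.
Qed.

Lemma sliceE D F (a b : R) (J : quat R) :
  stem_function D F -> D (a, b) -> imag_units J ->
  slice F (a%:A + b *: J) = (F (a, b)).1 + J * (F (a, b)).2.
Proof.
move=> stemF Dab /imag_unitsP[J0 J1].
set x := _ + _.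
have x0 : q0 x = a by rewrite qD !qZ J0 !mkqE; ring.
have x1 : q1 x = b * q1 J by rewrite qD !qZ !mkqE; ring.
have x2 : q2 x = b * q2 J by rewrite qD !qZ !mkqE; ring.
have x3 : q3 x = b * q3 J by rewrite qD !qZ !mkqE; ring.
have nx : qimnorm x = `|b|.
  rewrite /qimnorm x1 x2 x3 -sqrtr_sqr -[in RHS](mulr1 (b ^+ 2)) -J1.
  by congr Num.sqrt; ring.
have dx : qimdir x = (`|b|^-1 * b) *: J.
  by rewrite /qimdir nx; apply: quatP; rewrite !(mkqE, qZ) ?J0 ?x1 ?x2 ?x3; ring.
rewrite /slice x0 nx dx; case: (ltrgt0P b) => [b_gt0|b_lt0|b0].
- by rewrite mulVf ?gt_eqF// scale1r.
- rewrite (stemF _ _ Dab) /= invrN mulNr mulVf ?lt_eqF// scaleN1r.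
  by rewrite mulrNN.
- have F20 : (F (a, 0)).2 = 0.
    have := stemF _ _ Dab; rewrite b0 oppr0 => /(congr1 snd) /= /eqP.
    rewrite -addr_eq0 -mulr2n -scaler_nat scaler_eq0 pnatr_eq0 /=.
    by move=> /eqP.
  by rewrite b0 F20 !mulr0.
Qed.

(* Functions on Omega_D are represented by total functions of which only the
   values on circularization D = Omega_D are relevant. *)
Definition induced_by D f F : Prop :=
  stem_function D F /\ forall x, circularization D x -> f x = slice F x.

(* The stem function inducing f, unique on D by induced_by_uniq. *)
Definition stem_of D f : R * R -> quat R * quat R :=
  xget (fun=> 0) [set F | induced_by D f F].

Definition slice_C1 D : set (quat R -> quat R) :=
  [set f | exists2 F, induced_by D f F & C1_on D F].

Definition slice_regular D : set (quat R -> quat R) :=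
  [set f | exists2 F, induced_by D f F & holomorphic_on D F].

Definition slice_derivative D f : quat R -> quat R :=
  slice (stem_dz (stem_of D f)).

Definition slice_constant D : set (quat R -> quat R) :=
  [set g | slice_regular D g /\
     forall x, circularization D x -> slice_derivative D g x = 0].

Definition slice_mul D f g : quat R -> quat R :=
  slice (fun z => hc_mul (stem_of D f z) (stem_of D g z)).

Lemma induced_by_uniq D f F G :
  conj_invariant D -> induced_by D f F -> induced_by D f G ->
  forall z, D z -> F z = G z.
Proof.
move=> Dconj [stF fF] [stG fG] [a b] Dab.
have Jq : imag_units (qi : quat R).
  rewrite /imag_units /=; apply: quatP; rewrite -scaleN1r !(mkqE, qZ); ring.
have NJq : imag_units (- qi : quat R) by rewrite /imag_units /= mulrNN; exact: Jq.
have circ J : imag_units J -> circularization D (a%:A + b *: J).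
  by move=> uJ; exists a, b, J.
have eqJ J : imag_units J ->
    (F (a, b)).1 + J * (F (a, b)).2 = (G (a, b)).1 + J * (G (a, b)).2.
  move=> uJ; rewrite -(sliceE stF Dab uJ) -(sliceE stG Dab uJ).
  by rewrite -fF ?fG//; exact: circ.
have e1 := eqJ _ Jq; have e2 := eqJ _ NJq; move: e2; rewrite !mulNr => e2.
have dbl (u v : quat R) : u + u = v + v -> u = v.
  rewrite -!mulr2n => /eqP; rewrite -subr_eq0 -mulrnBl -scaler_nat scaler_eq0.
  by rewrite pnatr_eq0 /= subr_eq0 => /eqP.
have E1 : (F (a, b)).1 = (G (a, b)).1.
  by apply: dbl; have := f_equal2 (fun u v : quat R => u + v) e1 e2; rewrite addrACA subrr addr0 addrACA subrr addr0.
have E2 : qi * (F (a, b)).2 = qi * (G (a, b)).2.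
  by move: e1; rewrite E1 => /addrI.
have E3 : (F (a, b)).2 = (G (a, b)).2.
  have := congr1 (fun u => (- qi) * u) E2.
  by rewrite /= !mulrA mulNr (Jq : qi * qi = -1) opprK !mul1r.
by rewrite (surjective_pairing (F _)) (surjective_pairing (G _)) E1 E3.
Qed.

Lemma stem_ofE D f F : conj_invariant D -> induced_by D f F ->
  forall z, D z -> stem_of D f z = F z.
Proof.
move=> Dconj indF z Dz; apply: (induced_by_uniq (f := f) Dconj _ indF Dz).
exact: (@xgetPex _ (fun=> 0) [set F | induced_by D f F] (ex_intro _ F indF)).
Qed.

End StemAndSliceFunctions.

Section DifferentialOperators.
Context {R : realType}.
Implicit Types (D : set (R * R)) (f : quat R -> quat R) (lam x : quat R).

Definition laplacian f : quat R -> quat R := fun x =>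
  'D_1 ('D_1 f) x + 'D_qi ('D_qi f) x + 'D_qj ('D_qj f) x + 'D_qk ('D_qk f) x.

Definition crf f : quat R -> quat R := fun x =>
  2^-1 *: ('D_1 f x + qi * 'D_qi f x + qj * 'D_qj f x + qk * 'D_qk f x).

Definition crf_conj f : quat R -> quat R := fun x =>
  2^-1 *: ('D_1 f x - qi * 'D_qi f x - qj * 'D_qj f x - qk * 'D_qk f x).

Definition axially_monogenic D : set (quat R -> quat R) :=
  [set f | slice_C1 D f /\ forall x, circularization D x -> crf f x = 0].

Definition eigen_solution D lam f : Prop :=
  axially_monogenic D f /\
  forall x, circularization D x -> crf_conj f x = f x * lam.

Definition eigen_op lam f : quat R -> quat R := fun x =>
  crf_conj f x - f x * lam.

Definition eigen_ker D lam : set (quat R -> quat R) :=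
  [set f | axially_monogenic D f /\
     forall x, circularization D x -> eigen_op lam f x = 0].

Definition qexp lam : quat R -> quat R := fun x =>
  limn (series (fun n => n`!%:R^-1 *: (x ^+ n * lam ^+ n))).

Definition monogenic_poly (n : nat) : quat R -> quat R := fun x =>
  - 4^-1 *: laplacian (fun y => y ^+ n.+2) x.

End DifferentialOperators.

(* Main.v *)
(* On an axially monogenic [f] one has [crf_conj f = 'D_1 f], so an eigenfunction is
   determined by [d/dx0 f = f lam] and the Vekua-type system [vekua] for its stem
   function [(A, B)].  If [lam] is invertible, the functions
   [-(A - b B lam) lam^-2 / 2] and [-b A lam^-1 / 2] are the components of a holomorphic
   stem function [H] with [dH/dz = H lam]; multiplying [H] on the right by the stem of
   [exp_{-lam}] leaves a stem function with zero differential, i.e. the slice-constant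
   factor [g], and the explicit formula for the Laplacian of a slice-regular function
   gives back [f = laplacian (g . exp_lam)].  If [lam = 0] the functions [A] and
   [b^2 B] already have zero differential.  Functions with zero differential are constant
   along the circularization, which is connected; on a slice domain the value at a
   real point is a plain quaternion.  The stem of [laplacian exp_lam] extends across
   the real axis because [sin(t lam) / t] is an entire power series in [t]. *)

(* The formulas for [H] come from inverting the Laplacian: for a slice-regular function with stem
   [H] and [K = dH/dz], the Laplacian has stem [(- 2 K2 / b, 2 K1 / b - 2 H2 / b^2)]. Putting
   [K = H lam] and equating with [(A, B)], the first component yields [H2] and the second then
   yields [H1]. Noncommutativity does no harm: [lam] always acts on the right, and the components of
   the exponential stem are real power series in [lam], so that in the derivative of
   [H exp(- z lam)] the two terms of the product rule are opposite. The obstacle is the real axis,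
   where [1 / b] is singular and the norm of the imaginary part is not differentiable. There slice
   functions are studied along the lines [a + t J] with [t] of either sign, while [H] is formed from
   [A] and [B] without dividing by [b]. The set assumed connected is the circularization, not [D],
   which for a product domain splits into two conjugate halves. Hence stems are compared only at the
   points [(q0 x, qimnorm x)]. One with zero differential takes a single value [(c1, c2)] there; at
   a real point parity forces [c2 = 0]. *)
Require Import Defs.
From HB Require Import structures.
From mathcomp Require Import all_boot all_order all_algebra.
From mathcomp Require Import all_classical all_reals all_analysis.
From mathcomp Require Import ring lra.
Import Order.TTheory GRing.Theory Num.Theory.
Import numFieldNormedType.Exports.
Local Open Scope classical_set_scope.
Local Open Scope ring_scope.

(** * Differential calculus *)

Section Differentials.
Set Implicit Arguments.
Unset Strict Implicit.
Context {R : realType}.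

(** The operators involved only use derivatives in fixed directions. Restriction to a line turns
    each of them into the derivative of a function of a real variable, for which derivability and
    differentiability coincide. *)
Lemma is_derive_line (V W : normedModType R) (f : V -> W) (x v : V) (d : W) :
  is_derive x v f d <-> is_derive (0 : R) 1 (fun t : R => f (t *: v + x)) d.
Proof.
have E : 'D_v f x = 'D_1 (fun t : R => f (t *: v + x)) 0.
  rewrite /derive; set g1 := fun h => _; set g2 := fun h => _.
  suff -> : g1 = g2 by [].
  by apply/funext => h; rewrite /g1 /g2 /= addr0 scale0r add0r [_%:A]mulr1.
split=> -[df dE]; split.
- exact: (derivable1P f x v).1.
- by rewrite -E.
- exact: (derivable1P f x v).2.
- by rewrite E.
Qed.

Lemma is_derive_is_diff (W : normedModType R) (f : R -> W) (t : R) (d : W) :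
  is_derive t 1 f d <-> is_diff t f (fun h => h *: d).
Proof.
split=> [[df <-]|[df dE]].
  have df' : differentiable f t by apply/derivable1_diffP.
  by apply: DiffDef => //; rewrite diff1E // derive1E.
by apply: DeriveDef; [exact/derivable1_diffP|rewrite deriveE // dE scale1r].
Qed.

(** The chain rule is applied on the line through [x], so the inner map needs only a directional
    derivative. *)
Lemma is_derive_diff_comp (V U W : normedModType R) (F : U -> W) (g : V -> U)
    (x v : V) (dg : U) (dF : U -> W) :
  is_derive x v g dg -> is_diff (g x) F dF -> is_derive x v (F \o g) (dF dg).
Proof.
move=> /is_derive_line/is_derive_is_diff dg' dF'.
apply/is_derive_line.
have e0 : g x = g (0 *: v + x) by rewrite scale0r add0r.
have -> : (fun t : R => (F \o g) (t *: v + x)) = F \o (fun t => g (t *: v + x)) by [].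
have [F1 F2] := dF'; have [g1 g2] := dg'.
rewrite e0 in dF'.
have := @is_diff_comp _ _ _ _ _ _ _ _ _ dg' dF'.
set G := (fun t : R => g (t *: v + x)).
move=> [c1 c2]; split; first exact/derivable1_diffP.
by rewrite deriveE // c2 /= scale1r.
Qed.

Lemma is_derive_pair (V U W : normedModType R) (f : V -> U) (g : V -> W)
    (x v : V) df dg :
  is_derive x v f df -> is_derive x v g dg ->
  is_derive x v (fun y => (f y, g y)) (df, dg).
Proof.
move=> /is_derive_line/is_derive_is_diff hf /is_derive_line/is_derive_is_diff hg.
exact/is_derive_line/is_derive_is_diff.
Qed.

Lemma is_diff_linear (V W : normedModType R) (f : {linear V -> W}) (x : V) :
  continuous f -> is_diff x f f.
Proof.
by move=> cf; apply: DiffDef; [exact: linear_differentiable|exact: diff_lin].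
Qed.

Lemma is_derive_linear (V U W : normedModType R) (f : {linear U -> W})
    (g : V -> U) (x v : V) dg :
  continuous f -> is_derive x v g dg -> is_derive x v (fun y => f (g y)) (f dg).
Proof. by move=> cf hg; apply: (is_derive_diff_comp hg); exact: is_diff_linear. Qed.

Lemma is_diff_bilinear (U V W : normedModType R) (f : {bilinear U -> V -> W})
    (p : U * V) : continuous (fun q => f q.1 q.2) ->
  is_diff p (fun q => f q.1 q.2) (fun q => f p.1 q.2 + f q.1 p.2).
Proof.
by move=> cf; apply: DiffDef; [exact: differentiable_bilin|rewrite diff_bilin].
Qed.

Lemma is_derive_bilinear (T U V W : normedModType R) (b : {bilinear U -> V -> W})
    (f : T -> U) (g : T -> V) (x v : T) df dg :
  continuous (fun q => b q.1 q.2) -> is_derive x v f df -> is_derive x v g dg ->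
  is_derive x v (fun y => b (f y) (g y)) (b (f x) dg + b df (g x)).
Proof.
move=> cb hf hg; have := is_derive_pair hf hg.
by move=> /is_derive_diff_comp -/(_ _ _ _ (is_diff_bilinear _ cb)).
Qed.

Lemma scale_is_bilinear (V : normedModType R) : bilinear_for
  (GRing.Scale.Law.clone _ _ *:%R _) (GRing.Scale.Law.clone _ _ *:%R _)
  (fun (a : R) (w : V) => a *: w).
Proof.
split=> [u'|u] a x y /=; first by rewrite scalerDl scalerA.
by rewrite scalerDr !scalerA mulrC.
Qed.
Definition scaleb (V : normedModType R) (a : R) (w : V) := a *: w.
HB.instance Definition _ (V : normedModType R) :=
  bilinear_isBilinear.Build R R V V _ _ (@scaleb V) (scale_is_bilinear V).

Lemma scaleb_continuous (V : normedModType R) :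
  continuous (fun q : R * V => scaleb q.1 q.2).
Proof. exact: scale_continuous. Qed.

Lemma is_derive_scale (T V : normedModType R) (f : T -> R)
    (g : T -> V) (x v : T) df dg :
  is_derive x v f df -> is_derive x v g dg ->
  is_derive x v (fun y => f y *: g y) (f x *: dg + df *: g x).
Proof. exact: (is_derive_bilinear (@scaleb_continuous V)). Qed.

Lemma is_diff_pair_comp (T U V W : normedModType R) (b : {bilinear U -> V -> W})
    (f : T -> U) (g : T -> V) (x : T) df dg :
  continuous (fun q => b q.1 q.2) -> is_diff x f df -> is_diff x g dg ->
  is_diff x (fun y => b (f y) (g y)) (fun h => b (f x) (dg h) + b (df h) (g x)).
Proof.
move=> cb hf hg; have := is_diff_pair hf hg.
by move=> h; have := @is_diff_comp _ _ _ _ _ _ _ _ _ h (is_diff_bilinear _ cb).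
Qed.

(** [F] and [G] agree at [z] and for all small increments, so the little-o expansion of [F] serves
    for [G]. *)
Lemma is_diff_near (V W : normedModType R) (F G : V -> W) (z : V) d :
  (\forall w \near z, F w = G w) -> is_diff z F d -> is_diff z G d.
Proof.
move=> FG [/diff_locallyxP[cF dF] <-].
have FGz := nbhs_singleton FG.
suff eG : G \o shift z = cst (G z) + 'd F z +o_ 0 id.
  have dGE := diff_unique cF eG.
  by apply: DiffDef; [apply/diff_locallyP|]; rewrite dGE.
have eF : F \o shift z = cst (F z) + 'd F z +o_ 0 id.
  by apply/eqaddoE/funext => h; rewrite /= {1}dF.
apply/eqaddoP => _/posnumP[e].
have /eqaddoP/(_ e%:num)/(_ [gt0 of e%:num]) := eF.
have FG0 : \forall h \near (0 : V), F (h + z) = G (h + z).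
  by move: FG; rewrite (near_shift 0); apply: filterS => y /=; rewrite subr0.
apply: filterS2 FG0 => h /= FGh.
by rewrite !fctE /= -FGh -FGz.
Qed.

End Differentials.

(** * Hamilton's product as a continuous bilinear map *)

Section QuaternionCalculus.
Context {R : realType}.

Lemma qscalel (k : R) (x y : quat R) : (k *: x) * y = k *: (x * y).
Proof. by rewrite scalerAl. Qed.

Lemma qscaler (k : R) (x y : quat R) : x * (k *: y) = k *: (x * y).
Proof. by rewrite scalerAr. Qed.

Lemma mkq_eta (x : quat R) : x = mkq (q0 x) (q1 x) (q2 x) (q3 x).
Proof. by apply: quatP; rewrite mkqE. Qed.

Lemma mkq_basis (a b c d : R) :
  mkq a b c d = a%:A + b *: qi + c *: qj + d *: qk.
Proof. by apply: quatP; rewrite !(qD, qZ, mkqE); ring. Qed.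

Lemma q0_continuous : continuous (@q0 R). Proof. exact: coord_continuous. Qed.
Lemma q1_continuous : continuous (@q1 R). Proof. exact: coord_continuous. Qed.
Lemma q2_continuous : continuous (@q2 R). Proof. exact: coord_continuous. Qed.
Lemma q3_continuous : continuous (@q3 R). Proof. exact: coord_continuous. Qed.

Fact q0_is_linear : linear (@q0 R : quat R -> R).
Proof. by move=> a x y; rewrite qD qZ. Qed.
Fact q1_is_linear : linear (@q1 R : quat R -> R).
Proof. by move=> a x y; rewrite qD qZ. Qed.
Fact q2_is_linear : linear (@q2 R : quat R -> R).
Proof. by move=> a x y; rewrite qD qZ. Qed.
Fact q3_is_linear : linear (@q3 R : quat R -> R).
Proof. by move=> a x y; rewrite qD qZ. Qed.
HB.instance Definition _ := GRing.isLinear.Build R (quat R) R _ _ q0_is_linear.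
HB.instance Definition _ := GRing.isLinear.Build R (quat R) R _ _ q1_is_linear.
HB.instance Definition _ := GRing.isLinear.Build R (quat R) R _ _ q2_is_linear.
HB.instance Definition _ := GRing.isLinear.Build R (quat R) R _ _ q3_is_linear.

Lemma mkq_cvg (T : Type) (F : set_system T) {FF : Filter F}
    (f0 f1 f2 f3 : T -> R) (a b c d : R) :
  f0 @ F --> a -> f1 @ F --> b -> f2 @ F --> c -> f3 @ F --> d ->
  (fun t => mkq (f0 t) (f1 t) (f2 t) (f3 t)) @ F --> mkq a b c d.
Proof.
move=> h0 h1 h2 h3; rewrite mkq_basis.
rewrite [X in X @ F](_ : _ = fun t => (f0 t)%:A + f1 t *: qi + f2 t *: qj + f3 t *: qk).
  by do 3 (apply: cvgD; last by apply: cvgZr_tmp); apply: cvgZr_tmp.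
by apply/funext => t; rewrite mkq_basis.
Qed.

Lemma qmul_continuous : continuous (fun p : quat R * quat R => p.1 * p.2).
Proof.
move=> p; rewrite /GRing.mul/= /qmul.
have c (q : quat R -> R) : continuous q ->
   (q \o fst @ p --> q p.1) /\ (q \o snd @ p --> q p.2).
  move=> cq; split; (apply: (@continuous_comp _ _ _ _ q); last exact: cq).
    exact: cvg_fst.
  exact: cvg_snd.
have [a0 b0] := c _ q0_continuous; have [a1 b1] := c _ q1_continuous.
have [a2 b2] := c _ q2_continuous; have [a3 b3] := c _ q3_continuous.
apply: mkq_cvg.
- by apply: cvgB; [apply: cvgB; [apply: cvgB|]|]; apply: cvgM.
- by apply: cvgB; [apply: cvgD; [apply: cvgD|]|]; apply: cvgM.
- by apply: cvgD; [apply: cvgD; [apply: cvgB|]|]; apply: cvgM.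
- by apply: cvgD; [apply: cvgB; [apply: cvgD|]|]; apply: cvgM.
Qed.

Lemma qmul_is_bilinear : bilinear_for
  (GRing.Scale.Law.clone _ _ *:%R _) (GRing.Scale.Law.clone _ _ *:%R _)
  (fun x y : quat R => x * y).
Proof.
split=> [u'|u] a x y /=; first by rewrite mulrDl scalerAl.
by rewrite mulrDr scalerAr.
Qed.
Definition qmulb (x y : quat R) := x * y.
HB.instance Definition _ :=
  bilinear_isBilinear.Build R (quat R) (quat R) (quat R) _ _ qmulb qmul_is_bilinear.

Lemma is_derive_qmul (T : normedModType R) (f g : T -> quat R) (x v : T) df dg :
  is_derive x v f df -> is_derive x v g dg ->
  is_derive x v (fun y => f y * g y) (f x * dg + df * g x).
Proof. exact: (@is_derive_bilinear _ _ _ _ _ qmulb _ _ _ _ _ _ qmul_continuous). Qed.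

Lemma is_diff_qmul (T : normedModType R) (f g : T -> quat R) (x : T) df dg :
  is_diff x f df -> is_diff x g dg ->
  is_diff x (fun y => f y * g y) (fun h => f x * dg h + df h * g x).
Proof. exact: (@is_diff_pair_comp _ _ _ _ _ qmulb _ _ _ _ _ qmul_continuous). Qed.

End QuaternionCalculus.

(** * Partial derivatives of maps on the plane *)

Section PartialDerivatives.
Set Implicit Arguments.
Unset Strict Implicit.
Context {R : realType}.
Implicit Types (W : normedModType R) (z : R * R).

(* [X] and [Y] are the partial derivatives of [F] at [z]. *)
Definition hasd W (F : R * R -> W) z (X Y : W) : Prop :=
  is_diff z F (fun h => h.1 *: X + h.2 *: Y).

Lemma hasd_diff W (F : R * R -> W) z X Y h :
  hasd F z X Y -> 'd F z h = h.1 *: X + h.2 *: Y.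
Proof. by case=> _ ->. Qed.

Lemma hasd_derive W (F : R * R -> W) z X Y v :
  hasd F z X Y -> 'D_v F z = v.1 *: X + v.2 *: Y.
Proof. by case=> d1 d2; rewrite deriveE // d2. Qed.

Lemma differentiable_hasd W (F : R * R -> W) z :
  differentiable F z -> hasd F z ('D_(1, 0) F z) ('D_(0, 1) F z).
Proof.
move=> dF; apply: DiffDef => //; apply/funext => -[a b] /=.
rewrite !deriveE // -!linearZ -linearD /=; congr ('d F z _).
by congr (_, _) => /=; rewrite /GRing.scale /= ?mulr0 ?mulr1 ?addr0 ?add0r.
Qed.

Lemma hasd_uniq W (F : R * R -> W) z X Y X' Y' :
  hasd F z X Y -> hasd F z X' Y' -> X = X' /\ Y = Y'.
Proof.
move=> h h'; split.
  have := hasd_derive (1, 0) h; rewrite (hasd_derive (1, 0) h') /=.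
  by rewrite !scale1r !scale0r !addr0.
have := hasd_derive (0, 1) h; rewrite (hasd_derive (0, 1) h') /=.
by rewrite !scale1r !scale0r !add0r.
Qed.

Lemma hasd_eq W (F : R * R -> W) z X Y X' Y' :
  hasd F z X Y -> X = X' -> Y = Y' -> hasd F z X' Y'.
Proof. by move=> h <- <-. Qed.

Lemma hasd_near W (F G : R * R -> W) z X Y :
  (\forall w \near z, F w = G w) -> hasd F z X Y -> hasd G z X Y.
Proof. exact: is_diff_near. Qed.

Lemma hasd_cst W (c : W) z : hasd (fun=> c) z 0 0.
Proof. by apply: is_diff_eq; apply/funext => h /=; rewrite !scaler0 addr0. Qed.

Lemma hasdD W (F G : R * R -> W) z X Y X' Y' :
  hasd F z X Y -> hasd G z X' Y' -> hasd (fun w => F w + G w) z (X + X') (Y + Y').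
Proof.
move=> h h'; apply: (is_diff_eq (is_diffD h h')); apply/funext => k /=.
by rewrite !scalerDr addrACA.
Qed.

Lemma hasdN W (F : R * R -> W) z X Y :
  hasd F z X Y -> hasd (fun w => - F w) z (- X) (- Y).
Proof.
move=> h; apply: (is_diff_eq (is_diffN h)); apply/funext => k /=.
by rewrite !scalerN opprD.
Qed.

Lemma hasdB W (F G : R * R -> W) z X Y X' Y' :
  hasd F z X Y -> hasd G z X' Y' -> hasd (fun w => F w - G w) z (X - X') (Y - Y').
Proof. by move=> h h'; apply: hasdD => //; apply: hasdN. Qed.

Lemma hasd_linear W W' (L : {linear W -> W'}) (F : R * R -> W) z X Y :
  continuous L -> hasd F z X Y -> hasd (fun w => L (F w)) z (L X) (L Y).
Proof.
move=> cL h.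
have := @is_diff_comp _ _ _ _ _ _ _ _ _ h (is_diff_linear (F z) cL).
by move=> /is_diff_eq; apply; apply/funext => k /=; rewrite linearD !linearZ.
Qed.

Lemma hasd_scale W (f : R * R -> R) (F : R * R -> W) z a b X Y :
  hasd f z a b -> hasd F z X Y ->
  hasd (fun w => f w *: F w) z (f z *: X + a *: F z) (f z *: Y + b *: F z).
Proof.
move=> hf hF.
have := @is_diff_pair_comp _ _ _ _ _ (@scaleb R W) _ _ _ _ _ (@scaleb_continuous R W) hf hF.
move=> /is_diff_eq; apply; apply/funext => k /=.
rewrite /scaleb !scalerDr !scalerDl !scalerA addrACA /GRing.scale /=.
by rewrite ![f z * _]mulrC.
Qed.

Lemma hasd_scalec W (c : R) (F : R * R -> W) z X Y :
  hasd F z X Y -> hasd (fun w => c *: F w) z (c *: X) (c *: Y).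
Proof.
move=> hF; apply: hasd_eq; first exact: (hasd_scale (hasd_cst c z) hF).
  by rewrite scale0r addr0.
by rewrite scale0r addr0.
Qed.

Lemma hasd_fst W (f : R -> W) z d :
  is_derive z.1 1 f d -> hasd (fun w => f w.1) z d 0.
Proof.
move=> /is_derive_is_diff hf.
have h : is_diff z (fst : R * R -> R) fst by apply: is_diff_linear => ?; exact: cvg_fst.
have := @is_diff_comp _ _ _ _ _ _ _ _ _ h hf.
by move=> /is_diff_eq; apply; apply/funext => k /=; rewrite scaler0 addr0.
Qed.

Lemma hasd_snd W (f : R -> W) z d :
  is_derive z.2 1 f d -> hasd (fun w => f w.2) z 0 d.
Proof.
move=> /is_derive_is_diff hf.
have h : is_diff z (snd : R * R -> R) snd by apply: is_diff_linear => ?; exact: cvg_snd.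
have := @is_diff_comp _ _ _ _ _ _ _ _ _ h hf.
by move=> /is_diff_eq; apply; apply/funext => k /=; rewrite scaler0 add0r.
Qed.

Lemma hasdP W W' (F : R * R -> W * W') z X Y :
  hasd F z X Y <->
  hasd (fun w => (F w).1) z X.1 Y.1 /\ hasd (fun w => (F w).2) z X.2 Y.2.
Proof.
split=> [h|[h1 h2]].
  split.
    by apply: (@hasd_linear _ _ (fst : W * W' -> W) _ _ _ _ _ h) => ?; exact: cvg_fst.
  by apply: (@hasd_linear _ _ (snd : W * W' -> W') _ _ _ _ _ h) => ?; exact: cvg_snd.
have := is_diff_pair h1 h2.
rewrite (_ : (fun y => _) = F); first by move=> /is_diff_eq; apply.
by apply/funext => w; case: (F w).
Qed.

Lemma hasd_curve (V W : normedModType R) (F : R * R -> W) (f g : V -> R)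
    (x v : V) a b X Y :
  is_derive x v f a -> is_derive x v g b -> hasd F (f x, g x) X Y ->
  is_derive x v (fun y => F (f y, g y)) (a *: X + b *: Y).
Proof.
move=> hf hg hF.
exact: (is_derive_diff_comp (is_derive_pair hf hg) hF).
Qed.

Lemma hasd_conj W (F : R * R -> W) (a b : R) X Y :
  hasd F (a, b) X Y -> hasd (fun w => F (w.1, - w.2)) (a, - b) X (- Y).
Proof.
move=> hF.
have h : is_diff (a, - b) (fun w : R * R => (w.1, - w.2)) (fun w : R * R => (w.1, - w.2)).
  apply: is_diff_pair.
    by apply: is_diff_linear => ?; exact: cvg_fst.
  apply: (is_diffN (f := snd)).
  by apply: is_diff_linear => ?; exact: cvg_snd.
have hF' : is_diff ((a, - b).1, - (a, - b).2) F (fun h => h.1 *: X + h.2 *: Y).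
  by rewrite /= opprK.
have := @is_diff_comp _ _ _ _ _ _ _ _ _ h hF'.
by move=> /is_diff_eq; apply; apply/funext => k /=; rewrite scaleNr scalerN.
Qed.

Lemma hasd_mul (F G : R * R -> quat R) z X Y X' Y' :
  hasd F z X Y -> hasd G z X' Y' ->
  hasd (fun w => F w * G w) z (F z * X' + X * G z) (F z * Y' + Y * G z).
Proof.
move=> hF hG; apply: (is_diff_eq (is_diff_qmul hF hG)); apply/funext => k /=.
rewrite mulrDr mulrDl !scalerDr !scalerAl -!scalerAr.
by rewrite -!scalerAl addrACA.
Qed.

Lemma hasd_mulr (F : R * R -> quat R) c z X Y :
  hasd F z X Y -> hasd (fun w => F w * c) z (X * c) (Y * c).
Proof.
move=> hF; apply: (hasd_eq (hasd_mul hF (hasd_cst c z))).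
  by rewrite mulr0 add0r.
by rewrite mulr0 add0r.
Qed.

Lemma hasd_mull (F : R * R -> quat R) c z X Y :
  hasd F z X Y -> hasd (fun w => c * F w) z (c * X) (c * Y).
Proof.
move=> hF; apply: (hasd_eq (hasd_mul (hasd_cst c z) hF)).
  by rewrite mul0r addr0.
by rewrite mul0r addr0.
Qed.

End PartialDerivatives.

(** * Maps with zero differential, and locally constant maps on connected sets *)

Section LocallyConstant.
Set Implicit Arguments.
Unset Strict Implicit.
Context {R : realType}.

(** Mean value theorem on the segment from [z] to [w], which stays in a ball where the differential
    vanishes. *)
Lemma hasd0_locally_cst_real (f : R * R -> R) (z : R * R) :
  (\forall w \near z, hasd f w 0 0) -> \forall w \near z, f w = f z.
Proof.
move=> /nbhs_ballP[e /= e0 he]; apply/nbhs_ballP; exists e => //= w.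
rewrite -!ball_normE /= => zw.
pose g (t : R) := f (z.1 + t * (w.1 - z.1), z.2 + t * (w.2 - z.2)).
have inb (t : R) : 0 <= t <= 1 ->
    hasd f (z.1 + t * (w.1 - z.1), z.2 + t * (w.2 - z.2)) 0 0.
  move=> /andP[t0 t1]; apply: he; rewrite -ball_normE /=.
  apply: le_lt_trans zw.
  rewrite [X in `|X|](_ : _ = t *: (z - w)).
    by rewrite normrZ ger0_norm // ler_piMl.
  by apply: injective_projections; rewrite /= /GRing.scale /=; ring.
have aff (t a b : R) : is_derive t 1 (fun s : R => a + s * b) b.
  have : is_derive t 1 (cst a + (id * cst b)) (0 + (t *: 0 + b *: 1)).
    by apply: is_deriveD.
  by move=> /is_derive_eq; apply; rewrite /GRing.scale /= mulr0 !add0r mulr1.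
have dg (t : R) : 0 <= t <= 1 -> is_derive t 1 g 0.
  move=> ht; have := hasd_curve (aff t z.1 (w.1 - z.1)) (aff t z.2 (w.2 - z.2)) (inb t ht).
  by move=> /is_derive_eq; apply; rewrite !scaler0 addr0.
have [| |c _] := @MVT_segment R g (fun=> 0) 0 1 ler01.
- by move=> t; rewrite in_itv /= => /andP[t0 t1]; apply: dg; rewrite !ltW.
- apply: derivable_within_continuous => t; rewrite in_itv /= => ht.
  by have [] := dg t ht.
rewrite mul0r => /eqP; rewrite subr_eq0 /g => /eqP.
rewrite !mul1r !mul0r !addr0 !subrKC -!surjective_pairing.
by [].
Qed.

Lemma hasd0_locally_cst (F : R * R -> quat R) (z : R * R) :
  (\forall w \near z, hasd F w 0 0) -> \forall w \near z, F w = F z.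
Proof.
move=> h.
have c (q : {linear quat R -> R}) : continuous q -> \forall w \near z, q (F w) = q (F z).
  move=> cq; apply: hasd0_locally_cst_real; apply: filterS h => w hw.
  by have := hasd_linear cq hw; rewrite linear0.
have c0 := c _ q0_continuous; have c1 := c _ q1_continuous.
have c2 := c _ q2_continuous; have c3 := c _ q3_continuous.
near=> w; apply: quatP; near: w; [exact: c0|exact: c1|exact: c2|exact: c3].
Unshelve. all: by end_near. Qed.

(** The level set through [x] is open in [A], and so is the union of the other level sets;
    connectedness leaves no room for the latter. *)
Lemma connected_locally_cst (T : topologicalType) (U : Type) (A : set T) (f : T -> U) :
  open A -> connected A -> (forall x, A x -> \forall y \near x, f y = f x) ->
  forall x y, A x -> A y -> f x = f y.
Proof.
move=> oA cA hf x y Ax Ay.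
pose B := [set t | A t /\ f t = f x].
suff BA : B = A by move: Ay; rewrite -BA => -[_ ->].
apply: cA; first by exists x.
- exists B; last by rewrite /B; apply/seteqP; split => t /=; [case|case].
  rewrite openE => t [At ft]; rewrite /interior.
  near=> s; split; first by near: s; exact: open_nbhs_nbhs.
  by rewrite -ft; near: s; exact: hf.
- exists (~` [set t | A t /\ f t <> f x]); last first.
    apply/seteqP; split => t /=.
      by move=> [At ft]; split => //; case.
    move=> [At nt]; split => //; apply: contrapT => nft; exact: nt.
  apply: open_closedC; rewrite openE => t [At ft]; rewrite /interior.
  near=> s; split; first by near: s; exact: open_nbhs_nbhs.
  suff -> : f s = f t by [].
  by near: s; exact: hf.
Unshelve. all: by end_near. Qed.

End LocallyConstant.

(** * Quaternionic power series and the exponential *)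

Section QuaternionPowerSeries.
Set Implicit Arguments.
Unset Strict Implicit.
Context {R : realType}.
Implicit Types (c : nat -> quat R) (t : R).

(** The sum norm is submultiplicative with constant 1, unlike the maximum norm carried by [quat R],
    so powers are bounded without extra constants. *)
Definition qnorm1 (x : quat R) : R := `|q0 x| + `|q1 x| + `|q2 x| + `|q3 x|.

Lemma qnorm1_coord (x : quat R) : [/\ `|q0 x| <= qnorm1 x, `|q1 x| <= qnorm1 x,
  `|q2 x| <= qnorm1 x & `|q3 x| <= qnorm1 x].
Proof.
have h0 := normr_ge0 (q0 x); have h1 := normr_ge0 (q1 x).
have h2 := normr_ge0 (q2 x); have h3 := normr_ge0 (q3 x).
by rewrite /qnorm1; split; lra.
Qed.

Lemma qnorm1_ge0 (x : quat R) : 0 <= qnorm1 x.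
Proof. by rewrite /qnorm1 !addr_ge0. Qed.

Lemma qnorm1Z a (x : quat R) : qnorm1 (a *: x) = `|a| * qnorm1 x.
Proof. by rewrite /qnorm1 !qZ !normrM !mulrDr. Qed.

Lemma qnorm1D (x y : quat R) : qnorm1 (x + y) <= qnorm1 x + qnorm1 y.
Proof.
rewrite /qnorm1 !qD.
have := ler_normD (q0 x) (q0 y); have := ler_normD (q1 x) (q1 y).
have := ler_normD (q2 x) (q2 y); have := ler_normD (q3 x) (q3 y).
lra.
Qed.

Lemma qnorm1_1 : qnorm1 (1 : quat R) = 1.
Proof. by rewrite /qnorm1 !mkqE normr1 !normr0 !addr0. Qed.

Lemma qnorm1M (x y : quat R) : qnorm1 (x * y) <= qnorm1 x * qnorm1 y.
Proof.
rewrite /qnorm1 !mkqE.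
have T4 (a b c d : R) : `|a + b + c + d| <= `|a| + `|b| + `|c| + `|d|.
  by rewrite !(le_trans (ler_normD _ _))// !lerD// (le_trans (ler_normD _ _))// lerD// ler_normD.
have H0 := T4 (q0 x * q0 y) (- (q1 x * q1 y)) (- (q2 x * q2 y)) (- (q3 x * q3 y)).
have H1 := T4 (q0 x * q1 y) (q1 x * q0 y) (q2 x * q3 y) (- (q3 x * q2 y)).
have H2 := T4 (q0 x * q2 y) (- (q1 x * q3 y)) (q2 x * q0 y) (q3 x * q1 y).
have H3 := T4 (q0 x * q3 y) (q1 x * q2 y) (- (q2 x * q1 y)) (q3 x * q0 y).
rewrite !normrN !normrM in H0 H1 H2 H3.
apply: le_trans (lerD (lerD (lerD H0 H1) H2) H3) _.
by rewrite le_eqVlt; apply/orP; left; apply/eqP; ring.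
Qed.

Lemma qnorm1X (x : quat R) n : qnorm1 (x ^+ n) <= qnorm1 x ^+ n.
Proof.
elim: n => [|n IH]; first by rewrite !expr0 qnorm1_1.
rewrite !exprS; apply: le_trans (qnorm1M _ _) _.
by rewrite ler_wpM2l ?qnorm1_ge0.
Qed.

(** Decay of the Taylor coefficients of an entire function of exponential type: it gives convergence
    everywhere and survives termwise differentiation. *)
Definition fact_bounded (c : nat -> R) := exists C M : R,
  [/\ 0 <= C, 0 <= M & forall n, `|c n| <= C * (M ^+ n / n`!%:R)].

Lemma fact_bounded_cvg (c : nat -> R) t : fact_bounded c -> cvgn (pseries c t).
Proof.
move=> [C [M [C0 M0 hc]]]; apply: normed_cvg.
apply: (@series_le_cvg _ _ (fun n => C * exp_coeff (M * `|t|) n)) => [n|n|n|].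
- exact: normr_ge0.
- by rewrite mulr_ge0 // exp_coeff_ge0 // mulr_ge0.
- rewrite /= normrM normrX /exp_coeff /= exprMn.
  apply: le_trans (ler_wpM2r _ (hc n)) _; first exact: exprn_ge0.
  by rewrite le_eqVlt; apply/orP; left; apply/eqP; ring.
have := is_cvg_seriesZ (k := C) (is_cvg_series_exp_coeff (M * `|t|)).
by [].
Qed.

Lemma fact_bounded_diffs (c : nat -> R) :
  fact_bounded c -> fact_bounded (pseries_diffs c).
Proof.
move=> [C [M [C0 M0 hc]]]; exists (C * M), M; split=> //; first exact: mulr_ge0.
move=> n; rewrite /pseries_diffs normrM ger0_norm //.
apply: le_trans (ler_wpM2l _ (hc n.+1)) _ => //.
rewrite factS natrM exprS le_eqVlt; apply/orP; left; apply/eqP.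
have a0 : n.+1%:R != 0 :> R by rewrite pnatr_eq0.
have b0 : n`!%:R != 0 :> R by rewrite pnatr_eq0 -lt0n fact_gt0.
by move: a0 b0; set a := n.+1%:R; set b := n`!%:R => a0 b0; field; apply/andP.
Qed.

Lemma fact_bounded_derive (c : nat -> R) t : fact_bounded c ->
  is_derive t 1 (fun s => limn (pseries c s)) (limn (pseries (pseries_diffs c) t)).
Proof.
(* Termwise differentiation asks for convergence of the series and of its first two formal
   derivatives at a point beyond [|t|]. The series converge everywhere, so any such point will do,
   here [|t| + 1]. *)
move=> hc; have hd := fact_bounded_diffs hc; have hdd := fact_bounded_diffs hd.
apply: (@pseries_snd_diffs _ c (`|t| + 1)).
- exact: fact_bounded_cvg.
- exact: fact_bounded_cvg.
- exact: fact_bounded_cvg.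
- by rewrite [ltRHS]ger0_norm ?addr_ge0 // ltrDl.
Qed.

Definition qent c := exists C M : R,
  [/\ 0 <= C, 0 <= M & forall n, qnorm1 (c n) <= C * (M ^+ n / n`!%:R)].

Definition qps_diffs c n := n.+1%:R *: c n.+1.

(** The variable is real, so the series splits into four real power series. A complex argument is
    accommodated later by moving it into the coefficients [cexp1] and [cexp2]. *)
Definition qps c t : quat R := limn (series (fun n => t ^+ n *: c n)).

Lemma qent_coord c : qent c -> [/\ fact_bounded (q0 \o c), fact_bounded (q1 \o c),
  fact_bounded (q2 \o c) & fact_bounded (q3 \o c)].
Proof.
move=> [C [M [C0 M0 hc]]]; split; exists C, M; split=> // n /=;
  have [h0 h1 h2 h3] := qnorm1_coord (c n); exact: le_trans (hc n).
Qed.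

Lemma qent_diffs c : qent c -> qent (qps_diffs c).
Proof.
move=> [C [M [C0 M0 hc]]]; exists (C * M), M; split=> //; first exact: mulr_ge0.
move=> n; rewrite /qps_diffs qnorm1Z ger0_norm //.
apply: le_trans (ler_wpM2l _ (hc n.+1)) _ => //.
rewrite factS natrM exprS le_eqVlt; apply/orP; left; apply/eqP.
have a0 : n.+1%:R != 0 :> R by rewrite pnatr_eq0.
have b0 : n`!%:R != 0 :> R by rewrite pnatr_eq0 -lt0n fact_gt0.
by move: a0 b0; set a := n.+1%:R; set b := n`!%:R => a0 b0; field; apply/andP.
Qed.

Lemma series_coord (q : {linear quat R -> R}) c t :
  (fun n => q (series (fun n => t ^+ n *: c n) n)) = pseries (q \o c) t.
Proof.
apply/funext => n; rewrite /pseries /series /= linear_sum; apply: eq_bigr => i _.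
by rewrite linearZ /= mulrC.
Qed.

Lemma qps_cvg_mkq c t : qent c -> series (fun n => t ^+ n *: c n) @ \oo -->
  mkq (limn (pseries (q0 \o c) t)) (limn (pseries (q1 \o c) t))
      (limn (pseries (q2 \o c) t)) (limn (pseries (q3 \o c) t)).
Proof.
move=> /qent_coord[h0 h1 h2 h3].
have -> : series (fun n => t ^+ n *: c n) = fun n => mkq (pseries (q0 \o c) t n)
    (pseries (q1 \o c) t n) (pseries (q2 \o c) t n) (pseries (q3 \o c) t n).
  by apply/funext => n; rewrite -!series_coord -mkq_eta.
by apply: mkq_cvg; apply: fact_bounded_cvg.
Qed.

Lemma qpsE c t : qent c -> qps c t =
  mkq (limn (pseries (q0 \o c) t)) (limn (pseries (q1 \o c) t))
      (limn (pseries (q2 \o c) t)) (limn (pseries (q3 \o c) t)).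
Proof. by move=> hc; apply: cvg_lim => //; apply: qps_cvg_mkq. Qed.

Lemma qps_cvg c t : qent c -> series (fun n => t ^+ n *: c n) @ \oo --> qps c t.
Proof. by move=> hc; rewrite qpsE //; apply: qps_cvg_mkq. Qed.

Lemma qps_derive c t : qent c -> is_derive t 1 (qps c) (qps (qps_diffs c) t).
Proof.
move=> hc; have -> : qps c = fun s => mkq (limn (pseries (q0 \o c) s))
    (limn (pseries (q1 \o c) s)) (limn (pseries (q2 \o c) s)) (limn (pseries (q3 \o c) s)).
  by apply/funext => s; exact: qpsE.
rewrite qpsE; last exact: qent_diffs.
have [h0 h1 h2 h3] := qent_coord hc.
have D (q : {linear quat R -> R}) : q \o qps_diffs c = pseries_diffs (q \o c).
  by apply/funext => n; rewrite /qps_diffs /pseries_diffs /= linearZ.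
have E (x : quat R) (f : R -> R) d : is_derive t 1 f d -> is_derive t 1 (fun s => f s *: x) (d *: x).
  move=> hf; have := is_derive_scale hf (is_derive_cst x t 1).
  by move=> /is_derive_eq; apply; rewrite scaler0 add0r.
rewrite (D q0) (D q1) (D q2) (D q3) mkq_basis.
under [X in is_derive _ _ X _]funext => s do rewrite mkq_basis.
by do 3 (apply: is_deriveD; last by apply: E; exact: fact_bounded_derive); apply: E; exact: fact_bounded_derive.
Qed.

Lemma qmulr_continuous (m : quat R) : continuous (fun x : quat R => x * m).
Proof.
move=> x; have [d _] := is_diff_qmul (is_diff_id x) (is_diff_cst m x).
exact: (differentiable_continuous d).
Qed.

Lemma qmull_continuous (m : quat R) : continuous (fun x : quat R => m * x).
Proof.
move=> x; have [d _] := is_diff_qmul (is_diff_cst m x) (is_diff_id x).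
exact: (differentiable_continuous d).
Qed.

Lemma qps_mulr c m t : qent c -> qps (fun n => c n * m) t = qps c t * m.
Proof.
move=> hc; apply: cvg_lim => //.
have := continuous_cvg _ (@qmulr_continuous m _) (qps_cvg (t := t) hc).
rewrite (_ : (_ \o _) = series (fun n => t ^+ n *: (c n * m))); first by apply.
apply/funext => n; rewrite /series /= mulr_suml; apply: eq_bigr => i _.
by rewrite scalerAl.
Qed.

Lemma qps_mull c m t : qent c -> qps (fun n => m * c n) t = m * qps c t.
Proof.
move=> hc; apply: cvg_lim => //.
have := continuous_cvg _ (@qmull_continuous m _) (qps_cvg (t := t) hc).
rewrite (_ : (_ \o _) = series (fun n => t ^+ n *: (m * c n))); first by apply.
apply/funext => n; rewrite /series /= mulr_sumr; apply: eq_bigr => i _.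
by rewrite scalerAr.
Qed.

Lemma qpsD c d t : qent c -> qent d ->
  qps (fun n => c n + d n) t = qps c t + qps d t.
Proof.
move=> hc hd; apply: cvg_lim => //.
have -> : series (fun n => t ^+ n *: (c n + d n)) =
    series (fun n => t ^+ n *: c n) + series (fun n => t ^+ n *: d n).
  apply/funext => n; transitivity (series (fun n => t ^+ n *: c n) n +
    series (fun n => t ^+ n *: d n) n); last by [].
  by rewrite /series /= -big_split /=; apply: eq_bigr => i _; rewrite scalerDr.
exact: cvgD (qps_cvg (t := t) hc) (qps_cvg (t := t) hd).
Qed.

Lemma qpsZ a c t : qent c -> qps (fun n => a *: c n) t = a *: qps c t.
Proof.
move=> hc; transitivity (a%:A * qps c t); last by rewrite -scalerAl mul1r.
rewrite -qps_mull //; congr (qps _ t).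
by apply/funext => n; rewrite -scalerAl mul1r.
Qed.

Lemma qps0 c : qps c 0 = c 0%N.
Proof.
apply: cvg_lim => //; rewrite -(cvg_shiftn 1) /=.
rewrite (_ : (fun n => _) = cst (c 0%N)); first exact: cvg_cst.
apply/funext => n; rewrite /series /= addn1 big_nat_recl // expr0 scale1r.
by rewrite big1 ?addr0 // => i _; rewrite exprS mul0r scale0r.
Qed.

Lemma qpsX c t : qent c ->
  qps (fun n => if n is m.+1 then c m else 0) t = t *: qps c t.
Proof.
move=> hc; apply: cvg_lim => //; rewrite -(cvg_shiftn 1) /=.
set u := (u in u @ _ --> _).
have -> : u = t *: series (fun n => t ^+ n *: c n).
  apply/funext => n; transitivity (t *: series (fun n => t ^+ n *: c n) n); last by [].
  rewrite /u /series /= addn1 big_nat_recl // scaler0 add0r.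
  by rewrite scaler_sumr; apply: eq_bigr => i _; rewrite scalerA -exprS.
exact: cvgZl_tmp (qps_cvg (t := t) hc).
Qed.

Lemma qent_cst_exp (k : nat -> R) (m : quat R) C : (forall n, `|k n| <= C ^+ n) -> 0 <= C ->
  qent (fun n => (k n / n`!%:R) *: m ^+ n).
Proof.
move=> hk C0; exists 1, (C * qnorm1 m); split; rewrite ?ler01 ?mulr_ge0 ?qnorm1_ge0 //.
move=> n; rewrite qnorm1Z mul1r exprMn normrM [`|_^-1|]ger0_norm ?invr_ge0 //.
rewrite mulrAC; apply: ler_wpM2r; first by rewrite invr_ge0.
by rewrite ler_pM ?qnorm1_ge0 ?qnorm1X.
Qed.

End QuaternionPowerSeries.

(** * Powers of complex numbers, encoded as pairs of reals like the points of [D] *)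

Section ComplexPowers.
Set Implicit Arguments.
Unset Strict Implicit.
Context {R : realType}.
Implicit Types (z : R * R).

Definition cmul z (p : R * R) : R * R :=
  (z.1 * p.1 - z.2 * p.2, z.2 * p.1 + z.1 * p.2).
Definition cpow z n : R * R := iter n (cmul z) (1, 0).

Lemma cpowS1 z n : (cpow z n.+1).1 = z.1 * (cpow z n).1 - z.2 * (cpow z n).2.
Proof. by []. Qed.
Lemma cpowS2 z n : (cpow z n.+1).2 = z.2 * (cpow z n).1 + z.1 * (cpow z n).2.
Proof. by []. Qed.

Lemma cpow_bound z n : `|(cpow z n).1| + `|(cpow z n).2| <= (`|z.1| + `|z.2|) ^+ n.
Proof.
elim: n => [|n IH]; first by rewrite expr0 /= normr1 normr0 addr0.
rewrite exprS cpowS1 cpowS2; set u := (cpow z n).1 in IH *; set v := (cpow z n).2 in IH *.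
have h1 := ler_normB (z.1 * u) (z.2 * v); have h2 := ler_normD (z.2 * u) (z.1 * v).
rewrite !normrM in h1 h2.
apply: le_trans (lerD h1 h2) _.
apply: (@le_trans _ _ ((`|z.1| + `|z.2|) * (`|u| + `|v|))).
  by rewrite le_eqVlt; apply/orP; left; apply/eqP; ring.
by rewrite ler_wpM2l ?addr_ge0.
Qed.

Lemma cpow_real (a : R) n : cpow (a, 0) n = (a ^+ n, 0).
Proof.
elim: n => // n IH; rewrite /cpow iterS -/(cpow _ _) IH exprS /cmul /=.
by congr (_, _); ring.
Qed.

Lemma cpow_conj z n : cpow (z.1, - z.2) n = ((cpow z n).1, - (cpow z n).2).
Proof.
elim: n => [|n IH]; first by rewrite /cpow /= oppr0.
rewrite /cpow iterS -/(cpow _ _) IH /cmul /=.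
by rewrite -/(cpow z n); congr (_, _); ring.
Qed.

End ComplexPowers.

Section ExponentialStem.
Set Implicit Arguments.
Unset Strict Implicit.
Context {R : realType}.
Implicit Types (lam : quat R) (z : R * R) (t : R).

(* [cexp1] and [cexp2] are the components of [z^n lam^n / n!] in H (x) C; [csinc]
   is the sequence of coefficients of [sin(t lam) / t]. *)
Definition cexp1 lam z n : quat R := ((cpow z n).1 / n`!%:R) *: lam ^+ n.
Definition cexp2 lam z n : quat R := ((cpow z n).2 / n`!%:R) *: lam ^+ n.
Definition csinc lam n : quat R := ((cpow (0, 1) n).1 / n.+1`!%:R) *: lam ^+ n.+1.

Lemma qent_cexp lam z : qent (cexp1 lam z) /\ qent (cexp2 lam z).
Proof.
split; apply: (@qent_cst_exp _ _ _ (`|z.1| + `|z.2|)); rewrite ?addr_ge0 // => n;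
  have := cpow_bound z n; apply: le_trans; rewrite ?lerDl ?lerDr normr_ge0 //.
Qed.

Lemma factSK (n : nat) : n.+1%:R * (n.+1`!%:R)^-1 = (n`!%:R)^-1 :> R.
Proof. by rewrite factS natrM invfM mulVKf // pnatr_eq0. Qed.

(** The [t]-derivative of [exp(t z lam)] is [z exp(t z lam) lam]; this is its first component on
    coefficients. *)
Lemma diffs_cexp1 lam z : qps_diffs (cexp1 lam z) =
  fun n => (z.1 *: cexp1 lam z n + (- z.2) *: cexp2 lam z n) * lam.
Proof.
apply/funext => n; rewrite /qps_diffs /cexp1 /cexp2 (scalerA n.+1%:R) (mulrCA n.+1%:R) factSK cpowS1.
rewrite exprSr !scalerA -scalerDl -scalerAl; congr (_ *: _); ring.
Qed.

Lemma diffs_cexp2 lam z : qps_diffs (cexp2 lam z) =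
  fun n => (z.2 *: cexp1 lam z n + z.1 *: cexp2 lam z n) * lam.
Proof.
apply/funext => n; rewrite /qps_diffs /cexp1 /cexp2 (scalerA n.+1%:R) (mulrCA n.+1%:R) factSK cpowS2.
rewrite exprSr !scalerA -scalerDl -scalerAl; congr (_ *: _); ring.
Qed.

Lemma qent_scale (a : R) (c : nat -> quat R) : qent c -> qent (fun n => a *: c n).
Proof.
move=> [C [M [C0 M0 hc]]]; exists (`|a| * C), M; split=> // [|n].
  by rewrite mulr_ge0.
by rewrite qnorm1Z -mulrA ler_wpM2l.
Qed.

Lemma qent_add (c d : nat -> quat R) : qent c -> qent d -> qent (fun n => c n + d n).
Proof.
move=> [C [M [C0 M0 hc]]] [C' [M' [C'0 M'0 hd]]].
exists (C + C'), (M + M'); split=> [||n]; rewrite ?addr_ge0 //.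
apply: le_trans (qnorm1D _ _) _; rewrite mulrDl.
apply: lerD; [apply: le_trans (hc n) _|apply: le_trans (hd n) _];
  apply: ler_wpM2l => //; apply: ler_wpM2r; rewrite ?invr_ge0 //;
  by apply: lerXn2r; rewrite ?nnegrE ?addr_ge0 // ?lerDl ?lerDr.
Qed.

(** With [rexp2], the components of [exp(t z lam)] as functions of the real scale [t] along the
    fixed direction [z]. *)
Definition rexp1 lam z := qps (cexp1 lam z).
Definition rexp2 lam z := qps (cexp2 lam z).

Lemma rexp1_derive lam z t :
  is_derive t 1 (rexp1 lam z) ((z.1 *: rexp1 lam z t - z.2 *: rexp2 lam z t) * lam).
Proof.
have [h1 h2] := qent_cexp lam z.
have := qps_derive t h1; move=> /is_derive_eq; apply.
rewrite diffs_cexp1 qps_mulr; last by apply: qent_add; apply: qent_scale.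
by rewrite qpsD ?qpsZ ?scaleNr //; apply: qent_scale.
Qed.

Lemma rexp2_derive lam z t :
  is_derive t 1 (rexp2 lam z) ((z.2 *: rexp1 lam z t + z.1 *: rexp2 lam z t) * lam).
Proof.
have [h1 h2] := qent_cexp lam z.
have := qps_derive t h2; move=> /is_derive_eq; apply.
rewrite diffs_cexp2 qps_mulr; last by apply: qent_add; apply: qent_scale.
by rewrite qpsD ?qpsZ //; apply: qent_scale.
Qed.

Lemma rexp_0 lam z : rexp1 lam z 0 = 1 /\ rexp2 lam z 0 = 0.
Proof.
by rewrite /rexp1 /rexp2 !qps0 /cexp1 /cexp2 /= !expr0 fact0 invr1 mulr1 scale1r mul0r scale0r.
Qed.

(** Every coefficient is a real multiple of a power of [lam]. *)
Lemma rexp_comm lam z t : lam * rexp1 lam z t = rexp1 lam z t * lam /\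
  lam * rexp2 lam z t = rexp2 lam z t * lam.
Proof.
have [h1 h2] := qent_cexp lam z.
rewrite /rexp1 /rexp2 -!qps_mull -?qps_mulr //; split; congr (qps _ t); apply/funext => n;
  by rewrite /cexp1 /cexp2 -scalerAl -scalerAr -exprS exprSr.
Qed.

(* [exp(t lam)], [cos(t lam)], [sin(t lam)], [sin(t lam) / t] and the first two
   derivatives of the latter. *)
Definition qex lam := rexp1 lam (1, 0).
Definition qco lam := rexp1 lam (0, 1).
Definition qsi lam := rexp2 lam (0, 1).
Definition qsc lam := qps (csinc lam).
Definition qsc1 lam := qps (qps_diffs (csinc lam)).
Definition qsc2 lam := qps (qps_diffs (qps_diffs (csinc lam))).

Lemma qex_derive lam t : is_derive t 1 (qex lam) (qex lam t * lam).
Proof.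
by have := rexp1_derive lam (1, 0) t; rewrite /= scale1r scale0r subr0.
Qed.

Lemma qco_derive lam t : is_derive t 1 (qco lam) (- (qsi lam t * lam)).
Proof.
by have := rexp1_derive lam (0, 1) t; rewrite /= scale1r scale0r sub0r mulNr.
Qed.

Lemma qsi_derive lam t : is_derive t 1 (qsi lam) (qco lam t * lam).
Proof.
by have := rexp2_derive lam (0, 1) t; rewrite /= scale1r scale0r addr0.
Qed.

Lemma qent_csinc lam : qent (csinc lam).
Proof.
have [[C [M [C0 M0 hc]]] _] := qent_cexp lam (0, 1).
exists (C * qnorm1 lam), M; split=> [||n] //; first by rewrite mulr_ge0 ?qnorm1_ge0.
(* Compared with the coefficients of the cosine there is one more factor [lam / (n + 1)], so their
   bound carries over. *)
have -> : csinc lam n = n.+1%:R^-1 *: (cexp1 lam (0, 1) n * lam).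
  rewrite /csinc /cexp1 exprSr -scalerAl scalerA factS natrM invfM.
  by congr (_ *: _); rewrite mulrCA mulrA.
rewrite qnorm1Z ger0_norm ?invr_ge0 //.
apply: (@le_trans _ _ (qnorm1 (cexp1 lam (0, 1) n * lam))).
  rewrite ler_piMl ?qnorm1_ge0 // invf_le1 // -[1]/(1%:R) ler_nat //.
apply: le_trans (qnorm1M _ _) _; rewrite mulrAC.
by apply: ler_wpM2r; rewrite ?qnorm1_ge0.
Qed.

Lemma qsc_derive lam t : is_derive t 1 (qsc lam) (qsc1 lam t).
Proof. by apply: qps_derive; exact: qent_csinc. Qed.
Lemma qsc1_derive lam t : is_derive t 1 (qsc1 lam) (qsc2 lam t).
Proof. by apply: qps_derive; apply: qent_diffs; exact: qent_csinc. Qed.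
Lemma qsc2_derivable lam t : derivable (qsc2 lam) t 1.
Proof.
by have [] := qps_derive t (qent_diffs (qent_diffs (qent_csinc lam))).
Qed.

Lemma qsi_qsc lam t : qsi lam t = t *: qsc lam t.
Proof.
rewrite /qsc -qpsX; last exact: qent_csinc.
congr (qps _ t); apply/funext => -[|n]; first by rewrite /cexp2 /= mul0r scale0r.
(* [Im i^(n+1) = Re i^n]. *)
by rewrite /cexp2 cpowS2 /= mul0r addr0 mul1r.
Qed.

(** Both sides are the derivative of [sin(t lam) = t s(t)], where [s(t) = sin(t lam) / t]. *)
Lemma qsc_eq1 lam t : qco lam t * lam = qsc lam t + t *: qsc1 lam t.
Proof.
have [_ <-] := qsi_derive lam t.
have -> : qsi lam = fun s => s *: qsc lam s by apply/funext => s; exact: qsi_qsc.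
have [_ ->] := is_derive_scale (is_derive_id t 1) (qsc_derive lam t).
by rewrite scale1r addrC.
Qed.

(** Differentiating [qsc_eq1] gives the spherical Bessel equation of order zero,
    [t s'' + 2 s' + t s lam^2 = 0]. It becomes the last equation of the Vekua system for the
    exponential. *)
Lemma qsc_eq2 lam t :
  t *: qsc2 lam t = - (t *: qsc lam t * lam * lam) - 2 *: qsc1 lam t.
Proof.
have h : is_derive t 1 (fun s => qco lam s * lam) (- (qsi lam t * lam) * lam).
  have := is_derive_qmul (qco_derive lam t) (is_derive_cst lam t 1).
  by move=> /is_derive_eq; apply; rewrite mulr0 add0r.
have h2 := is_deriveD (qsc_derive lam t) (is_derive_scale (is_derive_id t 1) (qsc1_derive lam t)).
have e : (fun s => qco lam s * lam) = qsc lam + (fun s => s *: qsc1 lam s).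
  by apply/funext => s; exact: qsc_eq1.
rewrite e in h; have [_ h'] := h; have [_ h2'] := h2.
move: h'; rewrite h2' qsi_qsc scale1r => /(congr1 (fun x => x - 2 *: qsc1 lam t)).
rewrite mulNr => <-; rewrite scaler_nat mulr2n addrCA addrK //.
Qed.

(** Read off from [s(t) = lam - t^2 lam^3 / 6 + ...]. It replaces [qsc_eq2] at [t = 0], where that
    equation does not determine [s'']. *)
Lemma qsc_at0 lam : qsc lam 0 = lam /\ 3 *: qsc2 lam 0 = - (lam * lam * lam).
Proof.
rewrite /qsc /qsc2 !qps0 /qps_diffs /csinc /=; split.
  by rewrite expr1 (_ : 1`! = 1)%N // divr1 scale1r.
rewrite !scalerA !exprS expr0 (mulr1 lam) (mulrA lam) -[RHS]scaleN1r; congr (_ *: _).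
by rewrite /= (_ : 3`! = 6)%N //; field.
Qed.

Lemma qco_even lam t : qco lam (- t) = qco lam t /\ qsc lam (- t) = qsc lam t.
Proof.
(* [(- t)^n i^n] is the conjugate of [t^n i^n]. *)
have h n : (- t) ^+ n * (cpow (0, 1) n).1 = t ^+ n * (cpow (0, 1) n).1 /\
   (- t) ^+ n * (cpow (0, 1) n).2 = - (t ^+ n * (cpow (0, 1) n).2).
  elim: n => [|n [IH1 IH2]]; first by rewrite !expr0 /= mulr0 oppr0.
  rewrite cpowS1 cpowS2 !exprS /= !mul0r !mul1r !addr0 !sub0r; split.
    transitivity (t * ((- t) ^+ n * (cpow (0, 1) n).2)); first by ring.
    by rewrite IH2; ring.
  transitivity (- t * ((- t) ^+ n * (cpow (0, 1) n).1)); first by ring.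
  by rewrite IH1; ring.
rewrite /qco /qsc /rexp1 /qps; split; congr (limn (series _)); apply/funext => n;
  have [hn _] := h n; rewrite /cexp1 /csinc !scalerA !mulrA hn //.
Qed.

Lemma qsc1_odd lam t : qsc1 lam (- t) = - qsc1 lam t.
Proof.
have h := is_derive_diff_comp (is_deriveNid t 1) ((is_derive_is_diff _ _ _).1 (qsc_derive lam (- t))).
have e : qsc lam \o -%R = qsc lam by apply/funext => s /=; exact: (qco_even _ _).2.
rewrite e in h; have [_ h1] := h; have [_ h2] := qsc_derive lam t.
by rewrite h2 scaleN1r in h1; rewrite h1 opprK.
Qed.

End ExponentialStem.

(** * The algebra of quaternions tensored with the complex numbers *)

Section ComplexifiedQuaternions.
Set Implicit Arguments.
Unset Strict Implicit.
Context {R : realType}.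
Implicit Types (u v w : quat R * quat R) (m : quat R).

Lemma qN (x : quat R) : (q0 (- x) = - q0 x) * (q1 (- x) = - q1 x)
  * (q2 (- x) = - q2 x) * (q3 (- x) = - q3 x).
Proof. by rewrite -scaleN1r !qZ !mulN1r. Qed.

Definition hcr u m : quat R * quat R := (u.1 * m, u.2 * m).
(** Multiplication by [iota]. Throughout, [hasd H z K (hci K)] expresses the Cauchy-Riemann
    equations: [H] is complex differentiable at [z] with [dH/dz = K]. *)
Definition hci u : quat R * quat R := (- u.2, u.1).

Lemma hc_mul_iota u : hc_mul hc_iota u = hci u.
Proof. by rewrite /hc_mul /hc_iota /hci /= !mul0r !mul1r sub0r add0r. Qed.

Lemma hc_mulA u v w : hc_mul u (hc_mul v w) = hc_mul (hc_mul u v) w.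
Proof.
rewrite /hc_mul /=; apply: injective_projections;
  rewrite /= !(mulrBl, mulrBr, mulrDl, mulrDr) !mulrA ?opprD -!addrA;
  by congr (_ + _); rewrite addrA addrC.
Qed.

Lemma hc_mulr1 u : hc_mul u (1, 0) = u.
Proof. by rewrite /hc_mul /= !mulr0 !mulr1 subr0 add0r -surjective_pairing. Qed.

Lemma hc_mul1r u : hc_mul (1, 0) u = u.
Proof. by rewrite /hc_mul /= !mul0r !mul1r subr0 addr0 -surjective_pairing. Qed.

Lemma hc_mulcr u v m : hc_mul u (hcr v m) = hcr (hc_mul u v) m.
Proof. by rewrite /hc_mul /hcr /= mulrBl mulrDl !mulrA. Qed.

Lemma hc_mulci u v : hc_mul u (hci v) = hci (hc_mul u v).
Proof.
by rewrite /hc_mul /hci /= !mulrN opprD addrC; congr (_, _); rewrite addrC.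
Qed.

Lemma hc_mulir u v : hc_mul (hci u) v = hci (hc_mul u v).
Proof.
rewrite /hc_mul /hci /= !mulNr; congr (_, _); last by rewrite addrC.
by rewrite opprD addrC.
Qed.

Lemma hc_mul_conj u v : hc_mul (hc_conj u) (hc_conj v) = hc_conj (hc_mul u v).
Proof. by rewrite /hc_mul /hc_conj /= mulrNN !mulNr mulrN opprD. Qed.

Lemma hciK u : hci (hci u) = - u.
Proof. by rewrite /hci /=; apply: injective_projections. Qed.

Lemma hasd_hc_mul (F G : R * R -> quat R * quat R) z X Y X' Y' :
  hasd F z X Y -> hasd G z X' Y' ->
  hasd (fun p => hc_mul (F p) (G p)) z (hc_mul (F z) X' + hc_mul X (G z))
       (hc_mul (F z) Y' + hc_mul Y (G z)).
Proof.
move=> /hasdP[f1 f2] /hasdP[g1 g2]; apply/hasdP; split => /=.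
  apply: (hasd_eq (hasdB (hasd_mul f1 g1) (hasd_mul f2 g2))).
    by rewrite opprD addrACA.
  by rewrite opprD addrACA.
apply: (hasd_eq (hasdD (hasd_mul f1 g2) (hasd_mul f2 g1))).
  by rewrite addrACA [X in _ + X]addrC addrACA; congr (_ + _); rewrite addrC.
by rewrite addrACA [X in _ + X]addrC addrACA; congr (_ + _); rewrite addrC.
Qed.

End ComplexifiedQuaternions.

(** * The exponential stem as the solution of a linear equation along rays *)

Section ExponentialStemTheory.
Set Implicit Arguments.
Unset Strict Implicit.
Context {R : realType}.
Implicit Types (lam : quat R) (z : R * R) (t : R).

(** The factorisation [exp(a lam) (cos(b lam) + iota sin(b lam))] is convenient because each factor
    depends on one real variable; [exp_stem_rexp] identifies it with the series in [z lam]. *)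
Definition exp_stem lam z : quat R * quat R :=
  (qex lam z.1 * qco lam z.2, qex lam z.1 * qsi lam z.2).

Lemma qex_comm lam t : lam * qex lam t = qex lam t * lam.
Proof. exact: (rexp_comm _ _ _).1. Qed.
Lemma qco_comm lam t : lam * qco lam t = qco lam t * lam.
Proof. exact: (rexp_comm _ _ _).1. Qed.
Lemma qsi_comm lam t : lam * qsi lam t = qsi lam t * lam.
Proof. exact: (rexp_comm _ _ _).2. Qed.

Lemma exp_stem_comm lam z : lam * (exp_stem lam z).1 = (exp_stem lam z).1 * lam /\
  lam * (exp_stem lam z).2 = (exp_stem lam z).2 * lam.
Proof.
by split=> /=; rewrite mulrA qex_comm -!mulrA ?qco_comm ?qsi_comm.
Qed.

Lemma hasd_exp_stem lam z :
  hasd (exp_stem lam) z (hcr (exp_stem lam z) lam) (hci (hcr (exp_stem lam z) lam)).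
Proof.
have hx := hasd_fst (qex_derive lam z.1).
have hc := hasd_snd (qco_derive lam z.2).
have hs := hasd_snd (qsi_derive lam z.2).
apply/hasdP; split => /=.
  apply: (hasd_eq (hasd_mul hx hc)); first by rewrite mulr0 add0r -!mulrA qco_comm.
  by rewrite mul0r addr0 mulrN mulrA.
apply: (hasd_eq (hasd_mul hx hs)); first by rewrite mulr0 add0r -!mulrA qsi_comm.
by rewrite mul0r addr0 mulrA.
Qed.

Lemma exp_stem_conj lam (a b : R) : exp_stem lam (a, - b) = hc_conj (exp_stem lam (a, b)).
Proof.
have [e1 e2] := qco_even lam b.
by rewrite /exp_stem /hc_conj /= e1 !qsi_qsc e2 scaleNr mulrN.
Qed.

Lemma Est0 lam : exp_stem lam (0, 0) = (1, 0).
Proof.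
have [h1 _] := rexp_0 lam (1, 0); have [h2 h3] := rexp_0 lam (0, 1).
by rewrite /exp_stem /= /qex /qco /qsi h1 h2 h3 mulr0 mulr1.
Qed.

Lemma quat_derive0_cst (f : R -> quat R) (s t : R) :
  (forall r : R, is_derive r 1 f 0) -> f s = f t.
Proof.
move=> hf.
have c (q : {linear quat R -> R}) : continuous q -> q (f s) = q (f t).
  move=> cq; apply: (@is_derive_0_is_cst _ (q \o f)) => r.
  by have := is_derive_linear cq (hf r); rewrite linear0.
apply: quatP; [exact: (c q0 q0_continuous)|exact: (c q1 q1_continuous)|
  exact: (c q2 q2_continuous)|exact: (c q3 q3_continuous)].
Qed.

(* Along the ray [t z] the exponential stem of [- lam] is an integrating factor
   for [y' = z y lam]. *)
Lemma ray_ode lam z (y1 y2 : R -> quat R) :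
  (forall t, is_derive t 1 y1 ((z.1 *: y1 t - z.2 *: y2 t) * lam)) ->
  (forall t, is_derive t 1 y2 ((z.2 *: y1 t + z.1 *: y2 t) * lam)) ->
  forall t, hc_mul (y1 t, y2 t) (exp_stem (- lam) (t * z.1, t * z.2)) = (y1 0, y2 0).
Proof.
move=> h1 h2 t; case: z h1 h2 => a b /= h1 h2.
have lin (c s : R) : is_derive s 1 (fun r : R => r * c) c.
  have := is_deriveM (f := id) (g := cst c) (is_derive_id s 1) (is_derive_cst c s 1).
  by move=> /is_derive_eq; apply; rewrite scaler0 add0r /GRing.scale /= mulr1.
pose e (s : R) := exp_stem (- lam) (s * a, s * b).
have e1 (s : R) : is_derive s 1 (fun r => (e r).1) (- ((a *: (e s).1 - b *: (e s).2) * lam)).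
  have [E1 _] := (hasdP _ _ _ _).1 (hasd_exp_stem (- lam) (s * a, s * b)).
  apply: is_derive_eq; first exact: (hasd_curve (lin a s) (lin b s) E1).
  by rewrite /e /hcr /hci /= !mulrN opprK mulrBl opprB -!scalerAl scalerN addrC.
have e2 (s : R) : is_derive s 1 (fun r => (e r).2) (- ((b *: (e s).1 + a *: (e s).2) * lam)).
  have [_ E2] := (hasdP _ _ _ _).1 (hasd_exp_stem (- lam) (s * a, s * b)).
  apply: is_derive_eq; first exact: (hasd_curve (lin a s) (lin b s) E2).
  by rewrite /e /hcr /hci /= !mulrN !scalerN mulrDl opprD -!scalerAl addrC.
have comm (s : R) : (e s).1 * lam = lam * (e s).1 /\ (e s).2 * lam = lam * (e s).2.
  have [c1 c2] := exp_stem_comm (- lam) (s * a, s * b).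
  by split; apply: oppr_inj; rewrite -[LHS]mulrN -[RHS]mulNr.
have p1 (s : R) : is_derive s 1 (fun r => y1 r * (e r).1 - y2 r * (e r).2) 0.
  have := is_deriveB (is_derive_qmul (h1 s) (e1 s)) (is_derive_qmul (h2 s) (e2 s)).
  move=> /is_derive_eq; apply.
  rewrite !(mulrN, mulrBl, mulrDl, mulrBr, mulrDr) -!scalerAl -!scalerAr.
  have [-> ->] := comm s; rewrite -!mulrA.
  (* The noncommutative products become atoms; what remains is linear over the reals and is checked
     coordinate by coordinate. The later algebraic lemmas use the same device. *)
  move: (y1 s * _) (y1 s * _) (y2 s * _) (y2 s * _) => A B C D.
  by apply: quatP; rewrite !(qD, qN, qZ) ?linear0; ring.
have p2 (s : R) : is_derive s 1 (fun r => y1 r * (e r).2 + y2 r * (e r).1) 0.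
  have := is_deriveD (is_derive_qmul (h1 s) (e2 s)) (is_derive_qmul (h2 s) (e1 s)).
  move=> /is_derive_eq; apply.
  rewrite !(mulrN, mulrBl, mulrDl, mulrBr, mulrDr) -!scalerAl -!scalerAr.
  have [-> ->] := comm s; rewrite -!mulrA.
  move: (y1 s * _) (y1 s * _) (y2 s * _) (y2 s * _) => A B C D.
  by apply: quatP; rewrite !(qD, qN, qZ) ?linear0; ring.
have e0 : e 0 = (1, 0) by rewrite /e !mul0r Est0.
rewrite /hc_mul /= -/(e t); congr (_, _).
  rewrite (quat_derive0_cst t 0 p1) e0 /= mulr0 mulr1 subr0 //.
by rewrite (quat_derive0_cst t 0 p2) e0 /= mulr0 mulr1 add0r.
Qed.

(** [exp(t z lam)] solves the equation of [ray_ode] with initial value 1; evaluate at [t = 1]. *)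
Lemma exp_stem_inv lam z : hc_mul (exp_stem lam z) (exp_stem (- lam) z) = (1, 0).
Proof.
case: z => a b.
have lin (c s : R) : is_derive s 1 (fun r : R => r * c) c.
  have := is_deriveM (f := id) (g := cst c) (is_derive_id s 1) (is_derive_cst c s 1).
  by move=> /is_derive_eq; apply; rewrite scaler0 add0r /GRing.scale /= mulr1.
pose e (s : R) := exp_stem lam (s * a, s * b).
have e1 (s : R) : is_derive s 1 (fun r => (e r).1) ((a *: (e s).1 - b *: (e s).2) * lam).
  have [E1 _] := (hasdP _ _ _ _).1 (hasd_exp_stem lam (s * a, s * b)).
  apply: is_derive_eq; first exact: (hasd_curve (lin a s) (lin b s) E1).
  by rewrite /e /hcr /hci /= mulrBl -!scalerAl scalerN.
have e2 (s : R) : is_derive s 1 (fun r => (e r).2) ((b *: (e s).1 + a *: (e s).2) * lam).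
  have [_ E2] := (hasdP _ _ _ _).1 (hasd_exp_stem lam (s * a, s * b)).
  apply: is_derive_eq; first exact: (hasd_curve (lin a s) (lin b s) E2).
  by rewrite /e /hcr /hci /= mulrDl -!scalerAl addrC.
have := @ray_ode lam (a, b) (fun s => (e s).1) (fun s => (e s).2) e1 e2 1.
have e0 : e 0 = (1, 0) by rewrite /e !mul0r Est0.
have e1' : e 1 = exp_stem lam (a, b) by rewrite /e !mul1r.
by rewrite e0 e1' !mul1r -surjective_pairing.
Qed.

Lemma exp_stem_invN lam z : hc_mul (exp_stem (- lam) z) (exp_stem lam z) = (1, 0).
Proof. by have := exp_stem_inv (- lam) z; rewrite opprK. Qed.

(** The series solves the equation of [ray_ode] too, so it is a left inverse of
    [exp_stem (- lam) z], whose inverse is [exp_stem lam z]. No series have to be multiplied. *)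
Lemma exp_stem_rexp lam z : exp_stem lam z = (rexp1 lam z 1, rexp2 lam z 1).
Proof.
have := ray_ode (rexp1_derive lam z) (rexp2_derive lam z) 1.
have [-> ->] := rexp_0 lam z; rewrite !mul1r -surjective_pairing.
move=> /(congr1 (fun u => hc_mul u (exp_stem lam z))).
by rewrite -hc_mulA exp_stem_invN hc_mulr1 hc_mul1r => ->.
Qed.

Lemma exp_stem_series lam z :
  series (cexp1 lam z) @ \oo --> (exp_stem lam z).1 /\
  series (cexp2 lam z) @ \oo --> (exp_stem lam z).2.
Proof.
have [h1 h2] := qent_cexp lam z; rewrite exp_stem_rexp /=.
have e (c : nat -> quat R) : (fun n => 1 ^+ n *: c n) = c.
  by apply/funext => n; rewrite expr1n scale1r.
by split; [have := qps_cvg (t := 1) h1|have := qps_cvg (t := 1) h2]; rewrite e.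
Qed.

End ExponentialStemTheory.

(** * Derivatives of slice functions *)

Section SliceGeometry.
Set Implicit Arguments.
Unset Strict Implicit.
Context {R : realType}.
Implicit Types (x v e J : quat R) (D : set (R * R)).

Definition ipq x v : R := q1 x * q1 v + q2 x * q2 v + q3 x * q3 v.
Definition qvec x : quat R := x - (q0 x)%:A.

Lemma qvecE x : qvec x = mkq 0 (q1 x) (q2 x) (q3 x).
Proof. by apply: quatP; rewrite !(qD, qN, qZ, mkqE); ring. Qed.

Lemma qimdirE x : qimdir x = (qimnorm x)^-1 *: qvec x.
Proof. by rewrite qvecE. Qed.

Lemma qimnorm_ge0 x : 0 <= qimnorm x. Proof. exact: sqrtr_ge0. Qed.

Lemma qimnorm_sqr x : qimnorm x ^+ 2 = ipq x x.
Proof.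
rewrite sqr_sqrtr; first by rewrite /ipq !expr2.
by rewrite !addr_ge0 // sqr_ge0.
Qed.

Lemma imag_unitsE J : q0 J = 0 -> ipq J J = 1 -> imag_units J.
Proof.
rewrite /ipq /imag_units /= => J0 J1.
by apply: quatP; rewrite !(mkqE, qN) J0; [rewrite -J1|..]; ring.
Qed.

Lemma qi_unit : imag_units (qi : quat R).
Proof. by apply: imag_unitsE; rewrite /ipq !mkqE //; ring. Qed.
Lemma qj_unit : imag_units (qj : quat R).
Proof. by apply: imag_unitsE; rewrite /ipq !mkqE //; ring. Qed.
Lemma qk_unit : imag_units (qk : quat R).
Proof. by apply: imag_unitsE; rewrite /ipq !mkqE //; ring. Qed.

Lemma qimdir_unit x : qimnorm x != 0 -> imag_units (qimdir x).
Proof.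
move=> r0; apply: imag_unitsE; rewrite qimdirE qvecE /ipq !(qZ, mkqE) ?mulr0 //.
transitivity ((qimnorm x)^-1 ^+ 2 * qimnorm x ^+ 2).
  by rewrite qimnorm_sqr /ipq; ring.
by rewrite -exprMn mulVf // expr1n.
Qed.

Lemma quat_polar x : exists2 J, imag_units J & x = (q0 x)%:A + qimnorm x *: J.
Proof.
have [r0|r0] := eqVneq (qimnorm x) 0; last first.
  exists (qimdir x); first exact: qimdir_unit.
  by rewrite qimdirE scalerA divff // scale1r /qvec addrC subrK.
(* At a real point [qimdir x] is 0 and not a unit, so an arbitrary unit is taken. *)
exists qi; first exact: qi_unit.
rewrite r0 scale0r addr0; apply/eqP; rewrite -subr_eq0 -/(qvec x); apply/eqP.
have := qimnorm_sqr x; rewrite r0 expr0n /= /ipq => h.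
have h1 := sqr_ge0 (q1 x); have h2 := sqr_ge0 (q2 x); have h3 := sqr_ge0 (q3 x).
have z1 : q1 x = 0 by apply/eqP; rewrite -sqrf_eq0; apply/eqP; rewrite !expr2 in h1 h2 h3 *; lra.
have z2 : q2 x = 0 by apply/eqP; rewrite -sqrf_eq0; apply/eqP; rewrite !expr2 in h1 h2 h3 *; lra.
have z3 : q3 x = 0 by apply/eqP; rewrite -sqrf_eq0; apply/eqP; rewrite !expr2 in h1 h2 h3 *; lra.
by rewrite qvecE z1 z2 z3; apply: quatP; rewrite mkqE linear0.
Qed.

Lemma q0_polar (a b : R) J : imag_units J -> q0 (a%:A + b *: J) = a.
Proof. by move=> /imag_unitsP[J0 _]; rewrite qD !qZ J0 mkqE mulr1 mulr0 addr0. Qed.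

Lemma ipqZ (a b : R) J : ipq (a%:A + b *: J) (a%:A + b *: J) = b ^+ 2 * ipq J J.
Proof. by rewrite /ipq !(qD, qZ, mkqE); ring. Qed.

Lemma ipq_unit J : imag_units J -> ipq J J = 1.
Proof. by move=> /imag_unitsP[_ <-]; rewrite /ipq !expr2. Qed.

Lemma qimnorm_polar (a b : R) J : imag_units J -> qimnorm (a%:A + b *: J) = `|b|.
Proof.
move=> uJ; rewrite -[LHS]ger0_norm ?qimnorm_ge0 // -sqrtr_sqr qimnorm_sqr.
by rewrite ipqZ ipq_unit // mulr1 sqrtr_sqr.
Qed.

(** Conjugation invariance allows the representative with [b >= 0] to be chosen always. *)
Lemma circularizationP D x : conj_invariant D ->
  circularization D x <-> D (q0 x, qimnorm x).
Proof.
move=> cD; split=> [[a [b [J [Dab uJ ->]]]]|Dx].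
  rewrite q0_polar // qimnorm_polar //; case: (ger0P b) => // _; exact: cD.
by have [J uJ xE] := quat_polar x; exists (q0 x), (qimnorm x), J.
Qed.

Lemma qimnorm_sqrt : @qimnorm R = @Num.sqrt R \o (fun y => ipq y y).
Proof. by apply/funext => y; rewrite /= /qimnorm /ipq !expr2. Qed.

Lemma qimnorm_continuous : continuous (@qimnorm R).
Proof.
move=> x; rewrite qimnorm_sqrt.
apply: (@continuous_comp _ _ _ (fun y : quat R => ipq y y)); last exact: sqrt_continuous.
have c1 := @q1_continuous R x; have c2 := @q2_continuous R x; have c3 := @q3_continuous R x.
rewrite /ipq.
have M (q : quat R -> R) : q @ x --> q x -> (fun y => q y * q y) @ x --> q x * q x.
  by move=> h; exact: (cvgM h h).
exact: (cvgD (cvgD (M _ c1) (M _ c2)) (M _ c3)).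
Qed.

Lemma near_polar (P : R * R -> Prop) x :
  (\forall w \near (q0 x, qimnorm x), P w) -> \forall y \near x, P (q0 y, qimnorm y).
Proof.
move=> hP.
have c : (fun y : quat R => (q0 y, qimnorm y)) @ x --> (q0 x, qimnorm x).
  exact: (cvg_pair (@q0_continuous R x) (@qimnorm_continuous x)).
exact: c _ hP.
Qed.

Lemma near_nonreal x : qimnorm x != 0 -> \forall y \near x, qimnorm y != 0.
Proof.
move=> r0; have h : \forall r \near qimnorm x, r != 0.
  by apply: open_nbhs_nbhs; split => //; exact: open_neq.
exact: (@qimnorm_continuous x _ h).
Qed.

Lemma is_derive_q (q : {linear quat R -> R}) x v :
  continuous q -> is_derive x v q (q v).
Proof. by move=> cq; exact: (is_derive_linear cq (is_derive_id x v)). Qed.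

Lemma is_derive_qvec x v : is_derive x v qvec (qvec v).
Proof.
apply: is_deriveB.
have := is_derive_scale (is_derive_q x v q0_continuous) (is_derive_cst (1 : quat R) x v).
by move=> /is_derive_eq; apply; rewrite scaler0 add0r.
Qed.

Lemma is_derive_ipq x v e : is_derive x v (fun y => ipq y e) (ipq v e).
Proof.
have h (q : {linear quat R -> R}) (c : R) : continuous q -> is_derive x v (fun y => q y * c) (q v * c).
  move=> cq; have := is_deriveM (f := q) (g := cst c) (is_derive_q x v cq) (is_derive_cst c x v).
  by move=> /is_derive_eq; apply; rewrite scaler0 add0r /GRing.scale /= mulrC.
by apply: is_deriveD; [apply: is_deriveD|]; apply: h; [exact: q1_continuous|
  exact: q2_continuous|exact: q3_continuous].
Qed.

Lemma is_derive_qimnorm x v : qimnorm x != 0 ->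
  is_derive x v (@qimnorm R) (ipq x v / qimnorm x).
Proof.
move=> r0.
have hs : is_derive x v (fun y => ipq y y) (2 * ipq x v).
  have h (q : {linear quat R -> R}) : continuous q -> is_derive x v (fun y => q y * q y) (2 * (q x * q v)).
    move=> cq; have := is_deriveM (is_derive_q x v cq) (is_derive_q x v cq).
    by move=> /is_derive_eq; apply; rewrite /GRing.scale /=; ring.
  apply: is_derive_eq.
    by apply: is_deriveD; [apply: is_deriveD|]; apply: h; [exact: q1_continuous|
      exact: q2_continuous|exact: q3_continuous].
  by rewrite /ipq; ring.
have p0 : 0 < ipq x x by rewrite -qimnorm_sqr exprn_gt0 // lt_def r0 qimnorm_ge0.
rewrite [X in is_derive _ _ X _]qimnorm_sqrt.
have := is_derive_diff_comp hs ((is_derive_is_diff _ _ _).1 (is_derive1_sqrt p0)).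
move=> /is_derive_eq; apply; rewrite -qimnorm_sqr sqrtr_sqr ger0_norm ?qimnorm_ge0 //.
by rewrite /GRing.scale /=; field.
Qed.

End SliceGeometry.

(** * First and second derivatives off the real axis *)

Section SliceDerivatives.
Set Implicit Arguments.
Unset Strict Implicit.
Context {R : realType}.
Implicit Types (x v e J : quat R) (D : set (R * R)) (F H K : R * R -> quat R * quat R).

Lemma is_derive_qimnormV x v : qimnorm x != 0 ->
  is_derive x v (fun y => (qimnorm y)^-1)
    (- ((qimnorm x)^-1 ^+ 2 * (ipq x v / qimnorm x))).
Proof.
move=> r0; have [d1 d2] := is_derive_qimnorm v r0.
split; first exact: derivableV.
by rewrite deriveV // d2 /GRing.scale /= exprVn mulNr.
Qed.

Lemma is_derive_qimdir x v : qimnorm x != 0 ->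
  is_derive x v (@qimdir R)
    ((qimnorm x)^-1 *: qvec v - (ipq x v / qimnorm x * (qimnorm x)^-1) *: qimdir x).
Proof.
move=> r0; have -> : @qimdir R = fun y => (qimnorm y)^-1 *: qvec y.
  by apply/funext => y; exact: qimdirE.
have := is_derive_scale (is_derive_qimnormV v r0) (is_derive_qvec x v).
move=> /is_derive_eq; apply; rewrite scaleNr scalerA; congr (_ - _ *: _).
by rewrite expr2; ring.
Qed.

Lemma is_derive_polar (W : normedModType R) (G : R * R -> W) x v X Y :
  qimnorm x != 0 -> hasd G (q0 x, qimnorm x) X Y ->
  is_derive x v (fun y => G (q0 y, qimnorm y))
    (q0 v *: X + (ipq x v / qimnorm x) *: Y).
Proof.
move=> r0; apply: hasd_curve; first exact: (is_derive_q x v q0_continuous).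
exact: is_derive_qimnorm.
Qed.

Lemma is_derive_slice F x v X Y : qimnorm x != 0 ->
  hasd F (q0 x, qimnorm x) X Y ->
  let b := ipq x v / qimnorm x in
  is_derive x v (slice F)
    (q0 v *: X.1 + b *: Y.1 + (qimdir x * (q0 v *: X.2 + b *: Y.2) +
     ((qimnorm x)^-1 *: qvec v - (b * (qimnorm x)^-1) *: qimdir x) *
       (F (q0 x, qimnorm x)).2)).
Proof.
move=> r0 /hasdP[h1 h2] b.
apply: is_deriveD; first exact: (is_derive_polar v r0 h1).
exact: (is_derive_qmul (is_derive_qimdir v r0) (is_derive_polar v r0 h2)).
Qed.

Lemma ipq1 x : ipq x 1 = 0.
Proof. by rewrite /ipq !mkqE !mulr0 !addr0. Qed.

Lemma qvec1 : qvec (1 : quat R) = 0.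
Proof. by rewrite qvecE; apply: quatP; rewrite !mkqE linear0. Qed.

Lemma derive1_slice F x X Y : qimnorm x != 0 ->
  hasd F (q0 x, qimnorm x) X Y ->
  is_derive x 1 (slice F) (X.1 + qimdir x * X.2).
Proof.
move=> r0 /(is_derive_slice 1 r0) /is_derive_eq; apply.
by rewrite ipq1 mul0r qvec1 !mkqE scaler0 !mul0r !scale0r subr0 mul0r !addr0 !scale1r.
Qed.

Lemma derive_imag_slice F x e X Y : qimnorm x != 0 -> imag_units e ->
  hasd F (q0 x, qimnorm x) X Y ->
  let b := ipq x e / qimnorm x in
  is_derive x e (slice F)
    (b *: Y.1 + (qimdir x * (b *: Y.2) +
     ((qimnorm x)^-1 *: e - (b * (qimnorm x)^-1) *: qimdir x) *
       (F (q0 x, qimnorm x)).2)).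
Proof.
move=> r0 /imag_unitsP[e0 _] /(is_derive_slice e r0) /is_derive_eq; apply.
by rewrite e0 !scale0r !add0r /qvec e0 scale0r subr0.
Qed.

Lemma qimdir_basis x : qimdir x =
  (ipq x qi / qimnorm x) *: qi + (ipq x qj / qimnorm x) *: qj +
  (ipq x qk / qimnorm x) *: qk.
Proof.
by rewrite qimdirE qvecE; apply: quatP; rewrite /ipq !(qD, qZ, mkqE); ring.
Qed.

(** The contribution of one unit [e] to the Cauchy-Riemann-Fueter sum, from [e * e = -1]. Summed
    over [i, j, k], the parts along [b *: e] reassemble into [qimdir x], while the remaining part is
    the same for all three. *)
Lemma imag_sum (e u Y1 Y2 F2 : quat R) (b w : R) : imag_units e ->
  e * (b *: Y1 + (u * (b *: Y2) + (w *: e - (b * w) *: u) * F2)) =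
  (b *: e) * (Y1 + u * Y2 - w *: (u * F2)) - w *: F2.
Proof.
rewrite /imag_units /= => ee.
have ee' y : e * (e * y) = - y by rewrite mulrA ee mulN1r.
rewrite !(mulrDr, mulrBr, mulrDl, mulrBl, mulrN, mulNr) !(=^~ scalerAl, =^~ scalerAr) ee'.
move: (e * Y1) (e * (u * Y2)) (e * (u * F2)) => A B C.
by apply: quatP; rewrite !(qD, qN, qZ); ring.
Qed.

Lemma crf_slice F x X Y : qimnorm x != 0 ->
  hasd F (q0 x, qimnorm x) X Y ->
  crf (slice F) x = 2^-1 *: (X.1 - Y.2 - (2 / qimnorm x) *: (F (q0 x, qimnorm x)).2 +
    qimdir x * (X.2 + Y.1)).
Proof.
move=> r0 hF; rewrite /crf; congr (_ *: _).
have [_ ->] := derive1_slice r0 hF.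
have [_ ->] := derive_imag_slice r0 qi_unit hF.
have [_ ->] := derive_imag_slice r0 qj_unit hF.
have [_ ->] := derive_imag_slice r0 qk_unit hF.
rewrite (imag_sum _ _ _ _ _ _ qi_unit) (imag_sum _ _ _ _ _ _ qj_unit).
rewrite (imag_sum _ _ _ _ _ _ qk_unit).
have uu : qimdir x * qimdir x = -1 by exact: qimdir_unit.
have uu' y : qimdir x * (qimdir x * y) = - y by rewrite mulrA uu mulN1r.
set u := qimdir x in uu uu' *; set F2 := (F _).2; set w := (qimnorm x)^-1.
set Z := Y.1 + _ - _.
have bs : u * Z = u * Y.1 - Y.2 + w *: F2.
  by rewrite mulrBr mulrDr uu' -scalerAr uu' scalerN opprK.
(* The three units give [- 3 w F2]; the radial term [u * (- w u F2) = w F2] reduces the coefficient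
   to the 2 of the statement. *)
transitivity (X.1 + u * X.2 + u * Z - 3 *: (w *: F2)).
  have hu : u = _ := qimdir_basis x.
  rewrite [X in _ = _ + X * Z - _]hu !mulrDl.
  move: (_ * Z) (_ * Z) (_ * Z) (u * X.2) => A B C E.
  by apply: quatP; rewrite !(qD, qN, qZ); ring.
rewrite bs mulrDr; move: (u * _) (u * _) => A B.
by apply: quatP; rewrite !(qD, qN, qZ); rewrite /w; ring.
Qed.

(** The two operators add up to [d/dx0]: their imaginary terms cancel. *)
Lemma crf_conjE f x : crf_conj f x = 'D_1 f x - crf f x.
Proof.
rewrite /crf_conj /crf.
move: ('D_1 f x) (qi * _) (qj * _) (qk * _) => A B C E.
by apply: quatP; rewrite !(qD, qN, qZ); field.
Qed.

Lemma derive_near (f g : quat R -> quat R) x v :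
  (\forall y \near x, f y = g y) -> 'D_v f x = 'D_v g x.
Proof. exact: near_eq_derive. Qed.

Lemma crf_near (f g : quat R -> quat R) x :
  (\forall y \near x, f y = g y) -> crf f x = crf g x.
Proof. by move=> fg; rewrite /crf !(derive_near _ fg). Qed.

(** For the second derivatives the first ones must agree all around [x], hence the iterated
    neighbourhood. *)
Lemma laplacian_near (f g : quat R -> quat R) x :
  (\forall y \near x, f y = g y) -> laplacian f x = laplacian g x.
Proof.
move=> /near_join fg.
have h v : 'D_v ('D_v f) x = 'D_v ('D_v g) x.
  by apply: derive_near; apply: filterS fg => y; exact: derive_near.
pose a (p q : quat R) := p + q.
exact: (f_equal2 a (f_equal2 a (f_equal2 a (h 1) (h qi)) (h qj)) (h qk)).
Qed.

Lemma derive2_1_slice H K x L M :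
  qimnorm x != 0 -> (\forall w \near (q0 x, qimnorm x), hasd H w (K w) (hci (K w))) ->
  hasd K (q0 x, qimnorm x) L M ->
  'D_1 ('D_1 (slice H)) x = L.1 + qimdir x * L.2.
Proof.
move=> r0 hH hK.
have [_ <-] := derive1_slice r0 hK; apply: derive_near.
have := near_nonreal r0; apply: filterS2 (near_polar hH) => y hy ry.
by have [_ ->] := derive1_slice ry hy.
Qed.

Let derive2_imag_algebra (b w : R) (u e K1 K2 H2 L1 L2 : quat R) :
  b *: (- (b *: L1)) + (w - b ^+ 2 * w) *: (- K2) +
  (u * (b *: (- (b *: L2)) + (w - b ^+ 2 * w) *: K1) +
   (w *: e - (b * w) *: u) * (b *: K1) +
   ((w *: e - (b * w) *: u) * (b *: K1) +
    (w *: 0 + (- (w ^+ 2 * b)) *: e -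
      ((b * w) *: (w *: e - (b * w) *: u) +
       (b *: (- (w ^+ 2 * b)) + w *: (w - b ^+ 2 * w)) *: u)) * H2)) =
  (w *: (u * K1) - w *: K2 - w ^+ 2 *: (u * H2)) +
    b ^+ 2 *: (w *: K2 - L1 - 3 *: (w *: (u * K1)) - u * L2 +
               3 *: (w ^+ 2 *: (u * H2))) +
    (b *: e) * (2 *: (w *: K1) - 2 *: (w ^+ 2 *: H2)).
Proof.
rewrite scaler0 add0r !(mulrDr u, mulrDr e, mulrN e, mulrDl _ _ H2, mulrDl _ _ (b *: K1), mulrN u,
  mulNr _ H2, mulNr _ (b *: K1), qscalel, qscaler).
move: (u * K1) (u * H2) (u * L2) (e * K1) (e * H2) => A B C E M.
by apply: quatP; rewrite !(qD, qN, qZ) ?linear0 /GRing.scale /=; ring.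
Qed.

(* Summed over [e = i, j, k], where the [b]'s are the coordinates of [qimdir x]. *)
Lemma derive2_imag_slice H K x e L :
  qimnorm x != 0 -> (\forall w \near (q0 x, qimnorm x), hasd H w (K w) (hci (K w))) ->
  hasd K (q0 x, qimnorm x) L (hci L) -> imag_units e ->
  let b := ipq x e / qimnorm x in let w := (qimnorm x)^-1 in
  let u := qimdir x in let z := (q0 x, qimnorm x) in
  'D_e ('D_e (slice H)) x =
    (w *: (u * (K z).1) - w *: (K z).2 - w ^+ 2 *: (u * (H z).2)) +
    b ^+ 2 *: (w *: (K z).2 - L.1 - 3 *: (w *: (u * (K z).1)) - u * L.2 +
               3 *: (w ^+ 2 *: (u * (H z).2))) +
    (b *: e) * (2 *: (w *: (K z).1) - 2 *: (w ^+ 2 *: (H z).2)).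
Proof.
move=> r0 hH hK ue b w u z.
pose bf y := ipq y e / qimnorm y; pose wf (y : quat R) := (qimnorm y)^-1.
pose pf (y : quat R) := (q0 y, qimnorm y).
(* [G] is the first derivative in direction [e] at points near [x], with the Cauchy-Riemann value
   [(- K2, K1)] for the [b]-derivative of [H]. *)
pose G y := bf y *: (- (K (pf y)).2) + (qimdir y * (bf y *: (K (pf y)).1) +
  (wf y *: e - (bf y * wf y) *: qimdir y) * (H (pf y)).2).
have -> : 'D_e ('D_e (slice H)) x = 'D_e G x.
  apply: derive_near.
  have := near_nonreal r0; apply: filterS2 (near_polar hH) => y hy ry.
  by have [_ ->] := derive_imag_slice ry ue hy.
have [e0 _] := imag_unitsP ue.
have ve : qvec e = e by rewrite /qvec e0 scale0r subr0.
have dw : is_derive x e wf (- (w ^+ 2 * b)) by exact: is_derive_qimnormV.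
(* The derivative of [<x, e> / r] in direction [e] is [(1 - b^2) / r], as [e] has length one. *)
have db : is_derive x e bf (w - b ^+ 2 * w).
  have alg (p q c : R) : p * q = c -> p * (- (q ^+ 2 * c)) + q * 1 = q - c ^+ 2 * q.
    by move=> <-; ring.
  have := is_deriveM (is_derive_ipq x e e) dw; move=> /is_derive_eq; apply.
  by rewrite ipq_unit //; exact: alg.
have du : is_derive x e (@qimdir R) (w *: e - (b * w) *: u).
  by have := is_derive_qimdir e r0; rewrite ve.
have [hK1 hK2] := (hasdP _ _ _ _).1 hK.
have [_ hH2] := (hasdP _ _ _ _).1 (nbhs_singleton hH).
have dK1 : is_derive x e (fun y => (K (pf y)).1) (- (b *: L.2)).
  have := is_derive_polar e r0 hK1; move=> /is_derive_eq; apply.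
  by rewrite e0 scale0r add0r /= scalerN.
have dK2 : is_derive x e (fun y => (K (pf y)).2) (b *: L.1).
  have := is_derive_polar e r0 hK2; move=> /is_derive_eq; apply.
  by rewrite e0 scale0r add0r.
have dH2 : is_derive x e (fun y => (H (pf y)).2) (b *: (K z).1).
  have := is_derive_polar e r0 hH2; move=> /is_derive_eq; apply.
  by rewrite e0 scale0r add0r.
have d1 := is_derive_scale db (is_deriveN dK2).
have d2 := is_derive_qmul du (is_derive_scale db dK1).
have d3 := is_derive_qmul (is_deriveB (is_derive_scale dw (is_derive_cst e x e))
  (is_derive_scale (is_deriveM db dw) du)) dH2.
have [_ dG] := is_deriveD d1 (is_deriveD d2 d3).
rewrite [LHS]dG; exact: derive2_imag_algebra.
Qed.

Lemma sum_bb x : qimnorm x != 0 ->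
  (ipq x qi / qimnorm x) ^+ 2 + (ipq x qj / qimnorm x) ^+ 2 +
  (ipq x qk / qimnorm x) ^+ 2 = 1.
Proof.
move=> r0; have := qimnorm_sqr x; rewrite /ipq !mkqE => h.
rewrite !exprMn -!mulrDl exprVn; apply: canLR (mulfK _) _; first by rewrite expf_neq0.
by rewrite mul1r h; ring.
Qed.

Let laplacian_algebra1 (b1 b2 b3 : R) (X P Q A B C : quat R) :
  b1 ^+ 2 + b2 ^+ 2 + b3 ^+ 2 = 1 ->
  X + (P + b1 ^+ 2 *: Q + A) + (P + b2 ^+ 2 *: Q + B) + (P + b3 ^+ 2 *: Q + C) =
  X + 3 *: P + Q + (A + B + C).
Proof.
move=> hb.
transitivity (X + 3 *: P + (b1 ^+ 2 + b2 ^+ 2 + b3 ^+ 2) *: Q + (A + B + C)).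
  by apply: quatP; rewrite !(qD, qN, qZ); ring.
by rewrite hb scale1r.
Qed.

Let laplacian_algebra2 (w : R) (u K1 K2 H2 L1 L2 : quat R) :
  L1 + u * L2 + 3 *: (w *: (u * K1) - w *: K2 - w ^+ 2 *: (u * H2)) +
  (w *: K2 - L1 - 3 *: (w *: (u * K1)) - u * L2 + 3 *: (w ^+ 2 *: (u * H2))) +
  u * (2 *: (w *: K1) - 2 *: (w ^+ 2 *: H2)) =
  - ((2 * w) *: K2) + u * ((2 * w) *: K1 - (2 * w ^+ 2) *: H2).
Proof.
rewrite !(mulrBr u, qscaler).
move: (u * K1) (u * H2) (u * L2) => A B C.
by apply: quatP; rewrite !(qD, qN, qZ); ring.
Qed.

(** The second derivatives of [H] drop out: [L] from the real direction cancels [- L] from the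
    radial one. What is left is the first-order term [2 / r] of the Laplacian in three dimensions
    and the term [- 2 / r^2] from the Laplacian of the unit field [qimdir]. *)
Lemma laplacian_slice H K x L :
  qimnorm x != 0 -> (\forall w \near (q0 x, qimnorm x), hasd H w (K w) (hci (K w))) ->
  hasd K (q0 x, qimnorm x) L (hci L) ->
  let w := (qimnorm x)^-1 in let z := (q0 x, qimnorm x) in
  laplacian (slice H) x =
    - ((2 * w) *: (K z).2) +
    qimdir x * ((2 * w) *: (K z).1 - (2 * w ^+ 2) *: (H z).2).
Proof.
move=> r0 hH hK w z; rewrite /laplacian.
have E1 := derive2_1_slice r0 hH hK.
have Ei := derive2_imag_slice r0 hH hK qi_unit.
have Ej := derive2_imag_slice r0 hH hK qj_unit.
have Ek := derive2_imag_slice r0 hH hK qk_unit.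
pose a (p q : quat R) := p + q.
rewrite [LHS](f_equal2 a (f_equal2 a (f_equal2 a E1 Ei) Ej) Ek) /a.
rewrite -/z -/w.
set S := 2 *: _ - _; set Q := w *: (K z).2 - _ - _ - _ + _; set P := _ - _ - w ^+ 2 *: _.
have hb := sum_bb r0; have hu := qimdir_basis x.
set b1 := ipq x qi / _ in hb hu *; set b2 := ipq x qj / _ in hb hu *.
set b3 := ipq x qk / _ in hb hu *; set u := qimdir x in hu *.
transitivity (L.1 + u * L.2 + 3 *: P + Q + u * S).
  by rewrite [X in _ = _ + X * S]hu !mulrDl; exact: laplacian_algebra1.
exact: laplacian_algebra2.
Qed.

End SliceDerivatives.

(** * Slice functions at real points, where [1 / b] is singular *)

Section RealPoints.
Set Implicit Arguments.
Unset Strict Implicit.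
Context {R : realType}.
Implicit Types (x v e J : quat R) (D : set (R * R)) (F H K : R * R -> quat R * quat R).

Lemma polar_real (a : R) : q0 (a%:A : quat R) = a /\ qimnorm (a%:A : quat R) = 0.
Proof.
have -> : a%:A = a%:A + 0 *: qi :> quat R by rewrite scale0r addr0.
by rewrite q0_polar ?qimnorm_polar ?normr0 //; exact: qi_unit.
Qed.

Lemma slice_real F (a : R) : slice F a%:A = (F (a, 0)).1.
Proof.
have [h1 h2] := polar_real a.
(* [qimdir] vanishes here through the convention that the inverse of 0 is 0. *)
by rewrite /slice /qimdir h1 h2 invr0 scale0r mul0r addr0.
Qed.

Lemma real_of_qimnorm0 x : qimnorm x = 0 -> x = (q0 x)%:A.
Proof. by have [J _ xE] := quat_polar x => r0; rewrite {1}xE r0 scale0r addr0. Qed.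

Let is_derive_shiftl (t a : R) : is_derive t 1 (fun s : R => s + a) 1.
Proof.
have := is_deriveD (f := id) (g := cst a) (is_derive_id t 1) (is_derive_cst a t 1).
by move=> /is_derive_eq; apply; rewrite addr0.
Qed.

Lemma derive1_slice_real F (a : R) X Y : hasd F (a, 0) X Y ->
  is_derive (a%:A : quat R) 1 (slice F) X.1.
Proof.
move=> /hasdP[h1 _]; apply/is_derive_line.
have -> : (fun t : R => slice F (t%:A + a%:A)) = fun t => (F (t + a, 0)).1.
  by apply/funext => t; rewrite -scalerDl slice_real.
have h1' : hasd (fun w => (F w).1) (0 + a, 0) X.1 Y.1 by rewrite add0r.
have := hasd_curve (is_derive_shiftl 0 a) (is_derive_cst (0 : R) (0 : R) (1 : R)) h1'.
by move=> /is_derive_eq; apply; rewrite scale1r scale0r addr0.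
Qed.

(** On the line [a + s J] the sign of [s] is free, so [sliceE] describes the function without [|s|],
    which is not differentiable at 0. *)
Lemma derive_imag_slice_line D F (a t : R) J X Y : open D -> stem_function D F ->
  D (a, t) -> imag_units J -> hasd F (a, t) X Y ->
  is_derive (t *: J + a%:A) J (slice F) (Y.1 + J * Y.2).
Proof.
move=> oD sF Dat uJ /hasdP[h1 h2]; apply/is_derive_line.
have cv : (fun s : R => (a, s + t)) @ (0 : R) --> (a, t).
  have e : t = 0 + t by rewrite add0r.
  rewrite [X in _ --> (a, X)]e.
  have [d _] := is_derive_shiftl 0 t.
  have ch := differentiable_continuous ((derivable1_diffP _ _).1 d).
  exact: (cvg_pair (cvg_cst a) ch).
have nD : \forall s \near (0 : R), D (a, s + t).
  by apply: cv; exact: open_nbhs_nbhs.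
apply: (near_eq_is_derive (f := fun s : R => (F (a, s + t)).1 + J * (F (a, s + t)).2)).
  apply: filterS nD => s Ds.
  by rewrite addrA -scalerDl addrC (sliceE sF Ds uJ).
have c (G : R * R -> quat R) Z W : hasd G (a, t) Z W ->
    is_derive (0 : R) 1 (fun s : R => G (a, s + t)) W.
  move=> hG; have hG' : hasd G (a, 0 + t) Z W by rewrite add0r.
  have := hasd_curve (is_derive_cst a (0 : R) (1 : R)) (is_derive_shiftl 0 t) hG'.
  by move=> /is_derive_eq; apply; rewrite scale1r scale0r add0r.
apply: is_deriveD; first exact: (c _ _ _ h1).
have := is_derive_qmul (is_derive_cst J (0 : R) (1 : R)) (c _ _ _ h2).
by move=> /is_derive_eq; apply; rewrite mul0r addr0.
Qed.

Lemma hasd_stem_conj D F (a b : R) X Y : open D -> conj_invariant D ->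
  stem_function D F -> D (a, b) -> hasd F (a, b) X Y ->
  hasd F (a, - b) (hc_conj X) (- hc_conj Y).
Proof.
move=> oD cD sF Dab hF.
have nD : \forall w \near (a, - b), D w by apply: open_nbhs_nbhs; split => //; exact: cD.
apply: (hasd_near (F := fun w => hc_conj (F (w.1, - w.2)))).
  apply: filterS nD => -[c d] Dcd /=.
  by rewrite (sF _ _ Dcd) /hc_conj /= opprK -surjective_pairing.
have /hasdP[h1 h2] := hasd_conj hF.
by apply/hasdP; split => //=; rewrite -[X in hasd _ _ _ X]/(- - Y.2); exact: (hasdN h2).
Qed.

Lemma quat_double0 (x : quat R) : x = - x -> x = 0.
Proof.
move=> /eqP; rewrite -addr_eq0 -mulr2n -scaler_nat scaler_eq0 pnatr_eq0 /=.
by move=> /eqP.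
Qed.

(** A real point is fixed by conjugation; comparing [F] and its partial derivatives there with their
    conjugates makes each of the three quantities its own opposite. *)
Lemma hasd_stem_real D F (a : R) X Y : open D -> conj_invariant D ->
  stem_function D F -> D (a, 0) -> hasd F (a, 0) X Y ->
  [/\ X.2 = 0, Y.1 = 0 & (F (a, 0)).2 = 0].
Proof.
move=> oD cD sF Da hF.
have hF' := hasd_stem_conj oD cD sF Da hF; rewrite oppr0 in hF'.
have [eX eY] := hasd_uniq hF hF'.
split; apply: quat_double0.
- by rewrite {1}eX.
- by rewrite {1}eY.
- by have := sF _ _ Da; rewrite oppr0 => {1}->.
Qed.

(** Each of the three imaginary units contributes [- Y2]. This is the limit of [crf_slice], since
    [F2 / b] tends to [Y2]. *)
Lemma crf_slice_real D F (a : R) X Y : open D -> conj_invariant D ->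
  stem_function D F -> D (a, 0) -> hasd F (a, 0) X Y ->
  crf (slice F) a%:A = 2^-1 *: (X.1 - 3 *: Y.2).
Proof.
move=> oD cD sF Da hF; have [_ Y1 _] := hasd_stem_real oD cD sF Da hF.
have h J : imag_units J -> J * 'D_J (slice F) a%:A = - Y.2.
  move=> uJ; have := derive_imag_slice_line oD sF Da uJ hF.
  rewrite scale0r add0r => -[_ ->].
  by rewrite Y1 add0r mulrA (uJ : J * J = -1) mulN1r.
rewrite /crf; congr (_ *: _).
have [_ ->] := derive1_slice_real hF.
have hi := h _ qi_unit; have hj := h _ qj_unit; have hk := h _ qk_unit.
rewrite hi hj hk; apply: quatP; rewrite !(qD, qN, qZ); ring.
Qed.

(** The real direction gives [L1] and each of the three imaginary lines [- L1]. The stem lives on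
    the whole plane because the lemma serves powers and the exponential. *)
Lemma laplacian_slice_real H K L (a : R) : stem_function setT H ->
  (forall w, hasd H w (K w) (hci (K w))) -> hasd K (a, 0) L (hci L) -> L.2 = 0 ->
  laplacian (slice H) a%:A = - (2 *: L.1).
Proof.
move=> sH hH hK L20; have [hK1 hK2] := (hasdP _ _ _ _).1 hK.
have E1 : 'D_1 ('D_1 (slice H)) a%:A = L.1.
  suff [] : is_derive (a%:A : quat R) 1 ('D_1 (slice H)) L.1 by [].
  apply/is_derive_line.
  have -> : (fun t : R => 'D_1 (slice H) (t%:A + a%:A)) = fun t => (K (t + a, 0)).1.
    apply/funext => t; rewrite -scalerDl.
    by have [_ ->] := derive1_slice_real (hH (t + a, 0)).
  have h1' : hasd (fun w => (K w).1) (0 + a, 0) L.1 (hci L).1 by rewrite add0r.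
  have := hasd_curve (is_derive_shiftl 0 a) (is_derive_cst (0 : R) (0 : R) (1 : R)) h1'.
  by move=> /is_derive_eq; apply; rewrite scale1r scale0r addr0.
have E J : imag_units J -> 'D_J ('D_J (slice H)) a%:A = - L.1.
  move=> uJ; suff [] : is_derive (a%:A : quat R) J ('D_J (slice H)) (- L.1) by [].
  apply/is_derive_line.
  have -> : (fun t : R => 'D_J (slice H) (t *: J + a%:A)) =
      fun t => - (K (a, t)).2 + J * (K (a, t)).1.
    apply/funext => t.
    have [_ ->] := derive_imag_slice_line (@openT _) sH (I : setT (a, t)) uJ (hH (a, t)).
    by [].
  have c (G : R * R -> quat R) Z W : hasd G (a, 0) Z W ->
      is_derive (0 : R) 1 (fun s : R => G (a, s)) W.
    move=> hG.
    have := hasd_curve (is_derive_cst a (0 : R) (1 : R)) (is_derive_id (0 : R) (1 : R)) hG.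
    by move=> /is_derive_eq; apply; rewrite scale1r scale0r add0r.
  have := is_deriveD (is_deriveN (c _ _ _ hK2))
    (is_derive_qmul (is_derive_cst J (0 : R) (1 : R)) (c _ _ _ hK1)).
  by move=> /is_derive_eq; apply; rewrite /= L20 oppr0 mulr0 mul0r !addr0.
have Ei := E _ qi_unit; have Ej := E _ qj_unit; have Ek := E _ qk_unit.
pose s (p q : quat R) := p + q.
rewrite [LHS](f_equal2 s (f_equal2 s (f_equal2 s E1 Ei) Ej) Ek) /s.
by apply: quatP; rewrite !(qD, qN, qZ); ring.
Qed.

End RealPoints.

(** * The Vekua system of an eigenfunction *)

Section VekuaSystem.
Set Implicit Arguments.
Unset Strict Implicit.
Context {R : realType}.
Implicit Types (x J lam : quat R) (D : set (R * R)) (F : R * R -> quat R * quat R)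
  (f : quat R -> quat R).

Lemma induced_near D f F x : open (circularization D) -> induced_by D f F ->
  circularization D x -> \forall y \near x, f y = slice F y.
Proof.
move=> oC [_ fF] Cx.
have : \forall y \near x, circularization D y by apply: open_nbhs_nbhs.
by apply: filterS => y; exact: fF.
Qed.

Lemma scale2V (x : quat R) : 2^-1 *: x = 0 -> x = 0.
Proof. by move=> /eqP; rewrite scaler_eq0 invr_eq0 pnatr_eq0 => /eqP. Qed.

(* The system satisfied by the components [F = (A, B)] of an eigenfunction:
   [A_a = A lam], [B_a = B lam], [A_b = - B lam], [b B_b = b A lam - 2 B]; the last
   equation degenerates on the real axis and is completed there by its limit. *)
Definition vekua D lam F (Y : R * R -> quat R) : Prop :=
  forall z, D z ->
  [/\ hasd F z (hcr (F z) lam) (- ((F z).2 * lam), Y z),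
      z.2 *: Y z = z.2 *: ((F z).1 * lam) - 2 *: (F z).2 &
      z.2 = 0 -> (F z).1 * lam = 3 *: Y z].

(** Continuity of [Y] makes the stem [C^1]: the other partial derivatives are right multiples of the
    components of [F], hence continuous already. *)
Lemma vekua_eigen D lam f F Y : open D -> conj_invariant D ->
  open (circularization D) -> induced_by D f F ->
  vekua D lam F Y -> (forall z, D z -> {for z, continuous Y}) ->
  eigen_solution D lam f.
Proof.
move=> oD cD oC fF vF cY.
have main x : circularization D x -> crf f x = 0 /\ 'D_1 f x = f x * lam.
  move=> Cx; have nf := induced_near oC fF Cx.
  rewrite (crf_near nf) (derive_near 1 nf) (nbhs_singleton nf).
  have Dz := (circularizationP x cD).1 Cx; have [hF eY eY0] := vF _ Dz.
  have [r0|r0] := eqVneq (qimnorm x) 0.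
    have xE := real_of_qimnorm0 r0; rewrite r0 /= in hF eY0 Dz; rewrite /= in eY.
    move: (q0 x) xE hF eY0 Dz {Cx nf r0 eY} => a -> hF eY0 Dz.
    rewrite (crf_slice_real oD cD fF.1 Dz hF) /= eY0 // subrr scaler0; split=> //.
    by have [_ ->] := derive1_slice_real hF; rewrite slice_real.
  rewrite (crf_slice r0 hF) /= subrr mulr0 addr0; split.
    rewrite [X in _ *: X](_ : _ = 0) ?scaler0 //.
    (* Multiplying by [qimnorm x] gives the form without denominators used in [vekua]. *)
    apply: (scalerI r0); rewrite scaler0 !scalerBr /= eY scalerA.
    have -> : qimnorm x * (2 / qimnorm x) = 2 by field.
    by rewrite opprB addrCA subrr addr0 subrr.
  by have [_ ->] := derive1_slice r0 hF; rewrite /slice mulrDl mulrA.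
split; last first.
  by move=> x Cx; have [h1 h2] := main x Cx; rewrite crf_conjE h1 h2 subr0.
split; last by move=> x /main[].
exists F => // z Dz; have [hF _ _] := vF z Dz; split; first by case: hF.
move=> v; have dF w : D w -> 'D_v F w = (v.1 *: ((F w).1 * lam) + v.2 *: - ((F w).2 * lam),
    v.1 *: ((F w).2 * lam) + v.2 *: Y w).
  by move=> Dw; have [hFw _ _] := vF w Dw; rewrite (hasd_derive v hFw).
have nD : \forall w \near z, D w by apply: open_nbhs_nbhs.
have cF : {for z, continuous F} by case: hF => d _; exact: differentiable_continuous.
have /hasdP[[d1 _] [d2 _]] := hF.
have [e1 _] := hasd_mulr lam (X := _) (Y := _) ((hasdP _ _ _ _).1 hF).1.
have [e2 _] := hasd_mulr lam (X := _) (Y := _) ((hasdP _ _ _ _).1 hF).2.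
have c1 := differentiable_continuous e1; have c2 := differentiable_continuous e2.
have nE : \forall w \near z, (v.1 *: ((F w).1 * lam) + v.2 *: - ((F w).2 * lam),
    v.1 *: ((F w).2 * lam) + v.2 *: Y w) = 'D_v F w.
  by apply: filterS nD => w /dF.
have g1 := cvgD (cvgZl_tmp (k := v.1) c1) (cvgZl_tmp (k := v.2) (cvgN c2)).
have g2 := cvgD (cvgZl_tmp (k := v.1) c2) (cvgZl_tmp (k := v.2) (cY z Dz)).
have lim : (fun w => 'D_v F w) @ z --> (v.1 *: ((F z).1 * lam) + v.2 *: - ((F z).2 * lam),
    v.1 *: ((F z).2 * lam) + v.2 *: Y z).
  exact: cvg_trans (near_eq_cvg nE) (cvg_pair (g1 _ _ _ _) (g2 _ _ _)).
by rewrite -(dF z Dz) in lim.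
Qed.

(** Comparing a unit with its opposite separates the two components. *)
Lemma imag_pm (P Q : quat R) : (forall J, imag_units J -> P + J * Q = 0) ->
  P = 0 /\ Q = 0.
Proof.
move=> h; have h1 := h _ qi_unit.
have uN : imag_units (- qi : quat R) by rewrite /imag_units /= mulrNN; exact: qi_unit.
have h2 := h _ uN; rewrite mulNr in h2.
have P0 : P = 0.
  apply: quat_double0; apply/eqP; rewrite -addr_eq0; apply/eqP.
  by rewrite -[RHS](addr0 0) -{1}h1 -{1}h2 addrACA subrr addr0.
split=> //; move: h1; rewrite P0 add0r => /(congr1 (fun y => qi * y)).
by rewrite mulrA (qi_unit : qi * qi = -1) mulN1r mulr0 => /eqP; rewrite oppr_eq0 => /eqP.
Qed.

(** On a sphere [a + b J] with [b > 0] both equations hold for every unit [J], so [imag_pm] splits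
    them into four equations for the stem. The lower half plane follows by conjugation and the real
    points by parity. *)
Lemma eigen_vekua D lam f F : axially_symmetric_domain D -> induced_by D f F ->
  C1_on D F -> eigen_solution D lam f ->
  forall z, D z -> exists2 Y : quat R,
    hasd F z (hcr (F z) lam) (- ((F z).2 * lam), Y) &
    z.2 *: Y = z.2 *: ((F z).1 * lam) - 2 *: (F z).2.
Proof.
move=> [oD cD oC _] fF C1 [[_ crf0] crfc].
have main x : circularization D x -> crf (slice F) x = 0 /\ 'D_1 (slice F) x = slice F x * lam.
  move=> Cx; have nf := induced_near oC fF Cx.
  have h0 := crf0 x Cx; have h1 := crfc x Cx; rewrite crf_conjE h0 subr0 in h1.
  by rewrite -(crf_near nf) -(derive_near 1 nf) -(nbhs_singleton nf).
have pos a b : D (a, b) -> 0 < b -> exists2 Y : quat R,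
    hasd F (a, b) (hcr (F (a, b)) lam) (- ((F (a, b)).2 * lam), Y) &
    b *: Y = b *: ((F (a, b)).1 * lam) - 2 *: (F (a, b)).2.
  move=> Dab b0.
  have [dF _] := C1 _ Dab; have hF := differentiable_hasd dF.
  move: hF; set X := 'D_ _ _ _; set Y := 'D_ _ _ _ => hF.
  have at_J J : imag_units J -> X.1 - Y.2 - (2 / b) *: (F (a, b)).2 + J * (X.2 + Y.1) = 0 /\
      X.1 + J * X.2 = ((F (a, b)).1 + J * (F (a, b)).2) * lam.
    move=> uJ; pose x := a%:A + b *: J.
    have Cx : circularization D x by exists a, b, J.
    have x0 : q0 x = a by exact: q0_polar.
    have xr : qimnorm x = b by rewrite qimnorm_polar // gtr0_norm.
    have r0 : qimnorm x != 0 by rewrite xr gt_eqF.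
    have xJ : qimdir x = J.
      by rewrite qimdirE /qvec x0 xr /x addrC addKr scalerA mulVf ?gt_eqF // scale1r.
    have hFx : hasd F (q0 x, qimnorm x) X Y by rewrite x0 xr.
    have [h1 h2] := main x Cx.
    move: h1; rewrite (crf_slice r0 hFx) x0 xr xJ => /scale2V h1; split => //.
    by move: h2; have [_ ->] := derive1_slice r0 hFx; rewrite xJ (sliceE fF.1 Dab uJ).
  have [P0 Q0] : X.1 - Y.2 - (2 / b) *: (F (a, b)).2 = 0 /\ X.2 + Y.1 = 0.
    by apply: imag_pm => J /at_J[].
  have [X1 X2] : X.1 - (F (a, b)).1 * lam = 0 /\ X.2 - (F (a, b)).2 * lam = 0.
    apply: imag_pm => J /at_J[_]; rewrite mulrDl => e.
    by rewrite mulrBr mulrA addrACA e -opprD subrr.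
  move/subr0_eq: X1 => X1; move/subr0_eq: X2 => X2.
  exists Y.2.
    apply: (hasd_eq hF); first by rewrite /hcr -X1 -X2 -surjective_pairing.
    by rewrite [LHS]surjective_pairing -X2; congr (_, _); apply/eqP; rewrite -addr_eq0 addrC Q0.
  move/subr0_eq: P0 => P0.
  have -> : Y.2 = X.1 - (2 / b) *: (F (a, b)).2 by rewrite -P0 opprB addrC subrK.
  rewrite X1 scalerBr scalerA; congr (_ - _ *: _).
  by rewrite mulrC divfK // gt_eqF.
move=> [a b] Dab; case: (ltrgt0P b) => [b0|b0|b0] /=.
- exact: pos.
- have [Y hY eY] := pos a (- b) (cD _ _ Dab) ltac:(by rewrite oppr_gt0).
  have := hasd_stem_conj oD cD fF.1 (cD _ _ Dab) hY; rewrite opprK.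
  move: eY; rewrite (fF.1 _ _ Dab) /hc_conj /hcr /= => eY h.
  exists Y; first by apply: (hasd_eq h); rewrite /= ?mulNr ?opprK //; congr (_, _); rewrite /= ?mulNr ?opprK.
  by move/(congr1 -%R): eY; rewrite !scaleNr scalerN !opprK opprD !opprK.
(* At a real point [B] vanishes, so the last equation reads [0 = 0] whatever [Y.2] is. *)
- rewrite b0 in Dab *; have [dF _] := C1 _ Dab; have hF := differentiable_hasd dF.
  move: hF; set X := 'D_ _ _ _; set Y := 'D_ _ _ _ => hF.
  have [X2 Y1 F2] := hasd_stem_real oD cD fF.1 Dab hF.
  exists Y.2; last by rewrite !scale0r F2 scaler0 subrr.
  have Cx : circularization D a%:A.
    by exists a, 0, qi; split => //; [exact: qi_unit|rewrite scale0r addr0].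
  have [_ h2] := main _ Cx.
  move: h2; have [_ ->] := derive1_slice_real hF; rewrite slice_real => X1.
  apply: (hasd_eq hF).
    by rewrite [LHS]surjective_pairing X1 X2 /hcr F2 mul0r.
  by rewrite [LHS]surjective_pairing Y1 F2 mul0r oppr0.
Qed.

End VekuaSystem.

(** * The Laplacian of the exponential *)

Section LaplacianOfExponential.
Set Implicit Arguments.
Unset Strict Implicit.
Context {R : realType}.
Implicit Types (x c J lam : quat R) (D : set (R * R)) (z : R * R).

Lemma qps_comm (d : nat -> quat R) lam t : qent d -> (forall n, lam * d n = d n * lam) ->
  lam * qps d t = qps d t * lam.
Proof.
move=> hd hc; rewrite -qps_mull // -qps_mulr //; congr (qps _ t).
by apply/funext => n; exact: hc.
Qed.

Lemma csinc_comm lam n : lam * csinc lam n = csinc lam n * lam.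
Proof. by rewrite /csinc qscalel qscaler -exprS -exprSr. Qed.

Lemma qsc_comm lam t : lam * qsc lam t = qsc lam t * lam.
Proof. by apply: qps_comm; [exact: qent_csinc|exact: csinc_comm]. Qed.

Lemma qsc1_comm lam t : lam * qsc1 lam t = qsc1 lam t * lam.
Proof.
apply: qps_comm; first by apply: qent_diffs; exact: qent_csinc.
by move=> n; rewrite /qps_diffs qscalel qscaler csinc_comm.
Qed.

(* Smooth also at [z.2 = 0], unlike the expression of the Laplacian through [H / z.2]. *)
Definition lap_exp_stem lam z : quat R * quat R :=
  (- (2 *: (qex lam z.1 * qsc lam z.2 * lam)), 2 *: (qex lam z.1 * qsc1 lam z.2)).

(** Stem of the slice product of the constant [c] with the Laplacian of [exp_lam]; see
    [slice_mul_cst]. *)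
Definition lap_exp_stemM c lam z : quat R * quat R := (c * (lap_exp_stem lam z).1, c * (lap_exp_stem lam z).2).

Lemma lap_exp_stemM_stem D c lam : stem_function D (lap_exp_stemM c lam).
Proof.
move=> a b _; rewrite /lap_exp_stemM /lap_exp_stem /hc_conj /= qsc1_odd (qco_even lam b).2.
by rewrite !mulrN scalerN mulrN.
Qed.

Let vekua_algebra1 (t : R) (c e s s2 s1 lam : quat R) :
  t *: s2 = - (t *: s * lam * lam) - 2 *: s1 ->
  t *: (c * (2 *: (e * s2))) =
  t *: (c * (- (2 *: (e * s * lam))) * lam) - 2 *: (c * (2 *: (e * s1))).
Proof.
move=> h; have h' : t *: (c * (e * s2)) = - (t *: (c * (e * s * lam) * lam)) - 2 *: (c * (e * s1)).
  by rewrite -!qscaler h mulrBr mulrN !qscalel !qscaler mulrBr mulrN !qscaler !mulrA.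
rewrite mulrN mulNr !(qscaler, qscalel) scalerA (mulrC t) -scalerA h'.
move: (c * (e * s * lam) * lam) (c * (e * s1)) => A B.
by apply: quatP; rewrite !(qD, qN, qZ); ring.
Qed.

Let vekua_algebra0 (c e s2 lam : quat R) : 3 *: s2 = - (lam * lam * lam) ->
  c * (- (2 *: (e * lam * lam))) * lam = 3 *: (c * (2 *: (e * s2))).
Proof.
move=> h; have h' : 3 *: (c * (e * s2)) = - (c * (e * lam * lam) * lam).
  by rewrite -!qscaler h !mulrN !mulrA.
rewrite mulrN mulNr !(qscaler, qscalel) scalerA (mulrC 3) -scalerA h'.
by rewrite scalerN.
Qed.

(** The last two equations follow from [qsc_eq2] and, on the real axis, from the values in
    [qsc_at0]. *)
Lemma vekua_lap_exp_stemM D c lam :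
  vekua D lam (lap_exp_stemM c lam) (fun z => c * (2 *: (qex lam z.1 * qsc2 lam z.2))).
Proof.
move=> z _; have hx := hasd_fst (qex_derive lam z.1).
have hs := hasd_snd (qsc_derive lam z.2); have hs1 := hasd_snd (qsc1_derive lam z.2).
have e0 : qex lam z.1 * lam * qsc lam z.2 = qex lam z.1 * qsc lam z.2 * lam.
  by rewrite -!mulrA qsc_comm.
have e1 : qex lam z.1 * lam * qsc1 lam z.2 = qex lam z.1 * qsc1 lam z.2 * lam.
  by rewrite -!mulrA qsc1_comm.
have e2 : qex lam z.1 * qsc1 lam z.2 * lam = qex lam z.1 * (qsc1 lam z.2 * lam).
  by rewrite mulrA.
split.
- apply/hasdP; split => /=.
    apply: (hasd_eq (hasd_mull c (hasdN (hasd_scalec 2 (hasd_mulr lam (hasd_mul hx hs)))))).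
      by rewrite mulr0 add0r e0 !mulrN !qscaler mulNr qscalel mulrA.
    by rewrite mul0r addr0 !mulrN !qscaler qscalel mulrA.
  apply: (hasd_eq (hasd_mull c (hasd_scalec 2 (hasd_mul hx hs1)))).
    by rewrite mulr0 add0r e1 !qscaler qscalel mulrA.
  by rewrite mul0r addr0.
- exact: vekua_algebra1 (qsc_eq2 lam z.2).
- move=> z2; have [s0 s2] := qsc_at0 lam.
  by rewrite /= z2 s0; exact: vekua_algebra0.
Qed.

Lemma vekua_lap_exp_stemM_continuous c lam z :
  {for z, continuous (fun w : R * R => c * (2 *: (qex lam w.1 * qsc2 lam w.2)))}.
Proof.
have hx := hasd_fst (qex_derive lam z.1).
have hs := hasd_snd (derivableP (@qsc2_derivable R lam z.2)).
have [d _] := hasd_mull c (hasd_scalec 2 (hasd_mul hx hs)).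
exact: differentiable_continuous d.
Qed.

Lemma cvgn_mull (m l : quat R) (f : nat -> quat R) :
  f @ \oo --> l -> (fun n => m * f n) @ \oo --> m * l.
Proof. by move=> h; have := continuous_cvg _ (@qmull_continuous _ m _) h; apply. Qed.

Lemma cvgn_mulr (m l : quat R) (f : nat -> quat R) :
  f @ \oo --> l -> (fun n => f n * m) @ \oo --> l * m.
Proof. by move=> h; have := continuous_cvg _ (@qmulr_continuous _ m _) h; apply. Qed.

Lemma polar_expr (a b : R) J n : imag_units J ->
  (a%:A + b *: J) ^+ n = (cpow (a, b) n).1%:A + (cpow (a, b) n).2 *: J.
Proof.
move=> uJ; have JJ : J * J = -1 by exact: uJ.
elim: n => [|n IH]; first by rewrite expr0 /= scale1r scale0r addr0.
rewrite exprS IH cpowS1 cpowS2 /=.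
rewrite mulrDl !mulrDr !(qscalel, qscaler) !mul1r mulr1 JJ.
by apply: quatP; rewrite !(qD, qN, qZ); ring.
Qed.

Lemma slice_setT F (a b : R) J : stem_function setT F -> imag_units J ->
  slice F (a%:A + b *: J) = (F (a, b)).1 + J * (F (a, b)).2.
Proof. by move=> sF uJ; rewrite (sliceE sF). Qed.

Lemma exp_stem_stem lam : stem_function setT (exp_stem lam).
Proof. by move=> a b _; exact: exp_stem_conj. Qed.

(** [x^n = Re z^n + J Im z^n] stands to the left of [lam^n], so [J] factors out on the left and
    leaves the two component series. *)
Lemma qexp_cvg lam x :
  series (fun n => n`!%:R^-1 *: (x ^+ n * lam ^+ n)) @ \oo --> slice (exp_stem lam) x.
Proof.
have [J uJ ->] := quat_polar x; set a := q0 x; set b := qimnorm x.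
rewrite slice_setT //; last exact: exp_stem_stem.
have [h1 h2] := exp_stem_series lam (a, b).
have -> : series (fun n => n`!%:R^-1 *: ((a%:A + b *: J) ^+ n * lam ^+ n)) =
    series (cexp1 lam (a, b)) + (fun n => J * series (cexp2 lam (a, b)) n).
  apply/funext => n; transitivity (series (cexp1 lam (a, b)) n + J * series (cexp2 lam (a, b)) n); last by [].
  rewrite /series /= mulr_sumr -big_split /=; apply: eq_bigr => i _.
  rewrite polar_expr // /cexp1 /cexp2 mulrDl !(qscalel, qscaler) mul1r scalerDr !scalerA.
  by rewrite mulrC [_^-1 * (cpow _ _).2]mulrC.
exact: cvgD h1 (cvgn_mull (m := J) h2).
Qed.

Lemma qexp_slice lam : qexp lam = slice (exp_stem lam).
Proof. by apply/funext => x; apply: cvg_lim => //; exact: qexp_cvg. Qed.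

Let lap_algebra (r : R) (u e s s1 co lam : quat R) : r != 0 ->
  co * lam = s + r *: s1 ->
  - ((2 * r^-1) *: (e * (r *: s) * lam)) +
  u * ((2 * r^-1) *: (e * co * lam) - (2 * r^-1 ^+ 2) *: (e * (r *: s))) =
  - (2 *: (e * s * lam)) + u * (2 *: (e * s1)).
Proof.
move=> r0 h; rewrite -(mulrA e co) h (mulrDr e) !(qscalel, qscaler) (mulrBr u) !qscaler (mulrDr u) !qscaler.
move: (e * s * lam) (u * (e * s)) (u * (e * s1)) => A B C.
by apply: quatP; rewrite !(qD, qN, qZ); field.
Qed.

Let slice_lap_exp_stemM_algebra (r : R) (u c e s s1 co lam : quat R) : r != 0 ->
  co * lam = s + r *: s1 ->
  c * - (2 *: (e * s * lam)) + u * (c * (2 *: (e * s1))) =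
  - ((2 * r^-1) *: (c * (e * (r *: s)) * lam)) +
  u * ((2 * r^-1) *: (c * (e * co) * lam) - (2 * r^-1 ^+ 2) *: (c * (e * (r *: s)))).
Proof.
move=> r0 h; rewrite !(mulrA c); rewrite (lap_algebra u (c * e) r0 h).
by rewrite (mulrN c) !(qscaler, qscalel) !mulrA.
Qed.

(** Matches the smooth form with the general Laplacian formula: [sin(r lam) = r s(r)] and [qsc_eq1]
    remove the powers of [1 / r]. *)
Lemma slice_lap_exp_stemM c lam x : qimnorm x != 0 ->
  let w := (qimnorm x)^-1 in let z := (q0 x, qimnorm x) in
  slice (lap_exp_stemM c lam) x = - ((2 * w) *: (c * (exp_stem lam z).2 * lam)) +
    qimdir x * ((2 * w) *: (c * (exp_stem lam z).1 * lam) - (2 * w ^+ 2) *: (c * (exp_stem lam z).2)).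
Proof.
move=> r0 w z; rewrite /exp_stem /= qsi_qsc.
exact: slice_lap_exp_stemM_algebra r0 (qsc_eq1 lam (qimnorm x)).
Qed.

Lemma lap_exp_stem1 lam : lap_exp_stemM 1 lam = lap_exp_stem lam.
Proof. by apply/funext => z; rewrite /lap_exp_stemM !mul1r. Qed.

Lemma slice_lap_exp_stem lam x : qimnorm x != 0 ->
  let w := (qimnorm x)^-1 in let z := (q0 x, qimnorm x) in
  slice (lap_exp_stem lam) x = - ((2 * w) *: ((exp_stem lam z).2 * lam)) +
    qimdir x * ((2 * w) *: ((exp_stem lam z).1 * lam) - (2 * w ^+ 2) *: (exp_stem lam z).2).
Proof.
move=> r0 w z; have := slice_lap_exp_stemM 1 lam r0; cbv zeta; rewrite (lap_exp_stem1 lam).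
by rewrite -/w -/z (mul1r (exp_stem lam z).1) (mul1r (exp_stem lam z).2).
Qed.

Lemma laplacian_qexp lam : laplacian (qexp lam) = slice (lap_exp_stem lam).
Proof.
have hE := hasd_exp_stem lam.
have hE2 w : hasd (fun p => hcr (exp_stem lam p) lam) w (hcr (hcr (exp_stem lam w) lam) lam)
    (hci (hcr (hcr (exp_stem lam w) lam) lam)).
  have [h1 h2] := (hasdP _ _ _ _).1 (hE w).
  apply/hasdP; split; last exact: (hasd_mulr lam h2).
  by apply: (hasd_eq (hasd_mulr lam h1)) => //=; rewrite mulNr.
apply/funext => x; rewrite qexp_slice.
have [r0|r0] := eqVneq (qimnorm x) 0.
  rewrite (real_of_qimnorm0 r0); set a := q0 x.
  rewrite (laplacian_slice_real (exp_stem_stem lam) hE (hE2 (a, 0))).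
    rewrite slice_real /= /qco (rexp_0 _ _).1 mulr1 (qsc_at0 lam).1.
    by [].
  by rewrite /= qsi_qsc scale0r mulr0 !mul0r.
rewrite (laplacian_slice r0 _ (hE2 _)); last by near=> w; exact: hE.
by rewrite slice_lap_exp_stem.
Unshelve. all: by end_near. Qed.

End LaplacianOfExponential.

(** * The polynomials [P_n] and the series expansion of the Laplacian *)

Section MonogenicPolynomials.
Set Implicit Arguments.
Unset Strict Implicit.
Context {R : realType}.
Implicit Types (x c J lam : quat R) (z : R * R) (n m : nat).

Definition pow_stem m z : quat R * quat R := ((cpow z m).1%:A, (cpow z m).2%:A).

Lemma pow_stem_stem m : stem_function setT (pow_stem m).
Proof.
by move=> a b _; rewrite /pow_stem (cpow_conj (a, b)) /hc_conj /= scaleNr.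
Qed.

Lemma slice_pow_stem m : slice (pow_stem m) = fun x => x ^+ m.
Proof.
apply/funext => x; have [J uJ ->] := quat_polar x.
by rewrite slice_setT ?polar_expr //= ?qscaler ?mulr1 //; exact: pow_stem_stem.
Qed.

Lemma hasd_cpow m z :
  hasd (fun w => (cpow w m).1) z (m%:R * (cpow z m.-1).1) (- (m%:R * (cpow z m.-1).2)) /\
  hasd (fun w => (cpow w m).2) z (m%:R * (cpow z m.-1).2) (m%:R * (cpow z m.-1).1).
Proof.
have h1 := hasd_fst (is_derive_id z.1 1); have h2 := hasd_snd (is_derive_id z.2 1).
elim: m => [|m [IH1 IH2]].
  by rewrite !mul0r oppr0; split; exact: hasd_cst.
split.
  apply: (hasd_eq (hasdB (hasd_scale h1 IH1) (hasd_scale h2 IH2))).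
    (* [m = 0] is treated apart because [m.-1.+1 = m] fails there; the factor [m%:R] makes the value
       of [m.-1] harmless. *)
    case: m {IH1 IH2} => [|m]; rewrite /GRing.scale /= ?mul0r; first by rewrite /=; ring.
    by rewrite -/(cpow z m) -(natr1 m.+1); ring.
  case: m {IH1 IH2} => [|m]; rewrite /GRing.scale /= ?mul0r; first by rewrite /=; ring.
  by rewrite -/(cpow z m) -(natr1 m.+1); ring.
apply: (hasd_eq (hasdD (hasd_scale h2 IH1) (hasd_scale h1 IH2))).
  case: m {IH1 IH2} => [|m]; rewrite /GRing.scale /= ?mul0r; first by rewrite /=; ring.
  by rewrite -/(cpow z m) -(natr1 m.+1); ring.
case: m {IH1 IH2} => [|m]; rewrite /GRing.scale /= ?mul0r; first by rewrite /=; ring.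
by rewrite -/(cpow z m) -(natr1 m.+1); ring.
Qed.

Lemma hasd_pow_stem m z : hasd (pow_stem m) z (m%:R *: pow_stem m.-1 z) (hci (m%:R *: pow_stem m.-1 z)).
Proof.
have [h1 h2] := hasd_cpow m z.
apply/hasdP; split => /=.
  apply: (hasd_eq (hasd_scale h1 (hasd_cst (1 : quat R) z))).
    by rewrite scaler0 add0r scalerA.
  by rewrite scaler0 add0r scalerA scaleNr.
apply: (hasd_eq (hasd_scale h2 (hasd_cst (1 : quat R) z))).
  by rewrite scaler0 add0r scalerA.
by rewrite scaler0 add0r scalerA.
Qed.

Lemma hasd_pow_stem2 m z : hasd (fun w => m%:R *: pow_stem m.-1 w) z
  (m%:R *: (m.-1%:R *: pow_stem m.-2 z)) (hci (m%:R *: (m.-1%:R *: pow_stem m.-2 z))).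
Proof.
apply: (hasd_eq (hasd_scalec m%:R (hasd_pow_stem m.-1 z))) => //.
by rewrite /hci; apply: injective_projections => //=; rewrite scalerN.
Qed.

(** With [mono_im], the components of [P_n(x)] along [1] and [qimdir x], read off from
    [laplacian_slice] for the stem [z^(n+2)]. *)
Definition mono_re n z : R := 2^-1 * z.2^-1 * n.+2%:R * (cpow z n.+1).2.
Definition mono_im n z : R :=
  - (2^-1 * (z.2^-1 * n.+2%:R * (cpow z n.+1).1 - z.2^-1 ^+ 2 * (cpow z n.+2).2)).

Lemma monogenic_poly_nonreal n x : qimnorm x != 0 ->
  let z := (q0 x, qimnorm x) in
  monogenic_poly n x = (mono_re n z)%:A + mono_im n z *: qimdir x.
Proof.
move=> r0 z; rewrite /monogenic_poly -slice_pow_stem.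
pose K w := n.+2%:R *: pow_stem n.+1 w.
have hn : \forall w \near z, hasd (pow_stem n.+2) w (K w) (hci (K w)).
  by near=> w; exact: hasd_pow_stem.
rewrite (laplacian_slice r0 hn (hasd_pow_stem2 n.+2 z)) /K.
rewrite -/z /pow_stem /=; set u := qimdir x.
rewrite mulrBr !qscaler !mulr1 /mono_re /mono_im /=.
move: ((qimnorm x)^-1) => w; move: (z.1 * _ - _) (z.2 * _ + _) => p q.
by apply: quatP; rewrite !(qD, qN, qZ) !mkqE; field.
Unshelve. all: by end_near. Qed.

Lemma monogenic_poly_real n (a : R) :
  monogenic_poly n (a%:A : quat R) = (2^-1 * n.+2%:R * n.+1%:R * a ^+ n)%:A.
Proof.
rewrite /monogenic_poly -slice_pow_stem.
rewrite (laplacian_slice_real (@pow_stem_stem n.+2) (hasd_pow_stem n.+2) (hasd_pow_stem2 n.+2 (a, 0))).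
  rewrite /pow_stem /= cpow_real /= !scalerN scaleNr opprK !scalerA.
  by congr (_ *: _); field.
by rewrite /pow_stem /= cpow_real /= !(scale0r, scaler0).
Qed.

Definition mono_sum n x : quat R :=
  \sum_(1 <= k < n.+2) k%:R *: (x ^+ k.-1 * qconj x ^+ (n.+1 - k)).

(** Right multiplication by the conjugate raises its exponent in every term; the new term is
    [k = n + 2]. *)
Lemma mono_sumS n x : mono_sum n.+1 x = mono_sum n x * qconj x + n.+2%:R *: x ^+ n.+1.
Proof.
rewrite /mono_sum big_nat_recr //= subnn expr0 mulr1; congr (_ + _).
rewrite mulr_suml; apply: eq_big_nat => k /andP[_ kn].
by rewrite qscalel -mulrA -exprSr subSn // -ltnS.
Qed.

Lemma mono_sum0 x : mono_sum 0 x = 1.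
Proof. by rewrite /mono_sum big_nat1 /= !expr0 mulr1 scale1r. Qed.

Let polar_mul_conj (s t a r k p q : R) (u : quat R) : u * u = -1 ->
  (s * a + t * r + k * p)%:A + (t * a - s * r + k * q) *: u =
  (s%:A + t *: u) * (a%:A - r *: u) + k *: (p%:A + q *: u).
Proof.
move=> uu; rewrite (mulrDl s%:A) (mulrBr s%:A) (mulrBr (t *: u)) !(qscalel, qscaler) uu !mul1r mulr1.
by apply: quatP; rewrite !(qD, qN, qZ); ring.
Qed.

(** Induction along [mono_sumS]: off the axis [mono_re] and [mono_im] obey the same recursion in the
    plane spanned by [1] and [qimdir x]. On the axis it is the recursion of the triangular numbers
    [(n + 1)(n + 2) / 2]. *)
Lemma monogenic_polyE n x : monogenic_poly n x = mono_sum n x.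
Proof.
have [r0|r0] := eqVneq (qimnorm x) 0.
  rewrite (real_of_qimnorm0 r0); set a := q0 x.
  have cj : qconj (a%:A : quat R) = a%:A.
    by apply: quatP; rewrite /qconj !mkqE !qZ !mkqE; ring.
  rewrite monogenic_poly_real; elim: n => [|n IH].
    by rewrite mono_sum0 expr0 mulr1 mulr1 mulVf ?scale1r // pnatr_eq0.
  rewrite mono_sumS -IH cj qscalel mul1r exprZn expr1n !scalerA -scalerDl; congr (_ *: _).
  by rewrite exprSr -(natr1 n.+2) -(natr1 n.+1); field.
set z := (q0 x, qimnorm x); have uu : qimdir x * qimdir x = -1 by exact: qimdir_unit.
have xE : x = z.1%:A + z.2 *: qimdir x.
  by rewrite qimdirE scalerA divff // scale1r /qvec addrC subrK.
have cj : qconj x = z.1%:A - z.2 *: qimdir x.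
  rewrite qimdirE scalerA divff // scale1r qvecE.
  by rewrite /z /=; apply: quatP; rewrite /qconj !(qD, qN, qZ) !mkqE; ring.
elim: n => [|n IH]; rewrite (monogenic_poly_nonreal _ r0) -/z.
  rewrite mono_sum0 /mono_re /mono_im /=.
  rewrite (_ : _ * _ = 1) ?scale1r; last by rewrite /=; field.
  by rewrite (_ : - _ = 0) ?scale0r ?addr0 //; field.
rewrite mono_sumS -IH (monogenic_poly_nonreal _ r0) -/z cj.
have -> : x ^+ n.+1 = (cpow z n.+1).1%:A + (cpow z n.+1).2 *: qimdir x.
  by rewrite {1}xE polar_expr -?surjective_pairing //; exact: qimdir_unit.
have e1 : mono_re n.+1 z = mono_re n z * z.1 + mono_im n z * z.2 + n.+2%:R * (cpow z n.+1).1.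
  rewrite /mono_re /mono_im !(cpowS2 z n.+1) -(natr1 n.+2) /=.
  move: (cpow z n.+1).1 (cpow z n.+1).2 => p q.
  by field.
have e2 : mono_im n.+1 z = mono_im n z * z.1 - mono_re n z * z.2 + n.+2%:R * (cpow z n.+1).2.
  rewrite /mono_re /mono_im !(cpowS2 z n.+2) !(cpowS1 z n.+1) !(cpowS2 z n.+1) -(natr1 n.+2) /=.
  move: (cpow z n.+1).1 (cpow z n.+1).2 => p q.
  by field.
rewrite e1 e2; exact: polar_mul_conj.
Qed.

Lemma cvg_series_shift (d : nat -> quat R) l :
  series d @ \oo --> l -> series (fun n => d n.+1) @ \oo --> l - d 0%N.
Proof.
move=> h; have -> : series (fun n => d n.+1) = fun n => series d n.+1 - d 0%N.
  by apply/funext => n; rewrite /series /= [in RHS]big_nat_recl // addrC addKr.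
apply: cvgB; last exact: cvg_cst.
by rewrite -cvg_shiftS in h.
Qed.

Let series_limit_algebra (w r : R) (u E1 E2 lam : quat R) : w * r = 1 ->
  - 4^-1 *: (- ((2 * w) *: (E2 * lam)) +
             u * ((2 * w) *: (E1 * lam) - (2 * w ^+ 2) *: E2)) =
  (2^-1 * w) *: ((E2 - 0) * lam) + (- (2^-1 * w)) *: (u * ((E1 - 1) * lam)) +
  (2^-1 * w ^+ 2) *: (u * (E2 - 0 - r *: lam)).
Proof.
move=> wr; rewrite !subr0 (mulrBl lam) mul1r !(mulrBr u) !qscaler.
have -> : (2^-1 * w ^+ 2) *: (u * E2 - r *: (u * lam)) =
    (2^-1 * w ^+ 2) *: (u * E2) - (2^-1 * w) *: (u * lam).
  rewrite scalerBr scalerA; congr (_ - _ *: _).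
  by rewrite expr2 -!mulrA wr mulr1.
move: (E2 * lam) (u * (E1 * lam)) (u * E2) (u * lam) => A B C M.
by apply: quatP; rewrite !(qD, qN, qZ); field.
Qed.

(** The factor [n + 2] from differentiating the power turns [1 / (n + 2)!] into [1 / (n + 1)!],
    which gives back terms of the exponential series. *)
Let monogenic_term lam x n : qimnorm x != 0 ->
  let z := (q0 x, qimnorm x) in let w := (qimnorm x)^-1 in let u := qimdir x in
  (n.+2)`!%:R^-1 *: (monogenic_poly n x * lam ^+ n.+2) =
  (2^-1 * w) *: (cexp2 lam z n.+1 * lam) +
  (- (2^-1 * w)) *: (u * (cexp1 lam z n.+1 * lam)) +
  (2^-1 * w ^+ 2) *: (u * cexp2 lam z n.+2).
Proof.
move=> r0 z w u; rewrite (monogenic_poly_nonreal _ r0) -/z -/u.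
have fK : (n.+1`!%:R)^-1 = n.+2%:R * (n.+2`!%:R)^-1 :> R by rewrite factSK.
rewrite /mono_re /mono_im -/w /cexp1 /cexp2 fK mulrDl !(qscalel, qscaler) -!exprSr mul1r.
move: (cpow z n.+1) (cpow z n.+2) (n.+2`!%:R^-1 : R) (n.+2%:R : R) => p q F N.
move: (lam ^+ n.+2) => M; move: (u * M) => uM.
by apply: quatP; rewrite !(qD, qN, qZ) -/w; ring.
Qed.

(** The Laplacian is never exchanged with the sum. Each term is a combination of terms of the
    exponential series, so the sum is known from [exp_stem_series] and is compared with the explicit
    Laplacian. *)
Lemma monogenic_series lam x :
  series (fun n => (n.+2)`!%:R^-1 *: (monogenic_poly n x * lam ^+ n.+2)) @ \oo -->
  - 4^-1 *: laplacian (qexp lam) x.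
Proof.
rewrite laplacian_qexp.
have fK n : (n.+1`!%:R)^-1 * n.+1%:R = (n`!%:R)^-1 :> R by rewrite mulrC factSK.
have [r0|r0] := eqVneq (qimnorm x) 0.
  rewrite (real_of_qimnorm0 r0); set a := q0 x.
  have [h1 _] := exp_stem_series lam (a, 0).
  (* Since [P_n(a) = (n + 1)(n + 2) a^n / 2], each term is [a^n lam^n / n!] times [lam^2 / 2]. *)
  have := cvgn_mulr (m := 2^-1 *: (lam * lam)) h1.
  rewrite slice_real /= /qco (rexp_0 _ _).1 mulr1 (qsc_at0 lam).1.
  have -> : qex lam a * (2^-1 *: (lam * lam)) = - 4^-1 *: - (2 *: (qex lam a * lam * lam)).
    by rewrite qscaler scalerN scaleNr opprK scalerA mulrA; congr (_ *: _); field.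
  rewrite (_ : (fun n => _) = series (fun n => (n.+2)`!%:R^-1 *: (monogenic_poly n a%:A * lam ^+ n.+2))) //.
  apply/funext => n; rewrite /series /= mulr_suml; apply: eq_bigr => i _.
  rewrite monogenic_poly_real /cexp1 cpow_real /= !(qscalel, qscaler) mul1r !scalerA !exprSr !mulrA.
  congr (_ *: _); rewrite -(fK i) -(fK i.+1).
  by ring.
set z := (q0 x, qimnorm x); have [h1 h2] := exp_stem_series lam z.
set w := (qimnorm x)^-1; set u := qimdir x.
(* The sums run over the terms from degree 1 or 2 on; these are the initial terms to be
   subtracted. *)
have c10 : cexp1 lam z 0 = 1 by rewrite /cexp1 /= expr0 fact0 divr1 scale1r.
have c20 : cexp2 lam z 0 = 0 by rewrite /cexp2 /= mul0r scale0r.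
have c21 : cexp2 lam z 1 = qimnorm x *: lam.
  by rewrite /cexp2 /= expr1 (_ : 1`! = 1)%N // divr1 mulr1 mulr0 addr0.
have wr : w * qimnorm x = 1 by rewrite mulVf.
have s1 := cvg_series_shift h1; have s2 := cvg_series_shift h2.
have s3 := cvg_series_shift s2.
rewrite c10 in s1; rewrite c20 in s2 s3; rewrite c21 in s3.
have A1 := cvgZl_tmp (k := 2^-1 * w) (cvgn_mulr (m := lam) s2).
have A2 := cvgZl_tmp (k := - (2^-1 * w)) (cvgn_mull (m := u) (cvgn_mulr (m := lam) s1)).
have A3 := cvgZl_tmp (k := 2^-1 * w ^+ 2) (cvgn_mull (m := u) s3).
have lim := cvgD (cvgD (A1 _) (A2 _)) (A3 _).
rewrite (slice_lap_exp_stem lam r0) (series_limit_algebra _ _ _ _ wr).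
set s := series _.
suff -> : s = fun n => (2^-1 * w) *: (series (fun n => cexp2 lam z n.+1) n * lam) +
    (- (2^-1 * w)) *: (u * (series (fun n => cexp1 lam z n.+1) n * lam)) +
    (2^-1 * w ^+ 2) *: (u * series (fun n => cexp2 lam z n.+2) n) by exact: lim.
apply/funext => n; rewrite /s /series /= !mulr_suml !mulr_sumr !scaler_sumr -!big_split /=.
by apply: eq_bigr => i _; exact: monogenic_term.
Qed.

End MonogenicPolynomials.

(** * Classification of the eigenfunctions *)

Section EigenfunctionRepresentation.
Set Implicit Arguments.
Unset Strict Implicit.
Context {R : realType}.
Implicit Types (x c J lam mu : quat R) (D : set (R * R)) (z : R * R)
  (F G H : R * R -> quat R * quat R) (f g : quat R -> quat R).

Lemma circularization_setT : circularization (@setT (R * R)) = setT.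
Proof.
apply/seteqP; split => // x _; have [J uJ xE] := quat_polar x.
by exists (q0 x), (qimnorm x), J.
Qed.

Lemma eigen_kerP D lam f : eigen_ker D lam f <-> eigen_solution D lam f.
Proof.
split=> -[h1 h2]; split => // x Cx; have := h2 x Cx; rewrite /eigen_op.
  by move=> /subr0_eq.
by move=> ->; rewrite subrr.
Qed.

Lemma induced_slice D F : stem_function D F -> induced_by D (slice F) F.
Proof. by []. Qed.

Lemma induced_cst D c : induced_by D (fun=> c) (fun=> (c, 0)).
Proof.
split; first by move=> a b _; rewrite /hc_conj /= oppr0.
by move=> x _; rewrite /slice /= mulr0 addr0.
Qed.

Lemma induced_laplacian_qexp D lam : induced_by D (laplacian (qexp lam)) (lap_exp_stem lam).
Proof.
split; last by rewrite laplacian_qexp.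
by rewrite -lap_exp_stem1; exact: lap_exp_stemM_stem.
Qed.

Lemma induced_qexp D lam : induced_by D (qexp lam) (exp_stem lam).
Proof.
split; last by rewrite qexp_slice.
by move=> a b _; exact: exp_stem_conj.
Qed.

Lemma slice_mulE D f g F G x : conj_invariant D -> induced_by D f F ->
  induced_by D g G -> circularization D x ->
  slice_mul D f g x = slice (fun z => hc_mul (F z) (G z)) x.
Proof.
move=> cD fF gG /(circularizationP _ cD) Dz.
by rewrite /slice_mul /slice (stem_ofE cD fF Dz) (stem_ofE cD gG Dz).
Qed.

Lemma slice_mul_cst D c lam x : conj_invariant D -> circularization D x ->
  slice_mul D (fun=> c) (laplacian (qexp lam)) x = slice (lap_exp_stemM c lam) x.
Proof.
move=> cD Cx; rewrite (slice_mulE cD (induced_cst _ c) (induced_laplacian_qexp _ lam) Cx).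
by rewrite /slice /hc_mul /lap_exp_stemM /= !mul0r subr0 addr0.
Qed.

Lemma eigen_lap_exp_stemM D c lam f : open D -> conj_invariant D -> open (circularization D) ->
  (forall x, circularization D x -> f x = slice (lap_exp_stemM c lam) x) ->
  eigen_solution D lam f.
Proof.
move=> oD cD oC fE.
have fF : induced_by D f (lap_exp_stemM c lam) by split => //; exact: lap_exp_stemM_stem.
have cY z : D z -> {for z, continuous (fun w : R * R => c * (2 *: (qex lam w.1 * qsc2 lam w.2)))}.
  by move=> _; exact: vekua_lap_exp_stemM_continuous.
exact: (vekua_eigen oD cD oC fF (@vekua_lap_exp_stemM R D c lam) cY).
Qed.

Lemma qimdir_polar (a b : R) J : imag_units J -> 0 < b -> qimdir (a%:A + b *: J) = J.
Proof.
move=> uJ b0; rewrite qimdirE /qvec q0_polar // qimnorm_polar // gtr0_norm //.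
by rewrite addrC addKr scalerA mulVf ?gt_eqF // scale1r.
Qed.

Lemma polar_stem_dz G (a b : R) : (forall J, imag_units J -> slice G (a%:A + b *: J) = 0) ->
  0 < b -> G (a, b) = 0.
Proof.
move=> h b0; suff [h1 h2] : (G (a, b)).1 = 0 /\ (G (a, b)).2 = 0.
  by rewrite [LHS]surjective_pairing h1 h2.
apply: imag_pm => J uJ; rewrite -[RHS](h J uJ) /slice.
by rewrite q0_polar // qimnorm_polar // gtr0_norm // qimdir_polar.
Qed.

Lemma slice_congr F G x : F (q0 x, qimnorm x) = G (q0 x, qimnorm x) ->
  slice F x = slice G x.
Proof. by rewrite /slice => ->. Qed.

(** Holomorphy makes the [b]-derivative [iota] times the [a]-derivative, so [dG/dz = 0] kills both.
    The slice derivative is evaluated only at [b >= 0]; the lower half of [D] is reached by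
    conjugation. *)
Lemma slice_constantP D g : open D -> conj_invariant D ->
  slice_constant D g <->
  exists2 G, induced_by D g G & forall z, D z -> hasd G z 0 0.
Proof.
move=> oD cD.
have dz G z X : hasd G z X (hci X) -> stem_dz G z = X.
  move=> hG; rewrite /stem_dz (hasd_derive (1, 0) hG) (hasd_derive (0, 1) hG) /=.
  rewrite !scale1r !scale0r addr0 add0r hc_mul_iota hciK opprK.
  by apply: injective_projections; rewrite /=; apply: quatP; rewrite !(qZ, qD); field.
(* The chosen [stem_of D g] is tied to [G] only on [D]; as [D] is open, this determines its
   derivatives there. *)
have sof G z : induced_by D g G -> D z -> stem_dz (stem_of D g) z = stem_dz G z.
  move=> gG Dz; have nG : \forall w \near z, stem_of D g w = G w.
    have : \forall w \near z, D w by apply: open_nbhs_nbhs.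
    by apply: filterS => w; exact: stem_ofE.
  by rewrite /stem_dz !(near_eq_derive _ nG).
split=> [[[G gG hG] g0]|[G gG hG]].
  exists G => //.
  have hX z : D z -> hasd G z (stem_dz G z) (hci (stem_dz G z)).
    move=> Dz; have [dG hi] := hG z Dz; have h := differentiable_hasd dG.
    have e : 'D_(0, 1) G z = hci ('D_(1, 0) G z).
      rewrite !deriveE // -hc_mul_iota -hi; congr ('d G z _).
      by rewrite /= oppr0.
    by rewrite e in h; rewrite (dz _ _ _ h).
  have s0 a b J : D (a, b) -> imag_units J -> slice (stem_dz G) (a%:A + b *: J) = 0.
    move=> Dab uJ; have Cx : circularization D (a%:A + b *: J) by exists a, b, J.
    rewrite -(g0 _ Cx); apply: slice_congr; apply/esym/sof => //.
    exact: (circularizationP _ cD).1 Cx.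
  have pos a b : D (a, b) -> 0 < b -> hasd G (a, b) 0 0.
    move=> Dab b0; have h := hX _ Dab.
    have e : stem_dz G (a, b) = 0.
      by apply: polar_stem_dz b0 => J uJ; exact: s0.
    by rewrite e in h; apply: (hasd_eq h) => //; rewrite /hci /= oppr0.
  move=> [a b] Dab; case: (ltrgt0P b) => [b0|b0|b0].
  - exact: pos.
  - have h := pos a (- b) (cD _ _ Dab) ltac:(by rewrite oppr_gt0).
    have := hasd_stem_conj oD cD gG.1 (cD _ _ Dab) h; rewrite opprK => h'.
    by apply: (hasd_eq h'); rewrite /hc_conj /= ?oppr0 //; apply: injective_projections; rewrite /= oppr0.
  - rewrite b0 in Dab *; have h := hX _ Dab.
    have [X2 _ _] := hasd_stem_real oD cD gG.1 Dab h.
    have := s0 a 0 qi Dab qi_unit; rewrite scale0r addr0 slice_real => X1.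
    have e : stem_dz G (a, 0) = 0 by rewrite [LHS]surjective_pairing X1 X2.
    by rewrite e in h; apply: (hasd_eq h) => //; rewrite /hci /= oppr0.
split.
  exists G => // z Dz; split; first by case: (hG z Dz).
  move=> h; rewrite !(hasd_diff _ (hG z Dz)) !scaler0 !addr0 hc_mul_iota.
  by rewrite /hci /= oppr0.
move=> x Cx; have Dz := (circularizationP _ cD).1 Cx.
have e : stem_dz G (q0 x, qimnorm x) = 0.
  by apply: dz; apply: (hasd_eq (hG _ Dz)) => //; rewrite /hci /= oppr0.
by rewrite /slice_derivative /slice (sof G) // e /= mulr0 addr0.
Qed.

(** Local constancy is transported to [circularization D], which is connected by assumption; the
    halves of [D] above and below the axis may carry different values. *)
Lemma stem_constant D G : axially_symmetric_domain D ->
  (forall z, D z -> hasd G z 0 0) -> forall x y,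
  circularization D x -> circularization D y ->
  G (q0 x, qimnorm x) = G (q0 y, qimnorm y).
Proof.
move=> [oD cD oC ccD] hG.
apply: (connected_locally_cst (f := fun x => G (q0 x, qimnorm x)) oC ccD).
move=> x Cx; have Dz := (circularizationP _ cD).1 Cx.
have nD : \forall w \near (q0 x, qimnorm x), D w by apply: open_nbhs_nbhs.
have n1 : \forall w \near (q0 x, qimnorm x), (G w).1 = (G (q0 x, qimnorm x)).1.
  apply: (@hasd0_locally_cst _ (fun w => (G w).1)); apply: filterS nD => w Dw.
  exact: ((hasdP _ _ _ _).1 (hG w Dw)).1.
have n2 : \forall w \near (q0 x, qimnorm x), (G w).2 = (G (q0 x, qimnorm x)).2.
  apply: (@hasd0_locally_cst _ (fun w => (G w).2)); apply: filterS nD => w Dw.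
  exact: ((hasdP _ _ _ _).1 (hG w Dw)).2.
apply: (near_polar (P := fun w => G w = G (q0 x, qimnorm x))).
by apply: filterS2 n1 n2 => w e1 e2; rewrite [LHS]surjective_pairing e1 e2 -surjective_pairing.
Qed.

Lemma stem_real D G (a : R) : stem_function D G -> D (a, 0) -> (G (a, 0)).2 = 0.
Proof.
move=> sG Da; apply: quat_double0.
by have := sG _ _ Da; rewrite oppr0 => {1}->.
Qed.

Lemma quat_inverse lam : lam <> 0 -> exists2 mu, lam * mu = 1 & mu * lam = 1.
Proof.
move=> lam0; pose n : R := q0 lam ^+ 2 + q1 lam ^+ 2 + q2 lam ^+ 2 + q3 lam ^+ 2.
have h0 := sqr_ge0 (q0 lam); have h1 := sqr_ge0 (q1 lam).
have h2 := sqr_ge0 (q2 lam); have h3 := sqr_ge0 (q3 lam).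
have n0 : n != 0.
  apply/eqP => n0; apply: lam0.
  have z (t : R) : t ^+ 2 <= 0 -> t = 0.
    by move=> t0; apply/eqP; rewrite -sqrf_eq0 eq_le t0 sqr_ge0.
  by apply: quatP; rewrite linear0; apply: z; rewrite /n in n0; lra.
exists (n^-1 *: qconj lam); apply: quatP; rewrite ?(qscalel, qscaler) !(qZ, mkqE);
  apply: (mulfI n0); rewrite mulrA divff // mul1r /n; ring.
Qed.

End EigenfunctionRepresentation.

(** * Passing between eigenfunctions and stems with [dH/dz = H lam] *)

Section EigenfunctionClassification.
Set Implicit Arguments.
Unset Strict Implicit.
Context {R : realType}.
Implicit Types (x c J lam mu : quat R) (D : set (R * R)) (z : R * R)
  (F G H : R * R -> quat R * quat R) (f g : quat R -> quat R).

(* The stem of [c + laplacian (slice H)] off the real axis, if [dH/dz = H lam]. *)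
Definition lap_stem c lam H z : quat R * quat R :=
  (c - 2 *: (z.2^-1 *: ((H z).2 * lam)),
   2 *: (z.2^-1 *: ((H z).1 * lam)) - 2 *: (z.2^-1 *: (z.2^-1 *: (H z).2))).

(* [dH/dz = H lam] with [H] holomorphic at [z]. *)
Definition exp_like lam H z := hasd H z (hcr (H z) lam) (hci (hcr (H z) lam)).

Lemma lap_stem_stem D c lam H : stem_function D H -> stem_function D (lap_stem c lam H).
Proof.
move=> sH a b Dab; rewrite /lap_stem (sH _ _ Dab) /hc_conj /= invrN mulNr.
rewrite !scaleNr !scalerN !opprK; congr (_, _).
by rewrite opprD opprK.
Qed.

Lemma exp_like_hcr lam H z : exp_like lam H z ->
  hasd (fun w => hcr (H w) lam) z (hcr (hcr (H z) lam) lam) (hci (hcr (hcr (H z) lam) lam)).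
Proof.
move=> /hasdP[h1 h2]; apply/hasdP; split; last exact: (hasd_mulr lam h2).
by apply: (hasd_eq (hasd_mulr lam h1)) => //=; rewrite mulNr.
Qed.

Lemma laplacian_exp_like c lam H x : qimnorm x != 0 ->
  (\forall w \near (q0 x, qimnorm x), exp_like lam H w) ->
  c + laplacian (slice H) x = slice (lap_stem c lam H) x.
Proof.
move=> r0 hH; have hK := exp_like_hcr (nbhs_singleton hH).
rewrite (laplacian_slice r0 hH hK) /slice /lap_stem /= addrA.
by rewrite expr2 !scalerA mulrA.
Qed.

Lemma hasd_inv2 z : z.2 != 0 ->
  hasd (fun w : R * R => w.2^-1 : R) z 0 (- (z.2^-1 * z.2^-1)).
Proof.
move=> z0; apply: hasd_snd.
have := is_deriveV (f := id) z0 (is_derive_id z.2 1).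
move=> /is_derive_eq; apply.
by rewrite /GRing.scale /= mulr1 expr2 invfM.
Qed.

Let lap_stem_algebra1 (i : R) (c H1 H2 lam : quat R) : c * lam = 0 ->
  0 - 2 *: (i *: (H2 * lam * lam) + 0 *: (H2 * lam)) = (c - 2 *: (i *: (H2 * lam))) * lam.
Proof.
move=> cl; rewrite (mulrBl lam) cl !qscalel; move: (H2 * lam * lam) (H2 * lam) => A B.
by apply: quatP; rewrite !(qD, qN, qZ) ?linear0; ring.
Qed.

Let lap_stem_algebra2 (i : R) (H1 H2 lam : quat R) :
  0 - 2 *: (i *: (H1 * lam * lam) + (- (i * i)) *: (H2 * lam)) =
  - ((2 *: (i *: (H1 * lam)) - 2 *: (i *: (i *: H2))) * lam).
Proof.
rewrite (mulrBl lam) !qscalel; move: (H1 * lam * lam) (H2 * lam) => A B.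
by apply: quatP; rewrite !(qD, qN, qZ) ?linear0; ring.
Qed.

Let lap_stem_algebra3 (i : R) (H1 H2 lam : quat R) :
  2 *: (i *: (H1 * lam * lam) + 0 *: (H1 * lam)) -
    2 *: (i *: (i *: (H2 * lam) + 0 *: H2) + 0 *: (i *: H2)) =
  (2 *: (i *: (H1 * lam)) - 2 *: (i *: (i *: H2))) * lam.
Proof.
rewrite (mulrBl lam) !qscalel; move: (H1 * lam * lam) (H1 * lam) (H2 * lam) => A B C.
by apply: quatP; rewrite !(qD, qN, qZ) ?linear0; ring.
Qed.

Let lap_stem_algebra4 (i : R) (c H1 H2 lam : quat R) : c * lam = 0 ->
  2 *: (i *: (- (H2 * lam) * lam) + (- (i * i)) *: (H1 * lam)) -
    2 *: (i *: (i *: (H1 * lam) + (- (i * i)) *: H2) + (- (i * i)) *: (i *: H2)) =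
  (c - 2 *: (i *: (H2 * lam))) * lam -
    (2 * i) *: (2 *: (i *: (H1 * lam)) - 2 *: (i *: (i *: H2))).
Proof.
move=> cl; rewrite (mulrBl lam) cl !qscalel mulNr; move: (H2 * lam * lam) (H1 * lam) => A B.
by apply: quatP; rewrite !(qD, qN, qZ) ?linear0; ring.
Qed.

(** [c * lam = 0] covers both uses: [c = 0] with any [lam], and any [c] with [lam = 0]. *)
Lemma hasd_lap_stem c lam H z : c * lam = 0 -> z.2 != 0 -> exp_like lam H z ->
  hasd (lap_stem c lam H) z (hcr (lap_stem c lam H z) lam)
    (- ((lap_stem c lam H z).2 * lam),
     (lap_stem c lam H z).1 * lam - (2 * z.2^-1) *: (lap_stem c lam H z).2).
Proof.
move=> cl z0 /hasdP[h1 h2]; have hi := hasd_inv2 z0.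
apply/hasdP; split.
  apply: (hasd_eq (hasdB (hasd_cst c z) (hasd_scalec 2 (hasd_scale hi (hasd_mulr lam h2))))).
    exact: lap_stem_algebra1 (H z).1 _ _ cl.
  exact: lap_stem_algebra2.
apply: (hasd_eq (hasdB (hasd_scalec 2 (hasd_scale hi (hasd_mulr lam h1)))
  (hasd_scalec 2 (hasd_scale hi (hasd_scale hi h2))))).
  exact: lap_stem_algebra3.
exact: lap_stem_algebra4.
Qed.

Lemma product_domain_nonreal D : product_domain D ->
  (forall z, D z -> z.2 != 0) /\ (forall x, circularization D x -> qimnorm x != 0).
Proof.
move=> [[_ cD _ _] pD].
have h z : D z -> z.2 != 0.
  case: z => a b /= Dab; apply/eqP => b0; rewrite b0 in Dab.
  suff : (circularization D `&` @real_axis R) a%:A by rewrite pD.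
  split; last by exists a.
  by exists a, 0, qi; split => //; [exact: qi_unit|rewrite scale0r addr0].
by split => // x /(circularizationP _ cD) /h.
Qed.

Lemma exp_like_eigen D c lam H f : product_domain D -> c * lam = 0 ->
  stem_function D H -> (forall z, D z -> exp_like lam H z) ->
  (forall x, circularization D x -> f x = c + laplacian (slice H) x) ->
  eigen_solution D lam f.
Proof.
move=> pD cl sH hH fE; have [nD nO] := product_domain_nonreal pD.
have [[oD cD oC _] _] := pD.
pose Y z := (lap_stem c lam H z).1 * lam - (2 * z.2^-1) *: (lap_stem c lam H z).2.
have hL z (Dz : D z) := hasd_lap_stem cl (nD z Dz) (hH z Dz).
have fF : induced_by D f (lap_stem c lam H).
  split; first exact: lap_stem_stem.
  move=> x Cx; have nDx : \forall w \near (q0 x, qimnorm x), D w.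
    by apply: open_nbhs_nbhs; split => //; exact: (circularizationP _ cD).1 Cx.
  have nH : \forall w \near (q0 x, qimnorm x), exp_like lam H w.
    by apply: filterS nDx => w; exact: hH.
  by rewrite (fE x Cx); exact: laplacian_exp_like (nO x Cx) nH.
have vL : vekua D lam (lap_stem c lam H) Y.
  move=> z Dz; split; first exact: hL.
    rewrite /Y scalerBr scalerA mulrCA divff ?nD // mulr1.
    by [].
  by move=> z0; have := nD z Dz; rewrite z0 eqxx.
have cY z : D z -> {for z, continuous Y}.
  move=> Dz; have /hasdP[h1 h2] := hL z Dz.
  have [d _] := hasdB (hasd_mulr lam h1)
    (hasd_scale (hasd_scalec 2 (hasd_inv2 (nD z Dz))) h2).
  exact: differentiable_continuous d.
exact: (vekua_eigen oD cD oC fF vL cY).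
Qed.

Lemma hc_mul_stem D F G : stem_function D F -> stem_function D G ->
  stem_function D (fun z => hc_mul (F z) (G z)).
Proof. by move=> sF sG a b Dab; rewrite (sF _ _ Dab) (sG _ _ Dab) hc_mul_conj. Qed.

Lemma exp_like_mul_exp_stem lam G z : hasd G z 0 0 ->
  exp_like lam (fun w => hc_mul (G w) (exp_stem lam w)) z.
Proof.
move=> hG; have m0 (u : quat R * quat R) : hc_mul 0 u = 0.
  by rewrite /hc_mul /= !mul0r subr0 addr0.
apply: (hasd_eq (hasd_hc_mul hG (hasd_exp_stem lam z))).
  by rewrite m0 addr0 hc_mulcr.
by rewrite m0 addr0 hc_mulci hc_mulcr.
Qed.

Lemma hc_mulrc lam (u v : quat R * quat R) :
  lam * v.1 = v.1 * lam -> lam * v.2 = v.2 * lam ->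
  hc_mul (hcr u lam) v = hcr (hc_mul u v) lam.
Proof.
by move=> c1 c2; rewrite /hc_mul /hcr /= mulrBl mulrDl -!mulrA c1 c2.
Qed.

(** The exponential commutes with [lam], so the two terms of the product rule are opposite. *)
Lemma exp_like_div_exp_stem lam H z : exp_like lam H z ->
  hasd (fun w => hc_mul (H w) (exp_stem (- lam) w)) z 0 0.
Proof.
move=> hH.
have [c1 c2] := exp_stem_comm (- lam) z.
have e : hc_mul (H z) (hcr (exp_stem (- lam) z) (- lam)) + hc_mul (hcr (H z) lam) (exp_stem (- lam) z) = 0.
  rewrite hc_mulrc; [|by apply: oppr_inj; rewrite -mulNr -mulrN..].
  rewrite hc_mulcr; apply: injective_projections => /=.
    by rewrite mulrN addNr.
  by rewrite mulrN addNr.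
apply: (hasd_eq (hasd_hc_mul hH (hasd_exp_stem (- lam) z))) => //.
rewrite hc_mulci hc_mulir.
have -> (u v : quat R * quat R) : hci u + hci v = hci (u + v).
  by rewrite /hci /=; apply: injective_projections => //=; rewrite opprD.
by rewrite e /hci /= oppr0.
Qed.

(* Inverts [lap_stem 0 lam] when [mu = lam^-1]. *)
Definition pre_stem lam mu F z : quat R * quat R :=
  (- (2^-1 *: (((F z).1 - z.2 *: ((F z).2 * lam)) * mu * mu)),
   - (2^-1 *: (z.2 *: ((F z).1 * mu)))).

Lemma pre_stem_stem D lam mu F : stem_function D F -> stem_function D (pre_stem lam mu F).
Proof.
move=> sF a b Dab; rewrite /pre_stem (sF _ _ Dab) /hc_conj /=.
by rewrite mulNr scaleNr scalerN !opprK scaleNr scalerN !opprK.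
Qed.

Let pre_stem_algebra1 (b : R) (A B lam mu : quat R) : lam * mu = 1 -> mu * lam = 1 ->
  - (2^-1 *: ((A * lam - (b *: (B * lam * lam) + 0 *: (B * lam))) * mu * mu)) =
  - (2^-1 *: ((A - b *: (B * lam)) * mu * mu)) * lam.
Proof.
move=> lm ml; rewrite scale0r addr0 -(qscalel b (B * lam) lam) -(mulrBl lam A).
move: (A - _) => M.
by rewrite -(mulrA M lam) lm mulr1 mulNr qscalel -(mulrA _ mu lam) ml mulr1.
Qed.

Let pre_stem_algebra2 (b : R) (A B Y lam mu : quat R) : lam * mu = 1 -> mu * lam = 1 ->
  b *: Y = b *: (A * lam) - 2 *: B ->
  - (2^-1 *: ((- (B * lam) - (b *: (Y * lam) + 1 *: (B * lam))) * mu * mu)) =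
  - (- (2^-1 *: (b *: (A * mu))) * lam).
Proof.
move=> lm ml eY; rewrite -(qscalel b Y lam) eY (mulrBl lam) !qscalel scale1r.
have -> : - (B * lam) - (b *: (A * lam * lam) - 2 *: (B * lam) + B * lam) =
    (- (b *: A)) * (lam * lam).
  rewrite (mulNr (b *: A)) (qscalel b A) (mulrA A); move: (B * lam) (A * lam * lam) => M N.
  by apply: quatP; rewrite !(qD, qN, qZ); ring.
rewrite !mulNr !qscalel -!mulrA ml mulr1 (mulrA lam mu) lm mul1r lm mulr1.
by rewrite opprK scalerN opprK.
Qed.

Let pre_stem_algebra3 (b : R) (A lam mu : quat R) : lam * mu = 1 -> mu * lam = 1 ->
  - (2^-1 *: (b *: (A * lam * mu) + 0 *: (A * mu))) = - (2^-1 *: (b *: (A * mu))) * lam.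
Proof.
by move=> lm ml; rewrite scale0r addr0 mulNr !qscalel -!mulrA lm ml.
Qed.

Let pre_stem_algebra4 (b : R) (A B lam mu : quat R) : lam * mu = 1 -> mu * lam = 1 ->
  - (2^-1 *: (b *: (- (B * lam) * mu) + 1 *: (A * mu))) =
  - (2^-1 *: ((A - b *: (B * lam)) * mu * mu)) * lam.
Proof.
move=> lm ml; rewrite scale1r !mulNr (qscalel 2^-1) -(mulrA _ mu lam) ml mulr1.
by congr (- (_ *: _)); rewrite (mulrBl mu) (qscalel b) scalerN addrC.
Qed.

(** In the [b]-derivative of [A - b B lam], the last equation of the system replaces [b B_b] and its
    term [2 B] cancels both copies of [B lam], leaving [- b A lam^2]. Nothing is divided by [b], so
    real points are included. *)
Lemma pre_stem_exp_like lam mu F z (Y : quat R) : lam * mu = 1 -> mu * lam = 1 ->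
  hasd F z (hcr (F z) lam) (- ((F z).2 * lam), Y) ->
  z.2 *: Y = z.2 *: ((F z).1 * lam) - 2 *: (F z).2 ->
  exp_like lam (pre_stem lam mu F) z.
Proof.
move=> lm ml /hasdP[/= h1 h2] eY.
have hb := hasd_snd (is_derive_id z.2 1).
apply/hasdP; split.
  apply: (hasd_eq (hasdN (hasd_scalec 2^-1 (hasd_mulr mu (hasd_mulr mu
    (hasdB h1 (hasd_scale hb (hasd_mulr lam h2)))))))).
    exact: pre_stem_algebra1.
  exact: pre_stem_algebra2.
apply: (hasd_eq (hasdN (hasd_scalec 2^-1 (hasd_scale hb (hasd_mulr mu h1))))).
  exact: pre_stem_algebra3.
exact: pre_stem_algebra4.
Qed.

Lemma lap_stem_pre_stem lam mu F z : lam * mu = 1 -> mu * lam = 1 -> z.2 != 0 ->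
  lap_stem 0 lam (pre_stem lam mu F) z = F z.
Proof.
move=> lm ml b0; rewrite /lap_stem /pre_stem.
have lmK (p : quat R) : p * lam * mu = p by rewrite -mulrA lm mulr1.
have mlK (p : quat R) : p * mu * lam = p by rewrite -mulrA ml mulr1.
case: (F z) => A B; apply: injective_projections; rewrite /=.
  by rewrite mulNr !qscalel mlK; apply: quatP; rewrite !(qD, qN, qZ) ?linear0; field.
rewrite mulNr qscalel mlK mulrBl qscalel lmK; move: (A * mu) => M.
by apply: quatP; rewrite !(qD, qN, qZ); field.
Qed.

Lemma eigen_representation D lam f F : lam <> 0 -> axially_symmetric_domain D ->
  induced_by D f F -> C1_on D F -> eigen_solution D lam f ->
  exists mu G, [/\ lam * mu = 1 /\ mu * lam = 1, stem_function D G,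
    forall z, D z -> hasd G z 0 0 &
    forall z, hc_mul (G z) (exp_stem lam z) = pre_stem lam mu F z].
Proof.
move=> lam0 aD fF C1 ef; have [mu lm ml] := quat_inverse lam0.
exists mu, (fun z => hc_mul (pre_stem lam mu F z) (exp_stem (- lam) z)); split => //.
- apply: hc_mul_stem; first exact: pre_stem_stem fF.1.
  by move=> a b _; exact: exp_stem_conj.
- move=> z Dz; have [Y hY eY] := eigen_vekua aD fF C1 ef Dz.
  exact: exp_like_div_exp_stem (pre_stem_exp_like lm ml hY eY).
- by move=> z; rewrite -hc_mulA exp_stem_invN hc_mulr1.
Qed.

End EigenfunctionClassification.

(** * The kernels on slice domains and on product domains *)

Section MainCases.
Set Implicit Arguments.
Unset Strict Implicit.
Context {R : realType}.
Implicit Types (x c lam : quat R) (D : set (R * R)) (z : R * R)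
  (F G H : R * R -> quat R * quat R) (f g : quat R -> quat R).

Lemma eigen_qexp lam : eigen_solution setT lam (laplacian (qexp lam)).
Proof.
apply: (@eigen_lap_exp_stemM R setT 1); first exact: openT.
- by [].
- by rewrite circularization_setT; exact: openT.
- by move=> x _; rewrite laplacian_qexp lap_exp_stem1.
Qed.

Lemma slice_domain_real D : slice_domain D -> exists a : R, D (a, 0).
Proof.
move=> [[_ cD _ _] [x [Cx [a xE]]]]; exists a.
by have := (circularizationP x cD).1 Cx; rewrite xE (polar_real a).1 (polar_real a).2.
Qed.

Lemma stem_constant_slice D G : slice_domain D -> stem_function D G ->
  (forall z, D z -> hasd G z 0 0) ->
  exists c, forall x, circularization D x -> G (q0 x, qimnorm x) = (c, 0).
Proof.
move=> sD sG hG; have [a Da] := slice_domain_real sD; have [aD _] := sD.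
have [_ cD _ _] := aD; have [a0 a1] := polar_real a.
exists (G (a, 0)).1 => x Cx.
have Ca : circularization D (a%:A : quat R) by apply/circularizationP; rewrite // a0 a1.
rewrite (stem_constant aD hG Cx Ca) a0 a1 [LHS]surjective_pairing.
by rewrite (stem_real sG Da).
Qed.

Lemma hc_mul_cst c (v : quat R * quat R) : hc_mul (c, 0) v = (c * v.1, c * v.2).
Proof. by rewrite /hc_mul /= !mul0r subr0 addr0. Qed.

Lemma slice_lap_stem lam H x : let w := (qimnorm x)^-1 in let z := (q0 x, qimnorm x) in
  slice (lap_stem 0 lam H) x = - ((2 * w) *: ((H z).2 * lam)) +
    qimdir x * ((2 * w) *: ((H z).1 * lam) - (2 * w ^+ 2) *: (H z).2).
Proof. by move=> w z; rewrite /slice /lap_stem /= sub0r expr2 !scalerA mulrA. Qed.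

Lemma eigen_slice D lam f : lam <> 0 -> slice_domain D ->
  eigen_solution D lam f <->
  exists c, forall x, circularization D x ->
    f x = slice_mul D (fun=> c) (laplacian (qexp lam)) x.
Proof.
move=> lam0 sD; have [aD _] := sD; have [oD cD oC _] := aD.
split=> [ef|[c fE]]; last first.
  by apply: (@eigen_lap_exp_stemM R D c) => // x Cx; rewrite fE // slice_mul_cst.
have [[[F fF C1] _] _] := ef.
have [mu [G [[lm ml] sG hG GE]]] := eigen_representation lam0 aD fF C1 ef.
have [c Gc] := stem_constant_slice sD sG hG; exists c => x Cx.
rewrite slice_mul_cst // fF.2 //.
have hE : pre_stem lam mu F (q0 x, qimnorm x) = hc_mul (c, 0) (exp_stem lam (q0 x, qimnorm x)).
  by rewrite -GE Gc.
rewrite hc_mul_cst in hE.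
(* At a real point [lap_stem] cannot recover [F]; instead the first component of [hE] reads
   [- A mu^2 / 2 = c exp(a lam)] and yields [A] directly. *)
have [r0|r0] := eqVneq (qimnorm x) 0.
  have xE := real_of_qimnorm0 r0; rewrite r0 in hE; rewrite xE !slice_real.
  move: hE => /(congr1 fst); rewrite /= scale0r subr0 /qco (rexp_0 _ _).1 mulr1 => h.
  rewrite (qsc_at0 lam).1 mulrN -scalerAr !mulrA -h.
  rewrite mulNr -scalerAl -(mulrA _ mu lam) ml mulr1 mulNr -scalerAl -(mulrA _ mu lam) ml mulr1.
  by rewrite scalerN opprK scalerA divff ?scale1r // pnatr_eq0.
rewrite (slice_lap_exp_stemM c lam r0).
transitivity (slice (lap_stem 0 lam (pre_stem lam mu F)) x).
  by apply: slice_congr; rewrite lap_stem_pre_stem.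
by rewrite slice_lap_stem hE.
Qed.

(** For [lam = 0] the last equation is [b B_b = - 2 B], so the [b]-derivative [2 b B + b (b B_b)] of
    [b^2 B] vanishes. *)
Lemma eigen0_stem D f F : axially_symmetric_domain D -> induced_by D f F ->
  C1_on D F -> eigen_solution D 0 f ->
  let N z := ((F z).1, z.2 *: (z.2 *: (F z).2)) in
  stem_function D N /\ forall z, D z -> hasd N z 0 0.
Proof.
move=> aD fF C1 ef N; split.
  move=> a b Dab; rewrite /N (fF.1 _ _ Dab) /hc_conj /=.
  by rewrite !(scalerN, scaleNr, opprK).
move=> z Dz; have [Y /hasdP[/= h1 h2] eY] := eigen_vekua aD fF C1 ef Dz.
have hb := hasd_snd (is_derive_id z.2 1).
apply/hasdP; split.
  by apply: (hasd_eq h1); rewrite mulr0 ?oppr0.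
apply: (hasd_eq (hasd_scale hb (hasd_scale hb h2))).
  by rewrite mulr0 !scale0r !(scaler0, addr0).
rewrite eY mulr0 scaler0 sub0r !scale1r scalerDr !scalerN.
by apply: quatP; rewrite !(qD, qN, qZ) linear0; ring.
Qed.

Lemma exp_like0 H z : hasd H z 0 0 -> exp_like 0 H z.
Proof.
move=> h; apply: (hasd_eq h); apply: injective_projections; rewrite /= ?mulr0 ?oppr0 //.
Qed.

(** The constant value of [b^2 B] is 0, its value on the real axis, so [B = 0] off the axis. *)
Lemma eigen0_slice D : slice_domain D ->
  eigen_ker D 0 = [set f : quat R -> quat R | exists c : quat R,
    forall x, circularization D x -> f x = c].
Proof.
move=> sD; have [aD _] := sD; have [oD cD oC _] := aD.
apply/seteqP; split => f /=.
  move=> /eigen_kerP ef; have [[[F fF C1] _] _] := ef.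
  have [sN hN] := eigen0_stem aD fF C1 ef.
  have [c Nc] := stem_constant_slice sD sN hN; exists c => x Cx.
  have [N1 N2] : (F (q0 x, qimnorm x)).1 = c /\
      qimnorm x *: (qimnorm x *: (F (q0 x, qimnorm x)).2) = 0.
    by have := Nc x Cx; case.
  rewrite fF.2 // /slice N1.
  have [r0|r0] := eqVneq (qimnorm x) 0.
    by rewrite /qimdir r0 invr0 scale0r mul0r addr0.
  by rewrite -(scaler0 _ (qimnorm x)) in N2; move/(scalerI r0): N2;
    rewrite -(scaler0 _ (qimnorm x)) => /(scalerI r0) ->; rewrite mulr0 addr0.
move=> [c fE]; apply/eigen_kerP.
have fF : induced_by D f (fun=> (c, 0)).
  split; first exact: (induced_cst D c).1.
  by move=> x Cx; rewrite fE //; exact: (induced_cst D c).2.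
have vF : vekua D 0 (fun=> (c, 0)) (fun=> 0).
  move=> z _; split => /=.
  - by apply: (hasd_eq (hasd_cst (c, 0 : quat R) z)); rewrite /hcr /= !mulr0 ?oppr0.
  - by rewrite mulr0 !scaler0 subrr.
  - by rewrite mulr0 scaler0.
by apply: (vekua_eigen oD cD oC fF vF) => z _; exact: cst_continuous.
Qed.

(** [slice_mul] is built from chosen stems and is tied to the product of the given ones only on the
    circularization; that set is open and the Laplacian is local. *)
Lemma laplacian_slice_mul_qexp D g G lam x : product_domain D -> induced_by D g G ->
  (forall z, D z -> hasd G z 0 0) -> circularization D x ->
  laplacian (slice_mul D g (qexp lam)) x =
  laplacian (slice (fun z => hc_mul (G z) (exp_stem lam z))) x.
Proof.
move=> [[oD cD oC _] _] gG hG Cx; apply: laplacian_near.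
have : \forall y \near x, circularization D y by apply: open_nbhs_nbhs.
by apply: filterS => y Cy; exact: slice_mulE cD gG (induced_qexp D lam) Cy.
Qed.

Lemma eigen_product D lam : product_domain D -> lam <> 0 ->
  eigen_ker D lam = [set f : quat R -> quat R | exists2 g, slice_constant D g &
    forall x, circularization D x -> f x = laplacian (slice_mul D g (qexp lam)) x].
Proof.
move=> pD lam0; have [aD _] := pD; have [oD cD oC _] := aD.
have [nD nO] := product_domain_nonreal pD.
apply/seteqP; split => f /=.
  move=> /eigen_kerP ef; have [[[F fF C1] _] _] := ef.
  have [mu [G [[lm ml] sG hG GE]]] := eigen_representation lam0 aD fF C1 ef.
  have gG := induced_slice sG.
  exists (slice G); first by apply/slice_constantP => //; exists G.
  move=> x Cx; rewrite (laplacian_slice_mul_qexp lam pD gG hG Cx) -[RHS]add0r.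
  have nDx : \forall w \near (q0 x, qimnorm x), D w.
    by apply: open_nbhs_nbhs; split => //; exact: (circularizationP x cD).1 Cx.
  have nH : \forall w \near (q0 x, qimnorm x),
      exp_like lam (fun z => hc_mul (G z) (exp_stem lam z)) w.
    by apply: filterS nDx => w Dw; apply: exp_like_mul_exp_stem; exact: hG.
  rewrite (laplacian_exp_like 0 (nO x Cx) nH) fF.2 //; apply: slice_congr.
  rewrite -(lap_stem_pre_stem F lm ml (nO x Cx : (q0 x, qimnorm x).2 != 0)).
  by rewrite /lap_stem GE.
move=> [g /(slice_constantP _ oD cD)[G gG hG] fE]; apply/eigen_kerP.
have e x : circularization D x ->
    f x = 0 + laplacian (slice (fun z => hc_mul (G z) (exp_stem lam z))) x.
  by move=> Cx; rewrite (fE x Cx) add0r (laplacian_slice_mul_qexp lam pD gG hG Cx).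
have sH := hc_mul_stem gG.1 (induced_qexp D lam).1.
exact: (exp_like_eigen pD (mul0r lam) sH (fun z Dz => exp_like_mul_exp_stem lam (hG z Dz)) e).
Qed.

Lemma eigen0_product D : product_domain D ->
  eigen_ker D 0 = [set f : quat R -> quat R | exists c : quat R, exists2 g,
    slice_constant D g & forall x, circularization D x -> f x = c + laplacian g x].
Proof.
move=> pD; have [aD _] := pD; have [oD cD oC _] := aD.
have [nD nO] := product_domain_nonreal pD.
apply/seteqP; split => f /=.
  move=> /eigen_kerP ef; have [[[F fF C1] _] _] := ef.
  have [sN hN] := eigen0_stem aD fF C1 ef.
  have [c Nc] : exists c, forall x, circularization D x -> (F (q0 x, qimnorm x)).1 = c.
    (* A product domain as defined may be empty; then any constant serves. *)
    have [[x0 Cx0]|nC] := pselect (exists x, circularization D x).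
      exists (F (q0 x0, qimnorm x0)).1 => x Cx.
      by have := stem_constant aD hN Cx Cx0; case.
    by exists 0 => x Cx; case: nC; exists x.
  (* With [dG/dz = 0] the Laplacian has stem [(0, - 2 G2 / b^2)]; equating the second component with
     [B] gives this [G]. *)
  pose G z : quat R * quat R := (0, - (2^-1 *: (z.2 *: (z.2 *: (F z).2)))).
  have sG : stem_function D G.
    move=> a b Dab; have := sN a b Dab; rewrite /hc_conj /= => -[_ e].
    by rewrite /G /hc_conj /= e scalerN.
  have hG z : D z -> hasd G z 0 0.
    move=> Dz; have /hasdP[_ /= h2] := hN z Dz.
    apply/hasdP; split; first exact: hasd_cst.
    by apply: (hasd_eq (hasdN (hasd_scalec 2^-1 h2))); rewrite scaler0 oppr0.
  exists c, (slice G).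
    by apply/slice_constantP => //; exists G => //; exact: induced_slice.
  move=> x Cx; have r0 := nO x Cx.
  have nDx : \forall w \near (q0 x, qimnorm x), D w.
    by apply: open_nbhs_nbhs; split => //; exact: (circularizationP x cD).1 Cx.
  have nH : \forall w \near (q0 x, qimnorm x), exp_like 0 G w.
    by apply: filterS nDx => w Dw; apply: exp_like0; exact: hG.
  rewrite (laplacian_exp_like c r0 nH) fF.2 //; apply: slice_congr.
  rewrite [LHS]surjective_pairing (Nc x Cx) /lap_stem /=.
  rewrite !mulr0 !scaler0 subr0 sub0r !scalerN opprK; congr (_, _).
  by apply: quatP; rewrite !qZ; field.
move=> [c [g /(slice_constantP _ oD cD)[G gG hG] fE]]; apply/eigen_kerP.
have e x : circularization D x -> f x = c + laplacian (slice G) x.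
  move=> Cx; rewrite (fE x Cx) (laplacian_near (g := slice G)) //.
  exact: induced_near oC gG Cx.
exact: (exp_like_eigen pD (mulr0 c) gG.1 (fun z Dz => exp_like0 (hG z Dz)) e).
Qed.

Lemma scale_m4K (y : quat R) : - 4 *: (- 4^-1 *: y) = y.
Proof. by rewrite scalerA mulrNN divff ?scale1r // pnatr_eq0. Qed.

End MainCases.

Theorem proposition28 (R : realType) (lam : quat R) (D : set (R * R))
    (hD : axially_symmetric_domain D) :
  eigen_solution setT lam (laplacian (qexp lam)) /\
  (lam <> 0 -> slice_domain D ->
     forall f : quat R -> quat R,
       eigen_solution D lam f <->
       exists c : quat R, forall x, circularization D x ->
         f x = slice_mul D (fun=> c) (laplacian (qexp lam)) x) /\
  (lam = 0 -> slice_domain D ->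
     eigen_ker D 0 = [set f : quat R -> quat R | exists c : quat R,
       forall x, circularization D x -> f x = c]) /\
  (product_domain D -> lam <> 0 ->
     eigen_ker D lam = [set f : quat R -> quat R | exists2 g, slice_constant D g &
       forall x, circularization D x ->
         f x = laplacian (slice_mul D g (qexp lam)) x]) /\
  (product_domain D -> lam = 0 ->
     eigen_ker D 0 = [set f : quat R -> quat R | exists c : quat R, exists2 g,
       slice_constant D g &
       forall x, circularization D x -> f x = c + laplacian g x]) /\
  (forall x : quat R,
     let u := fun n : nat =>
       (n.+2)`!%:R^-1 *: (monogenic_poly n x * lam ^+ n.+2) in
     let v := fun n : nat =>
       (n.+2)`!%:R^-1 *:
         ((\sum_(1 <= k < n.+2)
              k%:R *: (x ^+ k.-1 * qconj x ^+ (n.+1 - k))) * lam ^+ n.+2) in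
     [/\ cvgn (series u), cvgn (series v),
         laplacian (qexp lam) x = - 4 *: limn (series u) &
         laplacian (qexp lam) x = - 4 *: limn (series v)]).
Proof.
split; first exact: eigen_qexp.
split; first by move=> lam0 sD f; exact: eigen_slice.
split; first by move=> _; exact: eigen0_slice.
split; first by move=> pD; exact: eigen_product.
split; first by move=> pD _; exact: eigen0_product.
move=> x u v; have ucv := @monogenic_series R lam x.
have uE : v = u.
  by apply/funext => n; rewrite /u /v monogenic_polyE.
have uc : cvgn (series u) by exact: cvgP ucv.
have ul : limn (series u) = - 4^-1 *: laplacian (qexp lam) x by exact: cvg_lim ucv.
by rewrite uE ul scale_m4K.
Qed.
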